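(* For any constant real $\varepsilon>0$ and constant positive integers $d$ and $k$ with $2\le k\le d$, there is a randomized algorithm which, given a set $S$ of $n$ points in $\mathbb{R}^d$ and a point $y\in\mathbb{R}^d$, returns $k$ points of $S$ whose affine hull has Euclidean distance from $y$ at most $(1+\varepsilon)$ times the minimum, over all choices of $k$ points of $S$, of the distance from $y$ to their affine hull. With high probability the algorithm runs in time $O_{\varepsilon}(n^{k-1}\log^{d-k+2} n)$.
   Context: This is the nearest induced flat problem (equivalently, sparse affine regression: given $A\in\mathbb{R}^{d\times n}$, $y\in\mathbb{R}^d$, find $x\in\mathbb{R}^n$ with at most $k$ nonzero entries and $\sum_i x_i=1$ minimizing $\|Ax-y\|_2$). The distance from a point to a flat is the Euclidean distance to the closest point of the flat. *)

(* Defs.v *)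
(* MathComp / MathComp-Analysis. *)
From mathcomp Require Import all_boot all_order all_algebra.
From mathcomp Require Import all_classical all_reals all_analysis.

Set Implicit Arguments.
Unset Strict Implicit.
Unset Printing Implicit Defensive.

Import Order.TTheory GRing.Theory Num.Theory.

Local Open Scope classical_set_scope.
Local Open Scope ring_scope.

(** * Flats *)

(* The library norm on 'rV[R]_d is the sup norm, hence this definition. *)
Definition enorm (R : realType) (d : nat) (v : 'rV[R]_d) : R :=
  Num.sqrt (\sum_(j < d) v 0 j ^+ 2).

Definition affine_hull (R : realType) (d : nat) (q : seq 'rV[R]_d) :
    set 'rV[R]_d :=
  [set x | exists a : 'I_(size q) -> R,
     \sum_i a i = 1 /\ x = \sum_i a i *: q`_i].

(* The infimum is attained when F is a (nonempty) flat. *)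
Definition flat_dist (R : realType) (d : nat) (y : 'rV[R]_d)
    (F : set 'rV[R]_d) : R :=
  inf [set enorm (y - x) | x in F].

Definition k_points (R : realType) (d k : nat) (S q : seq 'rV[R]_d) : bool :=
  [&& size q == k, uniq q & all [in S] q].

(** * Randomized real RAM

    A program is a finite piece of syntax, which mentions neither real
    constants nor the input size. It works on a fixed number of unbounded
    arrays, named by natural numbers; word arrays hold w-bit integers, with w
    proportional to the bit length of the input size, and real arrays hold
    exact reals. Arrays are indexed by words. The operations on reals are the
    four field operations and comparisons: no floor, no square root, no
    conversion from reals to words. *)

(* Arithmetic is modulo the word modulus, except that subtraction is truncated
   at 0; division by 0 is as in MathComp: x %/ 0 = 0 and x %% 0 = x. *)
Inductive wexp : Type :=
  | WConst of nat
  | WGet of nat & wexp              (* array name, index *)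
  | WAdd of wexp & wexp
  | WSub of wexp & wexp
  | WMul of wexp & wexp
  | WDiv of wexp & wexp
  | WRem of wexp & wexp.

Inductive rexp : Type :=
  | ROfWord of wexp
  | RGet of nat & wexp              (* array name, index *)
  | RAdd of rexp & rexp
  | RSub of rexp & rexp
  | RMul of rexp & rexp
  | RDiv of rexp & rexp.            (* division by 0 returns 0 *)

Inductive test : Type :=
  | WLe of wexp & wexp
  | RLe of rexp & rexp
  | TNot of test
  | TAnd of test & test.

Inductive cmd : Type :=
  | Skip
  | WSet of nat & wexp & wexp       (* array name, index, new value *)
  | RSet of nat & wexp & rexp       (* array name, index, new value *)
  | WRand of nat & wexp & wexp      (* array name, index, m: the cell receives
                                       a uniform element of {0, ..., m} *)
  | Seq of cmd & cmd
  | If of test & cmd & cmd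
  | While of test & cmd.

Record state (R : realType) : Type := State {
  words : nat -> nat -> nat;
  reals : nat -> nat -> R }.

Definition set_cell (T : Type) (m : nat -> nat -> T) (a i : nat) (v : T) :
    nat -> nat -> T :=
  fun a' i' => if (a' == a) && (i' == i) then v else m a' i'.

Section Semantics.
Variables (R : realType) (M : nat). (* M is the word modulus 2 ^ w *)
Implicit Type s : state R.

Fixpoint weval s (e : wexp) : nat :=
  match e with
  | WConst c => c %% M
  | WGet a i => words s a (weval s i)
  | WAdd e1 e2 => (weval s e1 + weval s e2) %% M
  | WSub e1 e2 => weval s e1 - weval s e2
  | WMul e1 e2 => (weval s e1 * weval s e2) %% M
  | WDiv e1 e2 => weval s e1 %/ weval s e2
  | WRem e1 e2 => weval s e1 %% weval s e2
  end%N.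

Fixpoint reval s (e : rexp) : R :=
  match e with
  | ROfWord e1 => (weval s e1)%:R
  | RGet a i => reals s a (weval s i)
  | RAdd e1 e2 => reval s e1 + reval s e2
  | RSub e1 e2 => reval s e1 - reval s e2
  | RMul e1 e2 => reval s e1 * reval s e2
  | RDiv e1 e2 => reval s e1 / reval s e2
  end.

Fixpoint teval s (b : test) : bool :=
  match b with
  | WLe e1 e2 => (weval s e1 <= weval s e2)%N
  | RLe e1 e2 => reval s e1 <= reval s e2
  | TNot b1 => ~~ teval s b1
  | TAnd b1 b2 => teval s b1 && teval s b2
  end.

(* The commands still to be executed, and the current memory; the machine has
   halted when no command is left. *)
Definition conf : Type := (seq cmd * state R)%type.

Definition choices (cf : conf) : nat :=
  if cf is (WRand _ _ e :: _, s) then (weval s e).+1 else 1%N.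

(* One unit of time; r is the outcome of the random draw. Charging one unit
   for a whole command is only a constant factor away from charging each
   elementary operation, as the expressions of a program have bounded size. *)
Definition step (cf : conf) (r : nat) : conf :=
  match cf with
  | ([::], _) => cf
  | (Skip :: K, s) => (K, s)
  | (WSet a i e :: K, s) =>
      (K, State (set_cell (words s) a (weval s i) (weval s e)) (reals s))
  | (RSet a i e :: K, s) =>
      (K, State (words s) (set_cell (reals s) a (weval s i) (reval s e)))
  | (WRand a i _ :: K, s) =>
      (K, State (set_cell (words s) a (weval s i) r) (reals s))
  | (Seq c1 c2 :: K, s) => (c1 :: c2 :: K, s)
  | (If b c1 c2 :: K, s) => ((if teval s b then c1 else c2) :: K, s)
  | (While b c :: K, s) =>
      (if teval s b then c :: While b c :: K else K, s)
  end.

Inductive reach : conf -> conf -> Prop :=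
  | reach_refl cf : reach cf cf
  | reach_step cf r cf' :
      (r < choices cf)%N -> reach (step cf r) cf' -> reach cf cf'.

(* Probability that a run from cf halts within t units of time, all the random
   draws being independent. *)
Fixpoint prob_halt (t : nat) (cf : conf) : R :=
  if cf.1 is [::] then 1 else
  if t is t'.+1 then
    (\sum_(r < choices cf) prob_halt t' (step cf r)) / (choices cf)%:R
  else 0.

End Semantics.

(** * Inputs and outputs *)

(* For n > 0, (trunc_log 2 n).+1 is the bit length of n. *)
Definition word_modulus (b n : nat) : nat := 2 ^ (b * (trunc_log 2 n).+1).

(* Word array 0 holds n in its cell 0, real array 0 holds the points of S in
   row-major order, real array 1 holds y, and every other cell holds 0. *)
Definition input (R : realType) (d n : nat) (S : n.-tuple 'rV[R]_d)
    (y : 'rV[R]_d) : state R :=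
  let coord (v : 'rV[R]_d) (j : nat) : R :=
    if insub j is Some j' then v 0 j' else 0 in
  State (fun a i => if (a == 0%N) && (i == 0%N) then n else 0%N)
        (fun a i => if a == 0%N then coord S`_(i %/ d) (i %% d)%N
                    else if a == 1%N then coord y i else 0).

(* The output is read in the first k cells of word array 1. *)
Definition output_indices (R : realType) (k : nat) (s : state R) : seq nat :=
  [seq words s 1 j | j <- iota 0 k].

(* Main.v *)
(* Write N for an integer larger than d / eps and V for the set of integer vectors
   of norm at most N. Every z is a combination of V with weights c >= 0 such that
   |z| <= N * sum c <= (1 + d / N) |z|. So it suffices to find k points having an
   affine combination x with y = x - sum c_v v and sum c as small as possible, a
   linear program. In homogeneous coordinates a basic optimal solution is supported
   by a basis made of a set T of points and a tuple tau of elements of V, with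
   |T| <= k and |T| + |tau| = d + 1; there are finitely many tau.

   If |T| < k, Cramer's rule gives the value of T, and T is a prefix of one of the
   n^(k-1) tuples of points. If |T| = k, split T into T0, with k - 2 points, and two
   points a, p. Fix T0, tau and a vector w such that T0, tau, y, w is a basis. Scale
   each point q to have coordinate 1 along w, and let al(q) and gam_i(q) be its
   coordinates along y and tau_i, and G = sum_i gam_i. The value of a, p is the
   slope (G(p) - G(a)) / (al(p) - al(a)), under the constraint that gam(a) <= gam(p)
   in each of the m = d + 1 - k coordinates. Replace the gam_i by their ranks: the
   constraint means that for some m-tuple of bit positions the ranks of a and p
   agree above these bits, and a has 0 and p has 1 there (the ranks being doubled,
   and that of p shifted by one, to separate equal ranks). For each of these
   O(log^m n) tuples the points are grouped by the leading bits of their ranks. In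
   a group, the points in the role of p are pushed by increasing al onto a stack
   that holds their lower convex hull. Then, for each a, the vertex p minimizing
   G - best * al is on top, where best is the least slope found so far. As best only
   decreases, vertices which are not minimal for it never become so again and are
   popped; hence a group is treated in linear time.

   Every candidate value bounds the distance to the flat of its k points divided by
   N, so the result is correct with probability 1; no random draw is needed. *)

Require Import Defs.
From mathcomp Require Import all_boot all_order all_algebra.
From mathcomp Require Import all_classical all_reals all_analysis.
From mathcomp Require Import perm zify ring lra.

Import Order.TTheory GRing.Theory Num.Theory.
Local Open Scope ring_scope.

Set Implicit Arguments.
Unset Strict Implicit.
Unset Printing Implicit Defensive.

(** * Deterministic execution *)

(** The machine has no square root, so no distance is ever computed. The value of the linear
    program, a rational function of the input, replaces it: N times the recorded value is at least
    the distance to the recorded flat, and at most 1 + d / N times the distance to any other. Norms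
    of net vectors are tested when the program is built, not when it runs. The vector w makes the
    problem separable. The coordinates of a point in the basis completed by w depend on that point
    alone, and eliminating w between a and p couples them only through differences, which is what
    makes hulls and sorting applicable. Bounds on the best value are kept in the product form best *
    (al(p) - al(a)) <= G(p) - G(a). It is meaningful for every sign of al(p) - al(a) and, as best >=
    0 and G(a) <= G(p), it survives every later decrease of best, so no finished stage has to be
    repeated. A round costs O(n log n) for the sorting and O(n log^m n) for the level tuples, with m
    >= 1; the exponent m + 1 of the statement leaves a logarithm to spare. *)

Section Execution.
Variables (R : realType) (M : nat).
Implicit Types (s : state R) (c : cmd) (K : seq cmd) (Q : nat -> state R -> Prop).

(** Only steps with a single outcome are allowed, so the run is forced: one such path to a halted
    state determines both the halting probability and every reachable halting state. *)
Inductive dpath : nat -> conf R -> conf R -> Prop :=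
  | dpath_refl cf : dpath 0 cf cf
  | dpath_step t c K s cf :
      choices M (c :: K, s) = 1%N ->
      dpath t (step M (c :: K, s) 0) cf -> dpath t.+1 (c :: K, s) cf.

Lemma dpath_trans t1 t2 cf1 cf2 cf3 :
  dpath t1 cf1 cf2 -> dpath t2 cf2 cf3 -> dpath (t1 + t2) cf1 cf3.
Proof.
elim=> [//|t c K s cf hc _ IH h]; rewrite addSn.
by apply: dpath_step => //; exact: IH.
Qed.

Lemma dpath_prob_halt t cf s :
  dpath t cf ([::], s) -> prob_halt M t cf = 1.
Proof.
move e : ([::], s) => cf' h; elim: h e => [_ <- //|{}t c K s' {}cf' hc _ IH e].
by rewrite [LHS]/= -/(choices M (c :: K, s')) hc big_ord1 IH // divr1.
Qed.

Lemma dpath_reach t cf cf' s :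
  dpath t cf cf' -> reach M cf ([::], s) -> reach M cf' ([::], s).
Proof.
elim=> [//|{}t c K s' {}cf' hc _ IH hr]; apply: IH.
inversion hr as [|cf1 r cf2 lt_r hr']; subst.
by move: lt_r hr'; rewrite hc; case: r.
Qed.

(** Quantifying over the continuation [K] lets executions be glued whatever commands remain to be
    executed. *)
Definition exec c t s s' : Prop :=
  forall K, dpath t (c :: K, s) (K, s').

(* Weakest precondition with running time: [Q t s'] speaks of the number [t] of
   steps and the final memory [s']. *)
Definition wp c s Q : Prop := exists t s', exec c t s s' /\ Q t s'.

Lemma wp_mono c s Q Q' :
  (forall t s', Q t s' -> Q' t s') -> wp c s Q -> wp c s Q'.
Proof. by move=> h [t [s' [hx hq]]]; exists t, s'; split=> //; exact: h. Qed.

Definition setw s a i v := State (set_cell (words s) a i v) (reals s).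
Definition setr s a i v := State (words s) (set_cell (reals s) a i v).

Lemma wp_skip s Q : Q 1%N s -> wp Skip s Q.
Proof.
move=> h; exists 1%N, s; split=> // K.
by apply: dpath_step => //; exact: dpath_refl.
Qed.

Lemma wp_wset a i e s Q :
  Q 1%N (setw s a (weval M s i) (weval M s e)) -> wp (WSet a i e) s Q.
Proof.
move=> h; exists 1%N; eexists; split; last exact: h.
by move=> K; apply: dpath_step => //; exact: dpath_refl.
Qed.

Lemma wp_rset a i e s Q :
  Q 1%N (setr s a (weval M s i) (reval M s e)) -> wp (RSet a i e) s Q.
Proof.
move=> h; exists 1%N; eexists; split; last exact: h.
by move=> K; apply: dpath_step => //; exact: dpath_refl.
Qed.

Lemma wp_seq c1 c2 s Q :
  wp c1 s (fun t1 s1 => wp c2 s1 (fun t2 s2 => Q (t1 + t2).+1 s2)) ->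
  wp (Seq c1 c2) s Q.
Proof.
move=> [t1 [s1 [h1 [t2 [s2 [h2 hq]]]]]]; exists (t1 + t2).+1, s2; split=> // K.
by apply: dpath_step => //=; apply: dpath_trans (h1 _) (h2 _).
Qed.

Lemma wp_if b c1 c2 s Q :
  (teval M s b -> wp c1 s (fun t => Q t.+1)) ->
  (~~ teval M s b -> wp c2 s (fun t => Q t.+1)) ->
  wp (If b c1 c2) s Q.
Proof.
move=> h1 h2.
have [t [s' [h hq]]] : wp (if teval M s b then c1 else c2) s (fun t => Q t.+1).
  by case: ifP => hb; [exact: h1|apply: h2; rewrite hb].
by exists t.+1, s'; split=> // K; apply: dpath_step => //=; exact: h.
Qed.

(* The potential [v] bounds the number of iterations. *)
Lemma wp_while b c (I : nat -> state R -> Prop) (T v : nat) s :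
  (forall v s, I v s -> teval M s b ->
     wp c s (fun t s' => (t <= T)%N /\ exists2 v', (v' < v)%N & I v' s')) ->
  I v s ->
  wp (While b c) s (fun t s' => ~~ teval M s' b /\
     exists v', [/\ (v' <= v)%N, (t + T.+1 * v' <= T.+1 * v + 1)%N & I v' s']).
Proof.
move=> hc; elim/ltn_ind: v s => v IH s hI.
have [hb|hb] := boolP (teval M s b); last first.
  exists 1%N, s; split; last by split=> //; exists v; split=> //; rewrite addnC.
  by move=> K; apply: dpath_step => //=; rewrite (negbTE hb); exact: dpath_refl.
have [t1 [s1 [h1 [le_t [v1 lt_v hI1]]]]] := hc _ _ hI hb.
have [t2 [s2 [h2 [hb2 [v2 [le_v le_t2 hI2]]]]]] := IH _ lt_v _ hI1.
exists (t1 + t2).+1, s2; split.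
  by move=> K; apply: dpath_step => //=; rewrite hb; apply: dpath_trans (h1 _) (h2 _).
split=> //; exists v2; split=> //; first by lia.
by nia.
Qed.

Definition wvar x := WGet x (WConst 0).

(** The bound [e] is evaluated again before every turn, so an invariant given to [wp_for] has to
    keep its value. *)
Definition For x e c :=
  Seq (WSet x (WConst 0) (WConst 0))
      (While (TNot (WLe e (wvar x)))
         (Seq c (WSet x (WConst 0) (WAdd (wvar x) (WConst 1))))).

(* [p] is a potential in the sense of amortized analysis. *)
Lemma wp_for x e c (N T : nat) (I : nat -> nat -> state R -> Prop) s p :
  (N < M)%N ->
  I 0%N p (setw s x 0 0) ->
  (forall i p s, (i <= N)%N -> words s x 0 = i -> I i p s -> weval M s e = N) ->
  (forall i p s, (i < N)%N -> words s x 0 = i -> I i p s ->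
     wp c s (fun t s' => words s' x 0 = i /\
       exists2 p', (t + p' <= p + T)%N & I i.+1 p' (setw s' x 0 i.+1))) ->
  wp (For x e c) s (fun t s' => words s' x 0 = N /\
     exists2 p', (t + p' <= N * (T + 3) + p + 3)%N & I N p' s').
Proof.
move=> lt_NM hI he hc; apply: wp_seq; apply: wp_wset; rewrite /= mod0n.
(* If [N] is 0 the modulus may be 1, and the constant 1 then evaluates to 0; but in that case the
   counter is never incremented. *)
have M1 : (1 %% M = 1)%N \/ N = 0%N.
  by case: N lt_NM {hI he hc} => [|N] h; [right|left; rewrite modn_small //; lia].
pose J v s := exists i p', [/\ (i <= N)%N, words s x 0 = i, I i p' s & v = (N - i)%N].
suff H : forall d i p s, (N - i <= d)%N -> (i <= N)%N -> words s x 0 = i -> I i p s ->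
  wp (While (TNot (WLe e (wvar x)))
         (Seq c (WSet x (WConst 0) (WAdd (wvar x) (WConst 1))))) s
    (fun t s' => words s' x 0 = N /\
     exists2 p', (t + p' <= (N - i) * (T + 3) + p + 1)%N & I N p' s').
  have := H N 0%N p (setw s x 0 0).
  rewrite subn0 => /(_ (leqnn _) (leq0n _)); rewrite {1}/setw /= /set_cell !eqxx /=.
  move=> /(_ erefl hI); apply: wp_mono => t s' [h1 [p' h2 h3]]; split=> //.
  by exists p' => //; lia.
elim=> [|d IH] i q s0 le_d le_i hx hi.
  have ei : i = N by lia.
  exists 1%N, s0; split.
    move=> K; apply: dpath_step => //=.
    by rewrite mod0n (he i q) // hx ei leqnn /=; exact: dpath_refl.
  by split; [rewrite hx|exists q; [lia|rewrite -ei]].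
have [ei|lt_i] := eqVneq i N.
  exists 1%N, s0; split.
    move=> K; apply: dpath_step => //=.
    by rewrite mod0n (he i q) // hx ei leqnn /=; exact: dpath_refl.
  by split; [rewrite hx|exists q; [lia|rewrite -ei]].
have {}lt_i : (i < N)%N by lia.
have [t1 [s1 [h1 [hx1 [q1 le_t1 hi1]]]]] := hc i q s0 lt_i hx hi.
have [|//||//|t2 [s2 [h2 [hx2 [q2 le_t2 hi2]]]]] :=
    IH i.+1 q1 (setw s1 x 0 i.+1); first by lia.
  by rewrite /setw /= /set_cell !eqxx.
(* Besides the body, a turn pays for the test, the sequencing and the increment: hence [T + 3]. *)
exists (1 + (1 + (t1 + 1)) + t2)%N, s2; split; last first.
  split=> //; exists q2 => //.
  have -> : (N - i = (N - i.+1).+1)%N by lia.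
  lia.
move=> K; apply: dpath_trans (h2 K).
apply: dpath_step => //=; rewrite mod0n (he i q) // hx.
rewrite -ltnNge lt_i; apply: dpath_step => //=; apply: dpath_trans (h1 _) _.
apply: dpath_step => //=.
have -> : (words s1 x (0 %% M) + 1 %% M = i + 1)%N.
  by rewrite mod0n hx1; case: M1 => [->|] //; lia.
rewrite mod0n addn1 modn_small; last by lia.
exact: dpath_refl.
Qed.

Definition seqs (cs : seq cmd) : cmd := foldr Seq Skip cs.

Lemma wp_seqs (A : eqType) (f : A -> cmd) (l : seq A) (T : nat)
    (I : seq A -> state R -> Prop) s :
  I [::] s ->
  (forall l1 x s, x \in l -> I l1 s ->
     wp (f x) s (fun t s' => (t <= T)%N /\ I (rcons l1 x) s')) ->
  wp (seqs [seq f x | x <- l]) s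
    (fun t s' => (t <= size l * T.+1 + 1)%N /\ I l s').
Proof.
move=> hI hf.
suff H : forall l2 l1 s, {subset l2 <= l} -> I l1 s ->
  wp (seqs [seq f x | x <- l2]) s
    (fun t s' => (t <= size l2 * T.+1 + 1)%N /\ I (l1 ++ l2) s').
  exact: (H l [::]).
elim=> [|x l2 IH] l1 s0 sub h1 /=.
  by apply: wp_skip; rewrite cats0.
apply: wp_seq; have := hf l1 x s0 (sub _ (mem_head _ _)) h1.
apply: wp_mono => t1 s1 [le_t1 h2].
have := IH (rcons l1 x) s1 _ h2; rewrite cat_rcons.
have sub2 : {subset l2 <= l} by move=> z hz; apply: sub; rewrite in_cons hz orbT.
move=> /(_ sub2); apply: wp_mono => t2 s2 [le_t2 h3]; split=> //.
by nia.
Qed.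

Fixpoint wmod (a : nat) c : bool :=
  match c with
  | WSet a' _ _ | WRand a' _ _ => a == a'
  | Skip | RSet _ _ _ => false
  | Seq c1 c2 | If _ c1 c2 => wmod a c1 || wmod a c2
  | While _ c1 => wmod a c1
  end.

Fixpoint rmod (a : nat) c : bool :=
  match c with
  | RSet a' _ _ => a == a'
  | Skip | WSet _ _ _ | WRand _ _ _ => false
  | Seq c1 c2 | If _ c1 c2 => rmod a c1 || rmod a c2
  | While _ c1 => rmod a c1
  end.

(** Arrays are named by literals, so the write set of a command can be read off its syntax. The
    induction runs over all pending commands because a step may unfold one command into several. *)
Lemma dpath_frame t cf cf' : dpath t cf cf' ->
  (forall a i, ~~ has (wmod a) cf.1 -> words cf'.2 a i = words cf.2 a i) /\
  (forall a i, ~~ has (rmod a) cf.1 -> reals cf'.2 a i = reals cf.2 a i).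
Proof.
elim=> [//|{}t c K s {}cf' _ _ [IHw IHr]]; split=> a i /=; rewrite negb_or => /andP[hc hK].
  case: c hc IHw {IHr} => //= [_|a' e1 e2 hc|a' e1 e2 _|a' e1 e2 hc|c1 c2 hc|b c1 c2 hc|b c1 hc] IH.
  - exact: IH.
  - by rewrite IH //= /set_cell (negbTE hc).
  - by rewrite IH.
  - by rewrite IH //= /set_cell (negbTE hc).
  - by rewrite IH //= !negb_or hK andbT -negb_or.
  - by rewrite IH //=; move: hc; rewrite negb_or => /andP[h1 h2]; case: ifP; rewrite negb_or hK andbT.
  - by rewrite IH //=; case: ifP => //= _; rewrite !negb_or hc hK.
case: c hc IHr {IHw} => //= [_|a' e1 e2 _|a' e1 e2 hc|a' e1 e2 _|c1 c2 hc|b c1 c2 hc|b c1 hc] IH.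
- exact: IH.
- by rewrite IH.
- by rewrite IH //= /set_cell (negbTE hc).
- by rewrite IH.
- by rewrite IH //= !negb_or hK andbT -negb_or.
- by rewrite IH //=; move: hc; rewrite negb_or => /andP[h1 h2]; case: ifP; rewrite negb_or hK andbT.
- by rewrite IH //=; case: ifP => //= _; rewrite !negb_or hc hK.
Qed.

Definition frame c s s' :=
  (forall a i, ~~ wmod a c -> words s' a i = words s a i) /\
  (forall a i, ~~ rmod a c -> reals s' a i = reals s a i).

Lemma wp_frame c s Q : wp c s Q -> wp c s (fun t s' => Q t s' /\ frame c s s').
Proof.
move=> [t [s' [h hQ]]]; exists t, s'; split=> //; split=> //.
have [h1 h2] := dpath_frame (h [::]).
by split=> a i h3; [apply: h1|apply: h2] => /=; rewrite orbF.
Qed.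

Fixpoint wreads (e : wexp) (a : nat) : bool :=
  match e with
  | WConst _ => false
  | WGet a' e1 => (a == a') || wreads e1 a
  | WAdd e1 e2 | WSub e1 e2 | WMul e1 e2 | WDiv e1 e2 | WRem e1 e2 =>
      wreads e1 a || wreads e2 a
  end.

Lemma weval_ext s s' e :
  (forall a i, wreads e a -> words s' a i = words s a i) ->
  weval M s' e = weval M s e.
Proof.
elim: e => //= [a e IH|e1 IH1 e2 IH2|e1 IH1 e2 IH2|e1 IH1 e2 IH2|e1 IH1 e2 IH2|e1 IH1 e2 IH2] h;
  do ?[rewrite IH1 => [|? ? h1]; last by apply: h; rewrite h1];
  do ?[rewrite IH2 => [|? ? h1]; last by apply: h; rewrite h1 orbT] => //.
by rewrite IH => [|? ? h1]; rewrite h ?eqxx ?h1 ?orbT.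
Qed.

End Execution.

(** * Euclidean norm and the net of directions *)

Section Norm.
Variables (R : realType) (d : nat).
Implicit Types u v w : 'rV[R]_d.

Lemma enorm_ge0 v : 0 <= enorm v.
Proof. exact: sqrtr_ge0. Qed.

Lemma enorm_sqr v : enorm v ^+ 2 = \sum_(j < d) v 0 j ^+ 2.
Proof. by rewrite sqr_sqrtr // sumr_ge0 // => i _; exact: sqr_ge0. Qed.

Lemma enorm0 : enorm (0 : 'rV[R]_d) = 0.
Proof. by rewrite /enorm big1 ?sqrtr0 // => i _; rewrite mxE expr0n. Qed.

Lemma enorm_eq0 v : enorm v = 0 -> v = 0.
Proof.
move=> h; have := enorm_sqr v; rewrite h expr0n /= => /esym/eqP.
rewrite psumr_eq0 => [/allP h2|i _]; last exact: sqr_ge0.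
apply/rowP => j; rewrite mxE; apply/eqP; rewrite -sqrf_eq0.
exact: h2 (mem_index_enum _).
Qed.

Lemma enormZ (c : R) v : enorm (c *: v) = `|c| * enorm v.
Proof.
rewrite /enorm -sqrtr_sqr -sqrtrM ?sqr_ge0 // mulr_sumr.
by congr Num.sqrt; apply: eq_bigr => j _; rewrite mxE exprMn.
Qed.

Lemma enormN v : enorm (- v) = enorm v.
Proof. by rewrite -scaleN1r enormZ normrN1 mul1r. Qed.

Lemma cauchy_schwarz (a b : 'I_d -> R) :
  (\sum_i a i * b i) ^+ 2 <= (\sum_i a i ^+ 2) * (\sum_i b i ^+ 2).
Proof.
set A := \sum_i a i ^+ 2; set B := \sum_i b i ^+ 2; set C := \sum_i _ * _.
have B0 : 0 <= B by apply: sumr_ge0 => i _; exact: sqr_ge0.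
have [Bz|Bnz] := eqVneq B 0.
  suff -> : C = 0 by rewrite Bz mulr0 expr0n.
  apply: big1 => i _; suff -> : b i = 0 by rewrite mulr0.
  apply/eqP; rewrite -sqrf_eq0; move/eqP: Bz.
  rewrite psumr_eq0 => [/allP h|j _]; last exact: sqr_ge0.
  exact: h (mem_index_enum _).
have Bp : 0 < B by rewrite lt_neqAle eq_sym Bnz.
(* The coefficients B and C are chosen so that the expanded square is B (A B - C^2). *)
have h : 0 <= \sum_i (B * a i - C * b i) ^+ 2.
  by apply: sumr_ge0 => i _; exact: sqr_ge0.
have e (p q : R) : \sum_i (p * a i - q * b i) ^+ 2 = p ^+ 2 * (\sum_i a i ^+ 2)
    - (2 * p * q) * (\sum_i a i * b i) + q ^+ 2 * (\sum_i b i ^+ 2).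
  rewrite !mulr_sumr -sumrB -big_split /=.
  by apply: eq_bigr => i _; ring.
move: h; rewrite e -/A -/B -/C.
have -> : B ^+ 2 * A - 2 * B * C * C + C ^+ 2 * B = B * (A * B - C ^+ 2) by ring.
by rewrite pmulr_rge0 // subr_ge0.
Qed.

Lemma enormD u v : enorm (u + v) <= enorm u + enorm v.
Proof.
rewrite -(ler_pXn2r (n := 2)) ?nnegrE ?addr_ge0 ?enorm_ge0 //.
rewrite sqrrD !enorm_sqr.
have -> : \sum_j (u + v) 0 j ^+ 2 =
  \sum_j u 0 j ^+ 2 + \sum_j u 0 j * v 0 j *+ 2 + \sum_j v 0 j ^+ 2.
  by rewrite -!big_split /=; apply: eq_bigr => j _; rewrite mxE sqrrD.
rewrite lerD2r lerD2l sumrMnl lerMn2r /=.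
apply: le_trans (ler_norm _) _.
rewrite -(ler_pXn2r (n := 2)) ?nnegrE ?mulr_ge0 ?enorm_ge0 //.
by rewrite exprMn !enorm_sqr -normrX ger0_norm ?sqr_ge0 // cauchy_schwarz.
Qed.

Lemma enorm_sum (I : Type) (r : seq I) (P : pred I) (f : I -> 'rV[R]_d) :
  enorm (\sum_(i <- r | P i) f i) <= \sum_(i <- r | P i) enorm (f i).
Proof.
elim/big_ind2: _ => [|u a v b hu hv|//]; first by rewrite enorm0.
by apply: le_trans (enormD _ _) _; exact: lerD.
Qed.

Lemma enorm_conic (I : Type) (r : seq I) (c : I -> R) (f : I -> 'rV[R]_d) (N : R) :
  (forall i, 0 <= c i) -> (forall i, enorm (f i) <= N) ->
  enorm (\sum_(i <- r) c i *: f i) <= N * \sum_(i <- r) c i.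
Proof.
move=> hc hf; apply: le_trans (enorm_sum _ _ _) _.
rewrite mulr_sumr; apply: ler_sum => i _.
by rewrite enormZ ger0_norm // mulrC ler_wpM2r.
Qed.

Lemma flat_dist_le (y x : 'rV[R]_d) (F : set 'rV[R]_d) :
  F x -> flat_dist y F <= enorm (y - x).
Proof.
move=> Fx; apply: ge_inf; last by exists x.
by exists 0 => _ [z _ <-]; exact: enorm_ge0.
Qed.

End Norm.

(* Integer vectors with entries in [-N, N], coded by offsetting the entries. *)
Section Net.
Variables (R : realType) (d N : nat).
Hypothesis N_gt0 : (0 < N)%N.

Definition code := {ffun 'I_d -> 'I_(2 * N).+1}.

Definition netv (f : code) : 'rV[R]_d := \row_j ((f j)%:R - N%:R).

Definition in_net (f : code) : bool := enorm (netv f) <= N%:R.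

Lemma code_of (g : 'I_d -> R) (h : 'I_d -> nat) (b : 'I_d -> bool) :
  (forall j, (h j <= N)%N) ->
  (forall j, g j = (-1) ^+ b j * (h j)%:R) ->
  exists f, netv f = \row_j g j.
Proof.
move=> hN hg.
exists [ffun j => inord (if b j then (N - h j)%N else (N + h j)%N)].
apply/rowP => j; rewrite !mxE ffunE inordK; last by have := hN j; case: ifP; lia.
rewrite hg; case: (b j); rewrite ?expr1 ?expr0 /=.
  by rewrite natrB //; ring.
by rewrite natrD; ring.
Qed.

(** The vectors N e_i and - N e_i, of norm exactly N, carry the remainder left by the truncation. *)
Definition axis (b : bool) (i : 'I_d) : 'rV[R]_d :=
  \row_j ((-1) ^+ b * (if j == i then N else 0%N)%:R).

Lemma axis_code b i : exists2 f, netv f = axis b i & in_net f.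
Proof.
have [|//|f hf] := @code_of (fun j => (-1) ^+ b * (if j == i then N else 0%N)%:R)
  (fun j => if j == i then N else 0%N) (fun=> b); first by move=> j; case: ifP.
exists f => //; rewrite /in_net hf -(ler_pXn2r (n := 2)) ?nnegrE ?enorm_ge0 //.
rewrite enorm_sqr (bigD1 i) //= big1 => [|j ji]; rewrite !mxE.
  by rewrite addr0 exprMn eqxx sqrr_sign mul1r.
by rewrite (negbTE ji) mulr0 expr0n.
Qed.

Lemma axisE (b : bool) (r : R) (i : 'I_d) : (b = (r < 0)) ->
  (`|r| / N%:R) *: axis b i = \row_j (if j == i then r else 0).
Proof.
move=> hb; apply/rowP => j; rewrite !mxE; case: eqP => _; last by rewrite !mulr0.
have N0 : N%:R != 0 :> R by rewrite pnatr_eq0 -lt0n.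
by rewrite mulrCA mulfVK // hb -numEsign.
Qed.

(* [z] is scaled to norm [N] and truncated towards 0; the remainder has entries
   at most 1 and is a combination of the vectors [axis b i]. *)
Lemma net_cone (z : 'rV[R]_d) :
  exists c : code -> R, [/\ forall f, 0 <= c f, forall f, c f != 0 -> in_net f,
    z = \sum_f c f *: netv f &
    N%:R * \sum_f c f <= (1 + d%:R / N%:R) * enorm z].
Proof.
have N0 : 0 < N%:R :> R by rewrite ltr0n.
have [z0|znz] := eqVneq (enorm z) 0.
  exists (fun=> 0); split => //; first by move=> f; rewrite eqxx.
    by rewrite (enorm_eq0 z0) big1 // => f _; rewrite scale0r.
  by rewrite big1 // mulr0 z0 mulr0.
have zp : 0 < enorm z by rewrite lt_neqAle eq_sym znz enorm_ge0.
pose s := enorm z / N%:R; have sp : 0 < s by rewrite divr_gt0.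
have [w zw nw] : exists2 w, z = s *: w & enorm w = N%:R.
  exists (s^-1 *: z); first by rewrite scalerA divff ?scale1r // gt_eqF.
  by rewrite enormZ gtr0_norm ?invr_gt0 // /s invf_div mulfVK.
have wj j : `|w 0 j| <= N%:R.
  rewrite -nw -(ler_pXn2r (n := 2)) ?nnegrE ?enorm_ge0 // enorm_sqr (bigD1 j) //=.
  by rewrite real_normK ?num_real // lerDl sumr_ge0 // => i _; exact: sqr_ge0.
pose h j := Num.truncn `|w 0 j|.
have hw j : (h j)%:R <= `|w 0 j| < (h j).+1%:R by apply: truncn_itv.
have hN j : (h j <= N)%N.
  by rewrite -(ler_nat R); apply: le_trans (wj j); case/andP: (hw j).
pose g j : R := (-1) ^+ (w 0 j < 0)%R * (h j)%:R.
have [f0 hf0] := @code_of g h (fun j => w 0 j < 0) hN (fun=> erefl).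
have net0 : in_net f0.
  rewrite /in_net -nw hf0 ler_sqrt; last by apply: sumr_ge0 => i _; exact: sqr_ge0.
  apply: ler_sum => j _; rewrite mxE /g exprMn sqrr_sign mul1r.
  rewrite -[w 0 j ^+ 2]real_normK ?num_real // ler_pXn2r ?nnegrE //.
  by case/andP: (hw j).
pose r j := w 0 j - g j.
have hr j : `|r j| <= 1.
  have -> : r j = (-1) ^+ (w 0 j < 0)%R * (`|w 0 j| - (h j)%:R).
    by rewrite /r /g mulrBr -numEsign.
  rewrite normrM normr_sign mul1r; case/andP: (hw j) => h1 h2.
  by rewrite ger0_norm ?subr_ge0 // lerBlDl natr1 ltW.
pose a j := s2val (cid2 (axis_code (r j < 0) j)).
have aE j : netv (a j) = axis (r j < 0) j by rewrite /a; case: cid2 => /=.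
have aN j : in_net (a j) by rewrite /a; case: cid2 => /=.
(* Indicators add the weights up in case the truncated vector and some axis have the same code. *)
pose c f := s * ((f == f0)%:R + \sum_j (`|r j| / N%:R) * (f == a j)%:R).
have sum1 (V : lmodType R) (F : code -> V) (e : code) :
    \sum_f (f == e)%:R *: F f = F e.
  rewrite (bigD1 e) //= eqxx scale1r big1 ?addr0 // => f /negbTE ->.
  by rewrite scale0r.
exists c; split.
- move=> f; by rewrite /c mulr_ge0 ?(ltW sp) // addr_ge0 // sumr_ge0 //.
- move=> f; apply: contraNT => nf; rewrite /c mulf_eq0; apply/orP; right.
  have -> : f == f0 = false by apply: contraNF nf => /eqP ->.
  rewrite add0r big1 // => j _; have -> : f == a j = false.
    by apply: contraNF nf => /eqP ->.
  by rewrite mulr0.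
- rewrite zw /c; under eq_bigr => f _ do rewrite -scalerA scalerDl scaler_suml.
  rewrite -scaler_sumr big_split /= sum1; congr (_ *: _).
  rewrite exchange_big /=.
  under eq_bigr => j _.
    under eq_bigr => f _ do rewrite -scalerA.
    rewrite -scaler_sumr sum1 aE axisE //.
    over.
  rewrite hf0; apply/rowP => j; rewrite !mxE summxE (bigD1 j) //= big1.
    by rewrite !mxE eqxx addr0 /r addrC subrK.
  by move=> i ij; rewrite mxE eq_sym (negbTE ij).
(* The truncated vector accounts for N * s = |z|; the d entries of the remainder, each at most 1,
   add at most the fraction d / N of it. *)
- rewrite /c -mulr_sumr big_split /= exchange_big /=.
  have one (e : code) : \sum_f (f == e)%:R = 1 :> R.
    by have := sum1 R^o (fun=> 1) e; under eq_bigr => f _ do rewrite [_ *: _]mulr1.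
  rewrite one; under eq_bigr => j _ do rewrite -mulr_sumr one mulr1.
  have Ns : N%:R * s = enorm z by rewrite /s mulrC divfK // gt_eqF.
  rewrite mulrA Ns mulrC ler_wpM2r ?enorm_ge0 // lerD2l.
  rewrite -mulr_suml ler_wpM2r ?invr_ge0 ?ler0n //.
  apply: le_trans (ler_sum _ (fun j _ => hr j)) _.
  by rewrite sumr_const card_ord.
Qed.

End Net.

(** * Basic solutions and determinants *)

Section BasicSolution.
Variables (R : realType) (I : finType) (D : nat) (f : I -> 'rV[R]_D) (b : pred I).
Implicit Types x z : I -> R.

Definition supp x := [set i | x i != 0]%SET.

(** Independence of an indexed family: equal vectors at different indices count as dependent. *)
Definition indep (A : {set I}) := forall z : I -> R,
  supp z \subset A -> \sum_i z i *: f i = 0 -> forall i, z i = 0.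

Lemma supp_step x z (t : R) i : supp z \subset supp x ->
  x i != 0 -> x i - t * z i = 0 ->
  supp (fun j => x j - t * z j) \proper supp x.
Proof.
move=> sub xi e; apply/fintype.properP; split.
  apply/fintype.subsetP => j; rewrite !inE; apply: contraNN => /eqP xj.
  have : j \notin supp z by apply: contra (fintype.subsetP sub j) _; rewrite inE xj eqxx.
  by rewrite inE negbK xj => /eqP ->; rewrite mulr0 subr0.
by exists i; rewrite inE // negbK e.
Qed.

(* Linear programming: an optimal solution may be taken basic. *)
Lemma basic_solution x : (forall i, b i -> x i <= 0) ->
  exists x', [/\ forall i, b i -> x' i <= 0, supp x' \subset supp x,
    \sum_i x' i *: f i = \sum_i x i *: f i,
    \sum_(i | b i) x i <= \sum_(i | b i) x' i & indep (supp x')].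
Proof.
have [m] := ubnP #|supp x|; elim: m x => // m IH x lt_m hx.
have [ind|nind] := pselect (indep (supp x)); first by exists x.
suff [x1 [h1 h2 h3 h4]] : exists x1, [/\ forall i, b i -> x1 i <= 0,
    supp x1 \proper supp x, \sum_i x1 i *: f i = \sum_i x i *: f i &
    \sum_(i | b i) x i <= \sum_(i | b i) x1 i].
  have lt1 : (#|supp x1| < m)%N.
    by apply: leq_trans (proper_card h2) _; rewrite -ltnS.
  have [x2 [g1 g2 g3 g4 g5]] := IH x1 lt1 h1.
  exists x2; split=> //; last by apply: le_trans h4 _.
    by apply: fintype.subset_trans g2 _; exact: proper_sub.
  by rewrite g3.
(* A kernel vector, with its sign chosen so that subtracting a nonnegative multiple does not
   decrease the objective. *)
have [z [sub z0 [i zi] sz]] : exists z, [/\ supp z \subset supp x,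
    \sum_i z i *: f i = 0, exists i, z i != 0 & \sum_(i | b i) z i <= 0].
  move/existsNP: nind => [z /not_implyP[sub /not_implyP[z0 /existsNP[i /eqP zi]]]].
  have [le0|lt0] := leP (\sum_(i | b i) z i) 0; first by exists z; split=> //; exists i.
  exists (fun i => - z i); split.
  - by apply: fintype.subset_trans sub; apply/fintype.subsetP => j; rewrite !inE oppr_eq0.
  - by under eq_bigr => j _ do rewrite scaleNr; rewrite sumrN z0 oppr0.
  - by exists i; rewrite oppr_eq0.
  - by rewrite sumrN oppr_le0 ltW.
have stepE t : \sum_i (x i - t * z i) *: f i = \sum_i x i *: f i.
  under eq_bigr => j _ do rewrite scalerBl -scalerA.
  by rewrite sumrB -scaler_sumr z0 scaler0 subr0.
have sumE t : \sum_(i | b i) (x i - t * z i) =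
    \sum_(i | b i) x i - t * \sum_(i | b i) z i by rewrite sumrB -mulr_sumr.
have xz j : z j != 0 -> x j != 0.
  by have := fintype.subsetP sub j; rewrite !inE.
(* Ratio test: the least quotient is the first moment at which a constrained coordinate reaches
   0. *)
have [[i0 /andP[bi0 zi0]]|none] := pselect (exists i, b i && (z i < 0)).
  case: (@arg_minP _ _ _ i0 (fun i => b i && (z i < 0)) (fun i => x i / z i)) => //.
    by rewrite bi0.
  move=> i1 /andP[bi1 zi1] hmin.
  have t0 : 0 <= x i1 / z i1 by rewrite mulr_le0 ?hx // invr_le0 ltW.
  exists (fun j => x j - (x i1 / z i1) * z j); split => //.
  - move=> j bj; rewrite subr_le0; have [zj|zj] := ltP (z j) 0.
      have := hmin j; rewrite bj zj => /(_ isT) h.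
      by rewrite -ler_ndivlMr.
    by apply: le_trans (hx j bj) _; exact: mulr_ge0.
  - apply: (@supp_step _ _ _ i1) => //; first by rewrite xz // lt_eqF.
    by rewrite divfK ?subrr // lt_eqF.
  - by rewrite sumE lerBrDr addrC -lerBrDr subrr mulr_ge0_le0.
(* Otherwise [z] vanishes on [b]: neither the constraints nor the objective move, and any coordinate
   in the support of [z] can be cancelled. *)
have bz j : b j -> z j = 0.
  have ge0 k : b k -> 0 <= z k.
    by move=> bk; rewrite leNgt; apply/negP => h; apply: none; exists k; rewrite bk.
  have : \sum_(i | b i) z i == 0 by rewrite eq_le sz sumr_ge0.
  by rewrite psumr_eq0 // => /allP h bj; have /implyP/(_ bj)/eqP := h j (mem_index_enum _).
exists (fun j => x j - (x i / z i) * z j); split=> //.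
- by move=> j bj; rewrite (bz j) // mulr0 subr0 hx.
- apply: (@supp_step _ _ _ i) => //; first exact: xz.
  by rewrite divfK ?subrr.
- by rewrite sumE [X in _ - _ * X]big1 ?mulr0 ?subr0 // => j; exact: bz.
Qed.

Lemma indep_free (A : {set I}) (s : seq I) :
  indep A -> uniq s -> {subset s <= A} -> free [seq f i | i <- s].
Proof.
move=> ind us sub; have sT : [seq f i | i <- s] = [tuple of [seq f i | i <- in_tuple s]] by [].
rewrite sT; apply/freeP => k hk.
pose z i := \sum_(j < size s | tnth (in_tuple s) j == i) k j.
have zE j : z (tnth (in_tuple s) j) = k j.
  rewrite /z (bigD1 j) //= big1 ?addr0 // => l /andP[/eqP h /negP ne].
  by case: ne; apply/eqP/(tuple_uniqP (in_tuple s)).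
move=> j; rewrite -zE; apply: ind.
  apply/fintype.subsetP => i; rewrite inE; apply: contraNT => ni.
  rewrite /z big1 // => l /eqP e; case/negP: ni; rewrite -e; apply: sub.
  exact: mem_tnth.
rewrite -[RHS]hk /z; under eq_bigr => i _ do rewrite scaler_suml.
rewrite (exchange_big_dep xpredT) //=; apply: eq_bigr => l _.
rewrite (big_pred1 (tnth (in_tuple s) l)) => [|i]; last by rewrite /= eq_sym.
by rewrite (nth_map (tnth (in_tuple s) l)) ?size_tuple // [in LHS](tnth_nth (tnth (in_tuple s) l)).
Qed.

End BasicSolution.

(** Greedy extension through [C]: a vector is kept exactly when it is outside the current span. *)
Lemma free_extend (K : fieldType) (vT : vectType K) (X C : seq vT) : free X ->
  exists Y, [/\ {subset Y <= C}, free (Y ++ X) & (<<C>> <= <<Y ++ X>>)%VS].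
Proof.
move=> fX; elim: C => [|v C [Y [sub fY le]]].
  by exists [::]; split=> //; rewrite span_nil sub0v.
have subv : {subset Y <= v :: C} by move=> z /sub; rewrite in_cons orbC => ->.
have [vin|nvin] := boolP (v \in <<Y ++ X>>%VS).
  exists Y; split=> //; rewrite span_cons subv_add le andbT.
  by rewrite -memvE.
exists (v :: Y); split.
- by move=> z; rewrite !in_cons => /orP[->//|/sub ->]; rewrite orbT.
- by rewrite /= free_cons nvin.
- by rewrite /= !span_cons addvS.
Qed.

Section Determinant.
Variables (K : fieldType) (D : nat).
Implicit Types (X : seq 'rV[K]_D) (z : 'rV[K]_D).

Definition rowsmx X : 'M[K]_D := \matrix_(i, j) X`_i 0 j.

(** Numerator of Cramer's rule: the coordinate of [z] along the i-th row, times the determinant. The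
    division is postponed since it cancels in ratios of coordinates. *)
Definition cramer X i z : K := \det (rowsmx (set_nth 0 X i z)).

Lemma rowsmx_comb X (c : 'rV[K]_D) : c *m rowsmx X = \sum_(l < D) c 0 l *: X`_l.
Proof.
apply/rowP => j; rewrite !mxE summxE; apply: eq_bigr => l _.
by rewrite !mxE.
Qed.

Lemma free_det X : free X -> size X = D -> \det (rowsmx X) != 0.
Proof.
move=> fX sX; apply/negP => /det0P[v vn0 hv].
case/negP: vn0; apply/eqP/rowP => i; rewrite [RHS]mxE.
move/eqP: sX => sX; have /freeP := (fX : free (Tuple sX)).
by apply; rewrite -rowsmx_comb.
Qed.

(** Expansion along the replaced row: the cofactors do not involve [z], whence the linearity in [z]
    used below. *)
Lemma cramerE X (i : 'I_D) z : cramer X i z = (z *m \adj (rowsmx X)) 0 i.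
Proof.
rewrite /cramer (expand_det_row _ i) mxE; apply: eq_bigr => j _.
rewrite !mxE nth_set_nth /= eqxx; congr (_ * (_ * \det _)).
apply/matrixP => k l; rewrite !mxE nth_set_nth /= ifF //.
by apply/negbTE; rewrite -[X in X != _]/(nat_of_ord (lift i k)) eq_sym; exact: neq_bump.
Qed.

Lemma cramer_comb X (i : 'I_D) (J : Type) (r : seq J) (c : J -> K) (g : J -> 'rV_D) :
  cramer X i (\sum_(j <- r) c j *: g j) = \sum_(j <- r) c j * cramer X i (g j).
Proof.
rewrite cramerE mulmx_suml summxE; apply: eq_bigr => j _.
by rewrite cramerE -scalemxAl mxE.
Qed.

Lemma cramerD X (i : 'I_D) z1 z2 : cramer X i (z1 + z2) = cramer X i z1 + cramer X i z2.
Proof. by rewrite !cramerE mulmxDl mxE. Qed.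

Lemma cramer_nth X (i l : 'I_D) :
  cramer X i X`_l = if i == l then \det (rowsmx X) else 0.
Proof.
have -> : X`_l = delta_mx 0 l *m rowsmx X.
  by rewrite -rowE; apply/rowP => j; rewrite !mxE.
rewrite cramerE -mulmxA mul_mx_adj mul_mx_scalar !mxE eqxx /= eq_sym.
by case: eqP => _; rewrite ?mulr1 ?mulr0.
Qed.

Lemma cramer_rep X z : \det (rowsmx X) != 0 ->
  z = \sum_(l < D) (cramer X l z / \det (rowsmx X)) *: X`_l.
Proof.
move=> dn0; have := rowsmx_comb X ((\det (rowsmx X))^-1 *: (z *m \adj (rowsmx X))).
rewrite -scalemxAl -mulmxA mul_adj_mx mul_mx_scalar scalerA mulVf // scale1r => {1}->.
by apply: eq_bigr => l _; rewrite mxE -cramerE mulrC.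
Qed.

End Determinant.

(** * Candidates *)

Section Homogeneous.
Variables (R : realType) (d : nat).
Implicit Types (v x y : 'rV[R]_d).

(* Homogeneous coordinates: weight [1] for points, weight [0] for directions. *)
Definition lift_mx (c : R) v : 'rV[R]_d.+1 := row_mx c%:M v.

Notation hat := (lift_mx 1).
Notation dir := (lift_mx 0).

Lemma lift_mxD c1 c2 v1 v2 :
  lift_mx c1 v1 + lift_mx c2 v2 = lift_mx (c1 + c2) (v1 + v2).
Proof. by rewrite /lift_mx (add_row_mx (n1 := 1)) -raddfD. Qed.

Lemma lift_mxZ a c v : a *: lift_mx c v = lift_mx (a * c) (a *: v).
Proof. by rewrite /lift_mx (scale_row_mx (n1 := 1)) scale_scalar_mx. Qed.

Lemma lift_mx_sum (I : Type) (r : seq I) (P : pred I) (c : I -> R) (v : I -> 'rV[R]_d) :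
  \sum_(i <- r | P i) lift_mx (c i) (v i) =
  lift_mx (\sum_(i <- r | P i) c i) (\sum_(i <- r | P i) v i).
Proof.
elim: r => [|i r IH]; last by rewrite !big_cons; case: ifP; rewrite IH ?lift_mxD.
by rewrite !big_nil /lift_mx raddf0; have := @row_mx0 R 1 1 d.
Qed.

Lemma lift_mx_inj c1 c2 v1 v2 : lift_mx c1 v1 = lift_mx c2 v2 -> c1 = c2 /\ v1 = v2.
Proof.
move/(@eq_row_mx _ _ 1) => [h ->]; split=> //.
by move/matrixP: h => /(_ 0 0); rewrite !mxE.
Qed.

Lemma lift_mxE c v (j : 'I_d.+1) :
  lift_mx c v 0 j = if unlift ord0 j is Some j' then v 0 j' else c.
Proof.
rewrite /lift_mx; case: unliftP => [j' ->|->].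
  have -> : lift ord0 j' = rshift 1 j' by apply/val_inj.
  exact: row_mxEr.
have -> : ord0 = lshift d ord0 :> 'I_(1 + d) by apply/val_inj.
by rewrite (row_mxEl (n1 := 1)) mxE eqxx.
Qed.

(** The first homogeneous coordinate says that the weights sum to 1. Weights of entries of [T] with
    the same position in [q] are added, as [T] may repeat points and need not exhaust [q]. *)
Lemma affine_hull_comb (q T : seq 'rV[R]_d) x (l : nat -> R) :
  {subset T <= q} -> \sum_(i < size T) l i *: hat T`_i = hat x ->
  affine_hull q x.
Proof.
move=> sub; under eq_bigr => i _ do rewrite lift_mxZ mulr1.
rewrite lift_mx_sum => /lift_mx_inj[sl sx].
have sz (i : 'I_(size T)) : (index (nth 0%R T i) q < size q)%N.
  by rewrite index_mem sub // mem_nth.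
exists (fun r => \sum_(i < size T | index (nth 0%R T i) q == r :> nat) l i); split.
  by rewrite -sl (partition_big (fun i => Ordinal (sz i)) xpredT).
rewrite -sx (partition_big (fun i => Ordinal (sz i)) xpredT) //=.
apply: eq_bigr => r _; rewrite scaler_suml; apply: eq_big.
  by move=> i; rewrite -val_eqE.
move=> i /eqP <- /=; congr (_ *: _).
by rewrite nth_index // sub // mem_nth.
Qed.

End Homogeneous.

Notation hat := (lift_mx 1).
Notation dir := (lift_mx 0).

Section Candidates.
Variables (R : realType) (d N n : nat) (pt : 'I_n -> 'rV[R]_d) (y : 'rV[R]_d).
Hypothesis N_gt0 : (0 < N)%N.
Implicit Types (x : 'rV[R]_d) (T : seq 'I_n) (tau : seq (code d N)).

Local Notation net g := (netv R g).

Definition brows T tau : seq 'rV[R]_d.+1 :=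
  [seq hat (pt i) | i <- T] ++ [seq dir (net g) | g <- tau].

(** One point is enough: subtracting a multiple of it leaves weight 0, and there the net spans by
    [net_cone]. *)
Lemma span_brows i T tau :
  (forall g : code d N, in_net R g -> dir (net g) \in <<brows (i :: T) tau>>%VS) ->
  <<brows (i :: T) tau>>%VS = fullv.
Proof.
move=> h; apply/eqP; rewrite eqEsubv subvf /=; apply/subvP => v _.
have hi : hat (pt i) \in <<brows (i :: T) tau>>%VS by apply: memv_span; exact: mem_head.
have [c [w ->]] : exists c w, v = lift_mx c w.
  exists (lsubmx (v : 'M[R]_(1, 1 + d)) 0 0), (rsubmx (v : 'M[R]_(1, 1 + d))).
  by rewrite /lift_mx -mx11_scalar hsubmxK.
have -> : lift_mx c w = c *: hat (pt i) + dir (w - c *: pt i).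
  by rewrite lift_mxZ lift_mxD mulr1 addr0 subrKC.
apply: memvD; first exact: memvZ.
have [cf [c0 cin -> _]] := net_cone N_gt0 (w - c *: pt i).
have -> : dir (\sum_f cf f *: net f) = \sum_f cf f *: dir (net f).
  under [RHS]eq_bigr => f _ do rewrite lift_mxZ mulr0.
  by rewrite lift_mx_sum big1_eq.
apply: memv_suml => f _; have [->|nz] := eqVneq (cf f) 0.
  by rewrite scale0r mem0v.
by apply: memvZ; apply: h; exact: cin.
Qed.

(** The weights [a] of x and a conic representation of x - y by the net form a feasible solution. A
    basic solution of no larger cost is completed to a basis by net directions of coefficient 0. Its
    points stay in the support of [a], which bounds their number. *)
Lemma basic_rep (a : 'I_n -> R) x : \sum_i a i = 1 -> x = \sum_i a i *: pt i ->
  exists T tau (l : 'I_n -> R) (c : code d N -> R),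
  [/\ [/\ uniq T, forall i, (i \in T) = (l i != 0) & forall i, i \in T -> a i != 0],
      [/\ uniq tau, all (in_net R (N := N)) tau & forall g, 0 <= c g],
      free (brows T tau) /\ (size T + size tau = d.+1)%N,
      hat y = \sum_(i <- T) l i *: hat (pt i) - \sum_(g <- tau) c g *: dir (net g)
    & N%:R * \sum_(g <- tau) c g <= (1 + d%:R / N%:R) * enorm (y - x)].
Proof.
move=> a1 xE; have [c0 [c0ge c0in xyE c0le]] := net_cone N_gt0 (x - y).
pose f (i : 'I_n + code d N) := match i with inl i => hat (pt i) | inr g => dir (net g) end.
pose b (i : 'I_n + code d N) := if i is inr _ then true else false.
(* Directions enter with the opposite sign: [basic_solution] keeps the variables in [b] nonpositive
   and does not decrease their sum, so the sum of the c does not increase. *)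
pose X0 (i : 'I_n + code d N) := match i with inl i => a i | inr g => - c0 g end.
have [|X [Xle Xsub XE Xs Xind]] := @basic_solution R _ _ f b X0.
  by case=> //= g _; rewrite oppr_le0.
have YE : hat y = \sum_i X i *: f i.
  rewrite XE big_sumType /=.
  under eq_bigr => i _ do rewrite lift_mxZ mulr1.
  under [X in _ = _ + X]eq_bigr => i _ do rewrite lift_mxZ mulr0.
  rewrite !lift_mx_sum a1 lift_mxD -xE big1 // addr0.
  by under eq_bigr => i _ do rewrite scaleNr; rewrite sumrN -xyE opprB subrKC.
pose T := [seq i <- enum 'I_n | X (inl i) != 0].
pose t0 := [seq g <- enum (code d N) | X (inr g) != 0].
have uT : uniq T by rewrite filter_uniq ?enum_uniq.
have fr : free (brows T t0).
  have := @indep_free _ _ _ f _ (map inl T ++ map inr t0) Xind.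
  rewrite map_cat -!map_comp; apply.
    have ut : uniq t0 by apply: filter_uniq; exact: enum_uniq.
    rewrite cat_uniq map_inj_uniq ?uT; last by move=> ? ? [].
    rewrite map_inj_uniq ?ut ?andbT; last by move=> ? ? [].
    by apply/hasPn => _ /mapP[g _ ->]; apply/mapP => -[].
  move=> i; rewrite mem_cat => /orP[] /mapP[j]; rewrite mem_filter => /andP[h _] ->;
    by rewrite inE.
have [Y [Ysub Yfr Yspan]] := free_extend [seq dir (net g) | g <- enum (code d N) & in_net R g] fr.
have [t1 [t1in YE1]] : exists t1 : seq (code d N),
    all (in_net R (N := N)) t1 /\ Y = [seq dir (net g) | g <- t1].
  elim: Y Ysub {Yfr Yspan} => [|v Y IH] sub; first by exists [::].
  have [|t1 [h1 ->]] := IH; first by move=> z hz; apply: sub; rewrite in_cons hz orbT.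
  have /mapP[g] := sub v (mem_head _ _); rewrite mem_filter => /andP[hg _] ->.
  by exists (g :: t1) => /=; rewrite hg.
pose tau := t0 ++ t1.
have pe : perm_eq (Y ++ brows T t0) (brows T tau).
  by rewrite /brows YE1 map_cat perm_catC catA.
have frb : free (brows T tau) by rewrite -(perm_free pe).
have X1 : \sum_(i <- T) X (inl i) = 1.
  have := YE; rewrite big_sumType /=.
  under eq_bigr => i _ do rewrite lift_mxZ mulr1.
  under [X in _ = _ + X]eq_bigr => i _ do rewrite lift_mxZ mulr0.
  rewrite !lift_mx_sum lift_mxD => /lift_mx_inj[]; rewrite [X in _ + X]big1 // addr0 => -> _.
  rewrite big_filter big_enum_cond /= [LHS]big_mkcond; apply: eq_bigr => i _.
  by case: eqP.
(* The weights of the points sum to 1, so there is a point to which [span_brows] applies. *)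
have sT : (0 < size T)%N.
  case: (T) X1 => //; rewrite big_nil => /esym/eqP; by rewrite oner_eq0.
have inT i : (i \in T) = (X (inl i) != 0) by rewrite mem_filter mem_enum andbT.
have inb i : i \in supp X -> X0 i != 0 by move/(fintype.subsetP Xsub); rewrite inE.
have utau : uniq tau.
  have := free_uniq frb; rewrite cat_uniq => /and3P[_ _].
  exact: map_uniq.
have alltau : all (in_net R (N := N)) tau.
  rewrite all_cat t1in andbT; apply/allP => g; rewrite mem_filter => /andP[h _].
  by apply: c0in; have := inb (inr g); rewrite inE /= oppr_eq0; apply.
have sumtau (V : zmodType) (F : code d N -> V) : (forall g, X (inr g) = 0 -> F g = 0) ->
    \sum_g F g = \sum_(g <- tau) F g.
  move=> h; rewrite (big_uniq _ utau) /= [RHS]big_mkcond; apply: eq_bigr => g _.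
  case: ifP => // ng; apply: h; apply/eqP; apply: contraFT ng => gn.
  by rewrite mem_cat mem_filter gn mem_enum.
exists T, tau, (fun i => X (inl i)), (fun g => - X (inr g)); split.
- by split=> // i; rewrite inT => h; have := inb (inl i); rewrite inE /=; apply.
- by split=> // g; rewrite oppr_ge0 Xle.
- split=> //; have : \dim <<brows T tau>> = size (brows T tau) by apply/eqP.
  have -> : <<brows T tau>>%VS = fullv.
    case eT: T sT => [//|i T'] _; apply: span_brows => g hg.
    rewrite -eT -(eq_span (perm_mem pe)); apply: (subvP Yspan); apply: memv_span.
    by apply: map_f; rewrite mem_filter hg mem_enum.
  by rewrite size_cat !size_map dimvf /dim /= mul1n => <-.
- rewrite YE big_sumType /=; congr (_ + _).
    rewrite big_filter big_enum_cond /= [in RHS]big_mkcond; apply: eq_bigr => i _.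
    by case: eqP => //= ->; rewrite scale0r.
  rewrite sumtau => [|g ->]; last by rewrite scale0r.
  by rewrite -sumrN; apply: eq_bigr => g _; rewrite scaleNr opprK.
- rewrite -(enormN (y - x)) opprB; apply: le_trans c0le.
  rewrite ler_wpM2l ?ler0n // -sumtau => [|g ->]; last by rewrite oppr0.
  rewrite sumrN lerNl -sumrN; move: Xs; rewrite !big_mkcond !big_sumType /=.
  by rewrite big1_eq big_pred0_eq !add0r.
Qed.

End Candidates.

Lemma cramer_mem (K : fieldType) (D : nat) (X : seq 'rV[K]_D) (i : nat) z :
  size X = D -> uniq X -> (i < D)%N -> z \in X ->
  cramer X i z = (z == X`_i)%:R * \det (rowsmx X).
Proof.
move=> sX uX ltD zX; have ltz : (index z X < D)%N by rewrite -[ltnRHS]sX index_mem.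
have := @cramer_nth K D X (Ordinal ltD) (Ordinal ltz); rewrite /= nth_index // => ->.
rewrite -val_eqE /= -{2}(nth_index 0 zX) eq_sym nth_uniq ?sX //.
by case: eqP; rewrite ?mul1r ?mul0r.
Qed.

Lemma cramer_rep_comb (K : fieldType) (D : nat) (X : seq 'rV[K]_D) z m : m = D ->
  \det (rowsmx X) != 0 ->
  \sum_(l < m) cramer X l z *: X`_l = \det (rowsmx X) *: z.
Proof.
move=> -> dn; rewrite [in RHS](cramer_rep z dn) scaler_sumr.
by apply: eq_bigr => l _; rewrite scalerA mulrC divfK.
Qed.

Lemma netv_inj (R : realType) d N : injective (@netv R d N).
Proof.
move=> f g /rowP h; apply/ffunP => j; apply/val_inj; apply/eqP.
by have := h j; rewrite !mxE => /addIr/eqP; rewrite eqr_nat.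
Qed.

Section Candidates.
Variables (R : realType) (d N n : nat) (pt : 'I_n -> 'rV[R]_d) (y : 'rV[R]_d).
Implicit Types (x : 'rV[R]_d) (T : seq 'I_n) (tau : seq (code d N)).

Local Notation net g := (netv R g).
Local Notation brows := (brows pt).

Lemma mem_brows_pt T tau t : t \in T -> hat (pt t) \in brows T tau.
Proof. by move=> h; rewrite mem_cat (map_f (fun i => hat (pt i)) h). Qed.

Lemma mem_brows_net T tau g : g \in tau -> dir (net g) \in brows T tau.
Proof. by move=> h; rewrite mem_cat (map_f (fun g => dir (net g)) h) orbT. Qed.

(** Directions are subtracted in the representation of y, so the admissible sign here is [<= 0] and
    the cost is the sum of the opposites. *)
Definition cf T tau i : R :=
  cramer (brows T tau) (size T + i) (hat y) / \det (rowsmx (brows T tau)).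

(** The point part of the Cramer expansion of [hat y] is [hat x] with x in the flat, and x - y is a
    conic combination of net vectors of norm at most N. *)
Lemma direct_sound T tau q : (size T + size tau = d.+1)%N ->
  all (in_net R (N := N)) tau -> \det (rowsmx (brows T tau)) != 0 ->
  (forall i, (i < size tau)%N -> cf T tau i <= 0) ->
  {subset [seq pt i | i <- T] <= q} ->
  flat_dist y (affine_hull q) <= N%:R * \sum_(i < size tau) - cf T tau i.
Proof.
move=> sz ntau dn cle sub.
have sX : size (brows T tau) = d.+1 by rewrite size_cat !size_map.
pose g0 : code d N := [ffun=> ord0].
pose x := y + \sum_(i < size tau) (- cf T tau i) *: net (nth g0 tau i).
apply: (@le_trans _ _ (enorm (y - x))).
  apply: flat_dist_le; apply: (@affine_hull_comb _ _ _ _ _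
    (fun i => cramer (brows T tau) i (hat y) / \det (rowsmx (brows T tau))) sub).
  have := cramer_rep_comb (hat y) sz dn; rewrite big_split_ord /= => h.
  apply: (scalerI dn); apply: (addIr (\det (rowsmx (brows T tau)) *:
    \sum_(i < size tau) cf T tau i *: dir (net (nth g0 tau i)))).
  rewrite -!scalerDr.
  have -> : hat x + \sum_(i < size tau) cf T tau i *: dir (net (nth g0 tau i)) = hat y.
    under eq_bigr => i _ do rewrite lift_mxZ mulr0.
    rewrite lift_mx_sum lift_mxD big1_eq addr0 /x.
    under [X in y + X + _]eq_bigr => i _ do rewrite scaleNr.
    by rewrite sumrN subrK.
  rewrite -h scalerDr !scaler_sumr; congr (_ + _).
    rewrite !size_map; apply: eq_bigr => i _.
    rewrite scalerA [_ * (_ / _)]mulrC divfK // nth_cat size_map ltn_ord.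
    by rewrite !(nth_map (tnth (in_tuple T) i)) ?size_map.
  apply: eq_bigr => i _.
  rewrite scalerA [_ * (_ / _)]mulrC divfK //= nth_cat size_map ltnNge leq_addr /=.
  by rewrite addKn (nth_map g0).
have -> : y - x = - \sum_(i < size tau) (- cf T tau i) *: net (nth g0 tau i).
  by rewrite /x opprD addKr' || rewrite /x opprD addrA subrr add0r.
rewrite enormN; apply: (@enorm_conic _ _ 'I_(size tau) _ (fun i => - cf T tau i)) => i.
  by rewrite oppr_ge0 cle.
by have /allP := ntau; apply; exact: mem_nth.
Qed.

(** Coordinates in a basis are unique, so Cramer's rule returns the coefficients of the given
    representation. *)
Lemma direct_complete T tau (l : 'I_n -> R) (c : code d N -> R) :
  (size T + size tau = d.+1)%N -> free (brows T tau) -> uniq tau ->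
  hat y = \sum_(i <- T) l i *: hat (pt i) - \sum_(g <- tau) c g *: dir (net g) ->
  \det (rowsmx (brows T tau)) != 0 /\
  forall g0 i, (i < size tau)%N -> cf T tau i = - c (nth g0 tau i).
Proof.
move=> sz fr ut yE.
have sX : size (brows T tau) = d.+1 by rewrite size_cat !size_map.
have dn := free_det fr sX; split=> // g0 i lti.
have ltd : (size T + i < d.+1)%N by lia.
have uX := free_uniq fr.
have Xi : (brows T tau)`_(size T + i) = dir (net (nth g0 tau i)).
  by rewrite nth_cat size_map ltnNge leq_addr /= addKn (nth_map g0).
rewrite /cf yE -sumrN; under [X in _ + X]eq_bigr => g _ do rewrite -scaleNr.
rewrite (@cramerD _ _ _ (Ordinal ltd)) !(@cramer_comb _ _ _ (Ordinal ltd)) /=.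
rewrite big1_seq ?add0r => [|t /andP[_ tT]]; last first.
  rewrite cramer_mem ?mem_brows_pt // Xi; case: eqP => [/lift_mx_inj[/eqP]|].
    by rewrite oner_eq0.
  by rewrite mul0r mulr0.
rewrite (bigD1_seq (nth g0 tau i)) ?mem_nth //= big1_seq => [|g /andP[gn gt]].
  by rewrite cramer_mem ?mem_brows_net ?mem_nth // Xi eqxx mul1r addr0 mulfK.
rewrite cramer_mem ?mem_brows_net // Xi.
case: eqP => [/lift_mx_inj[_ /netv_inj e]|_]; last by rewrite mul0r mulr0.
by rewrite e eqxx in gn.
Qed.

Definition mrows T0 tau w := brows T0 tau ++ [:: hat y; w].

(** * Bases with k points: coordinates relative to an auxiliary vector *)

Section Pairs.
Variables (T0 : seq 'I_n) (tau : seq (code d N)) (w : 'rV[R]_d.+1).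
Hypotheses (size_d : (size T0 + size tau + 2 = d.+1)%N)
  (net_tau : all (in_net R (N := N)) tau).

Let X := mrows T0 tau w.

(** Coordinates along [w], along y and along the directions, all up to the factor det X. Dividing by
    [pu] cancels this factor and scales the point to coordinate 1 along [w]. *)
Definition pu (p : 'I_n) := cramer X (size T0 + size tau + 1) (hat (pt p)).
Definition pal p := cramer X (size T0 + size tau) (hat (pt p)) / pu p.
Definition pgam i p := cramer X (size T0 + i) (hat (pt p)) / pu p.
Definition pGam p := \sum_(i < size tau) pgam i p.

Lemma size_mrows : size X = d.+1.
Proof. by rewrite !size_cat !size_map. Qed.

Lemma nth_mrows_net g0 i : (i < size tau)%N ->
  X`_(size T0 + i) = dir (net (nth g0 tau i)).
Proof.
move=> lti; rewrite nth_cat size_cat !size_map ltn_add2l lti.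
by rewrite nth_cat size_map ltnNge leq_addr /= addKn (nth_map g0).
Qed.

Lemma nth_mrows_y : X`_(size T0 + size tau) = hat y.
Proof. by rewrite nth_cat size_cat !size_map ltnn subnn. Qed.

Lemma nth_mrows_w : X`_(size T0 + size tau + 1) = w.
Proof. by rewrite nth_cat size_cat !size_map ltnNge leq_addr /= addKn. Qed.

Lemma sum_mrows (F : nat -> R) : \sum_(l < size T0 + size tau + 2) F l *: X`_l =
  \sum_(l < size T0) F l *: X`_l + \sum_(i < size tau) F (size T0 + i)%N *: X`_(size T0 + i)
  + F (size T0 + size tau)%N *: hat y + F (size T0 + size tau + 1)%N *: w.
Proof.
rewrite -nth_mrows_y -[in RHS]nth_mrows_w !addnS !addn0.
by rewrite !big_ord_recr big_split_ord.
Qed.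

(** Both scaled points have coordinate 1 along [w], so it disappears from their difference, which
    then expresses a multiple of [hat y] through T0, a, p and the directions. The multiple is
    [pal p - pal a > 0], so dividing by it keeps the direction coefficients nonnegative. *)
Lemma main_sound a p q : \det (rowsmx X) != 0 -> pu a != 0 -> pu p != 0 ->
  pal a < pal p -> (forall i, (i < size tau)%N -> pgam i a <= pgam i p) ->
  {subset [seq pt i | i <- T0 ++ [:: a; p]] <= q} ->
  flat_dist y (affine_hull q) <= N%:R * ((pGam p - pGam a) / (pal p - pal a)).
Proof.
move=> dn ua up lt_al le_gam sub.
have dl : 0 < pal p - pal a by rewrite subr_gt0.
pose g0 : code d N := [ffun=> ord0].
pose del := pal p - pal a.
pose cc (i : nat) := (pgam i p - pgam i a) / del.
pose x := y + \sum_(i < size tau) cc i *: net (nth g0 tau i).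
apply: (@le_trans _ _ (enorm (y - x))); last first.
  have -> : y - x = - \sum_(i < size tau) cc i *: net (nth g0 tau i).
    by rewrite /x opprD addrA subrr add0r.
  have -> : (pGam p - pGam a) / (pal p - pal a) = \sum_(i < size tau) cc i.
    by rewrite /pGam -sumrB mulr_suml.
  rewrite enormN; apply: (@enorm_conic _ _ 'I_(size tau) _ (fun i => cc i)) => i.
    by rewrite /cc divr_ge0 ?(ltW dl) // subr_ge0 le_gam.
  by have /allP := net_tau; apply; exact: mem_nth.
pose F l := cramer X l (hat (pt p)) / pu p - cramer X l (hat (pt a)) / pu a.
have E : \sum_(l < size T0 + size tau + 2) F l *: X`_l =
    (\det (rowsmx X) / pu p) *: hat (pt p) - (\det (rowsmx X) / pu a) *: hat (pt a).
  under eq_bigr => l _ do rewrite scalerBl [_ / pu p]mulrC [_ / pu a]mulrC -!scalerA.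
  rewrite sumrB -!scaler_sumr !cramer_rep_comb //.
  by rewrite !scalerA ![_^-1 * _]mulrC.
move: E; rewrite sum_mrows /F !divff // subrr scale0r addr0 -/(pal p) -/(pal a) -/del => E.
apply: flat_dist_le; apply: (@affine_hull_comb _ _ _ _ _ (fun i => del^-1 *
  (if (i < size T0)%N then - F i else if i == size T0 then - (\det (rowsmx X) / pu a)
   else \det (rowsmx X) / pu p)) sub).
apply: (scalerI (lt0r_neq0 dl)); rewrite -/del scaler_sumr.
under eq_bigr => i _ do rewrite scalerA mulVKf ?lt0r_neq0 //.
rewrite size_map size_cat addn2 !big_ord_recr /= ltnn eqxx.
rewrite ltnNge leqnSn /= gtn_eqF //.
rewrite map_cat !nth_cat size_map ltnn subnn ltnNge leqnSn /= subSnn /=.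
rewrite (_ : \sum_(i < size T0) _ = - \sum_(l < size T0) F l *: X`_l); last first.
  rewrite -sumrN; apply: eq_bigr => i _; rewrite ltn_ord scaleNr; congr (- (_ *: _)).
  rewrite !nth_cat size_cat !size_map ltn_ord ltn_addr ?ltn_ord //.
  by rewrite !(nth_map (tnth (in_tuple T0) i)).
have -> : del *: hat x =
    \sum_(i < size tau) F (size T0 + i)%N *: X`_(size T0 + i) + del *: hat y.
  have -> : hat x = hat y + \sum_(i < size tau) cc i *: dir (net (nth g0 tau i)).
    under eq_bigr => i _ do rewrite lift_mxZ mulr0.
    by rewrite lift_mx_sum lift_mxD big1_eq addr0.
  rewrite scalerDr addrC scaler_sumr; congr (_ + _); apply: eq_bigr => i _.
  by rewrite scalerA /cc mulrC divfK ?lt0r_neq0 // (nth_mrows_net g0).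
rewrite -addrA scaleNr [- _ + _ *: hat (pt p)]addrC -E.
by rewrite -!addrA addKr.
Qed.

(* Read in the basis [mrows], the representation of [hat y] by a basis containing
   [hat (pt a)] and [hat (pt p)] has coordinates 0 along [w] and 1 along [hat y]. *)
Lemma main_complete a p (l : 'I_n -> R) (c : code d N -> R) :
  uniq tau -> free (w :: hat y :: brows T0 tau) ->
  free (brows (T0 ++ [:: a; p]) tau) -> l a != 0 -> l p != 0 ->
  hat y = \sum_(i <- T0 ++ [:: a; p]) l i *: hat (pt i)
          - \sum_(g <- tau) c g *: dir (net g) ->
  [/\ \det (rowsmx X) != 0, pu a != 0, pu p != 0, pal a - pal p != 0 &
    forall g0 i, (i < size tau)%N ->
      pgam i a - pgam i p = c (nth g0 tau i) * (pal a - pal p)].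
Proof.
move=> ut frw fr la lp yE.
have pe : perm_eq (w :: hat y :: brows T0 tau) X.
  by rewrite /X /mrows perm_sym perm_catC /= perm_sym; apply/seq.permP => z /=; lia.
have frX : free X by rewrite -(perm_free pe).
have uX := free_uniq frX; have dn := free_det frX size_mrows.
have ltW : (size T0 + size tau + 1 < d.+1)%N by clear -size_d; lia.
have ltY : (size T0 + size tau < d.+1)%N by clear -size_d; lia.
have memw : w \in X by rewrite mem_cat !inE eqxx !orbT.
have memT t : t \in T0 -> hat (pt t) \in X by move=> h; rewrite mem_cat mem_brows_pt.
have memtau g : g \in tau -> dir (net g) \in X by move=> h; rewrite mem_cat mem_brows_net.
have nthX i z : (i < d.+1)%N -> z \in X -> cramer X i z = (z == X`_i)%:R * \det (rowsmx X).
  by move=> *; rewrite cramer_mem ?size_mrows.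
have gen i (hi : (i < d.+1)%N) : cramer X i (hat y) =
    \sum_(t <- T0) l t * cramer X i (hat (pt t)) + l a * cramer X i (hat (pt a))
    + l p * cramer X i (hat (pt p)) - \sum_(g <- tau) c g * cramer X i (dir (net g)).
  rewrite {1}yE -sumrN; under [X in _ + X]eq_bigr => g _ do rewrite -scaleNr.
  rewrite (@cramerD _ _ _ (Ordinal hi)) !(@cramer_comb _ _ _ (Ordinal hi)) /=.
  rewrite big_cat /= !big_cons big_nil addr0 !addrA; congr (_ + _).
  by rewrite -sumrN; apply: eq_bigr => g _; rewrite mulNr.
have diff i j z : (i < d.+1)%N -> (j < d.+1)%N -> i != j -> z = X`_j -> cramer X i z = 0.
  move=> hi hj ij ->; rewrite nthX ?mem_nth ?size_mrows //.
  by rewrite nth_uniq ?size_mrows // eq_sym (negbTE ij) mul0r.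
have posT t : t \in T0 -> exists2 j, (j < size T0)%N & hat (pt t) = X`_j.
  move=> tT; exists (index t T0); first by rewrite index_mem.
  rewrite !nth_cat size_cat !size_map index_mem tT ltn_addr ?index_mem //.
  by rewrite (nth_map t) ?index_mem // nth_index.
have postau g : g \in tau -> exists2 j, (j < size tau)%N & dir (net g) = X`_(size T0 + j).
  move=> gt; exists (index g tau); first by rewrite index_mem.
  by rewrite (nth_mrows_net g) ?index_mem // nth_index.
have T0z i : (size T0 <= i)%N -> (i < d.+1)%N ->
    \sum_(t <- T0) l t * cramer X i (hat (pt t)) = 0.
  move=> le_i hi; apply: big1_seq => t /andP[_ /posT[j ltj e]].
  have jd : (j < d.+1)%N by clear -ltj le_i hi size_d; lia.
  have ij : i != j by clear -ltj le_i; lia.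
  by rewrite (diff _ _ _ hi jd ij e) mulr0.
have tz i : (size T0 + size tau <= i)%N -> (i < d.+1)%N ->
    \sum_(g <- tau) c g * cramer X i (dir (net g)) = 0.
  move=> le_i hi; apply: big1_seq => t /andP[_ /postau[j ltj e]].
  have jd : (size T0 + j < d.+1)%N by clear -ltj size_d; lia.
  have ij : i != (size T0 + j)%N by clear -ltj le_i; lia.
  by rewrite (diff _ _ _ hi jd ij e) mulr0.
(* Among the vectors representing [hat y], only those of a and p have coordinates along [w]. *)
have eqW : l a * pu a + l p * pu p = 0.
  have := gen _ ltW; rewrite T0z ?tz ?leq_addr //; last by rewrite -addnA leq_addr.
  rewrite add0r subr0 => <-; apply: (diff _ (size T0 + size tau)%N) => //.
    by rewrite addn1 neq_ltn ltnSn orbT.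
  by rewrite nth_mrows_y.
have eqY : l a * cramer X (size T0 + size tau) (hat (pt a)) +
    l p * cramer X (size T0 + size tau) (hat (pt p)) = \det (rowsmx X).
  have := gen _ ltY; rewrite T0z ?tz ?leq_addr //.
  rewrite add0r subr0 => <-; rewrite nthX // ?nth_mrows_y ?eqxx ?mul1r //.
  by rewrite -nth_mrows_y mem_nth // size_mrows.
have eqC g0 i : (i < size tau)%N -> l a * cramer X (size T0 + i) (hat (pt a)) +
    l p * cramer X (size T0 + i) (hat (pt p)) = c (nth g0 tau i) * \det (rowsmx X).
  move=> hi; have lti : (size T0 + i < d.+1)%N by clear -hi size_d; lia.
  have ni : (size T0 + i)%N != (size T0 + size tau)%N by rewrite eqn_add2l ltn_eqF.
  have := gen _ lti; rewrite T0z ?leq_addr //.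
  rewrite (diff _ _ _ lti ltY ni) ?nth_mrows_y //.
  rewrite add0r => /esym/eqP; rewrite subr_eq0 => /eqP ->.
  rewrite (bigD1_seq (nth g0 tau i)) ?mem_nth //= big1_seq => [|g /andP[gn gt]].
    by rewrite nthX ?memtau ?mem_nth // (nth_mrows_net g0) // eqxx mul1r addr0.
  rewrite nthX ?memtau // (nth_mrows_net g0) //.
  case: eqP => [/lift_mx_inj[_ /netv_inj e]|_]; last by rewrite mul0r mulr0.
  by rewrite e eqxx in gn.
(* If [pu a] vanished, so would [pu p]; then a whole basis would have coordinate 0 along [w], and
   [w] itself has not. *)
have ua : pu a != 0.
  apply/negP => /eqP ua0.
  have up0 : pu p = 0.
    by move/eqP: eqW; rewrite ua0 mulr0 add0r mulf_eq0 (negbTE lp) => /eqP.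
  have sB : size (brows (T0 ++ [:: a; p]) tau) = d.+1.
    by rewrite size_cat !size_map size_cat /= -addnA [(2 + _)%N]addnC addnA.
  have dB := free_det fr sB.
  have : cramer X (size T0 + size tau + 1) w = 0.
    rewrite (cramer_rep w dB) (@cramer_comb _ _ _ (Ordinal ltW)) big1 // => j _.
    have : (brows (T0 ++ [:: a; p]) tau)`_j \in brows (T0 ++ [:: a; p]) tau.
      by rewrite mem_nth // sB.
    move: (nth _ _ _) => z; rewrite /brows mem_cat => /orP[] /mapP[t].
      rewrite mem_cat !inE => /orP[|/orP[]] => [/posT[i lti e]|/eqP ->|/eqP ->] ->.
      - have id : (i < d.+1)%N by clear -lti size_d; lia.
        have ni : (size T0 + size tau + 1)%N != i by clear -lti; lia.
        by rewrite (diff _ _ _ ltW id ni e) mulr0.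
      - by rewrite -/(pu a) ua0 mulr0.
      - by rewrite -/(pu p) up0 mulr0.
    move=> /postau[i lti e] ->.
    have id : (size T0 + i < d.+1)%N by clear -lti size_d; lia.
    have ni : (size T0 + size tau + 1)%N != (size T0 + i)%N by clear -lti; lia.
    by rewrite (diff _ _ _ ltW id ni e) mulr0.
  by rewrite nthX // nth_mrows_w eqxx mul1r => /eqP; rewrite (negbTE dn).
have up : pu p != 0.
  apply: contraNneq ua => up0; move/eqP: eqW.
  by rewrite up0 mulr0 addr0 mulf_eq0 (negbTE la).
have lpE : l p = - (l a * pu a) / pu p.
  by apply/eqP; rewrite eq_sym -(inj_eq (mulIf up)) divfK // eq_sym -addr_eq0 addrC eqW.
(* The sign of this quotient is not controlled, so which of the two points has the smaller [pal]
   cannot be fixed in advance. *)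
have key : pal a - pal p = \det (rowsmx X) / (l a * pu a).
  rewrite -eqY lpE /pal; field.
  by rewrite la ua up.
split=> //; first by rewrite key mulf_neq0 // invr_eq0 mulf_neq0.
move=> g0 i hi; rewrite key mulrA -(eqC g0) // lpE /pgam; field.
by rewrite la ua up.
Qed.

End Pairs.
End Candidates.

(** * From bounds on all candidates to the approximation ratio *)

Section Approximation.
Variables (R : realType) (d N n : nat) (pt : 'I_n -> 'rV[R]_d) (y : 'rV[R]_d).
Hypothesis N_gt0 : (0 < N)%N.
Variables (k : nat) (beta : R).
Hypotheses (k_ge2 : (2 <= k)%N) (k_le_d : (k <= d)%N).

Local Notation net g := (netv R g).
Local Notation e_ j := (delta_mx 0 j : 'rV[R]_d.+1).

Hypothesis direct_bound : forall T (tau : seq (code d N)),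
  uniq T -> (0 < size T < k)%N -> (size T + size tau = d.+1)%N ->
  all (in_net R (N := N)) tau -> \det (rowsmx (brows pt T tau)) != 0 ->
  (forall i, (i < size tau)%N -> cf pt y T tau i <= 0) ->
  beta <= \sum_(i < size tau) - cf pt y T tau i.

(** In product form no sign of the difference of the [pal] is assumed, so the two points may be
    inserted in either order. *)
Hypothesis pair_bound : forall T0 (tau : seq (code d N)) (j : 'I_d.+1) a p,
  size T0 = (k - 2)%N -> size tau = (d.+1 - k)%N -> all (in_net R (N := N)) tau ->
  let w := e_ j in
  \det (rowsmx (mrows pt y T0 tau w)) != 0 ->
  pu pt y T0 tau w a != 0 -> pu pt y T0 tau w p != 0 ->
  (forall i, (i < size tau)%N -> pgam pt y T0 tau w i a <= pgam pt y T0 tau w i p) ->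
  beta * (pal pt y T0 tau w p - pal pt y T0 tau w a) <=
    pGam pt y T0 tau w p - pGam pt y T0 tau w a.

Lemma span_delta : <<[seq e_ j | j <- enum 'I_d.+1]>>%VS = fullv.
Proof.
apply/eqP; rewrite eqEsubv subvf /=; apply/subvP => v _.
rewrite (row_sum_delta v); apply: memv_suml => j _; apply: memvZ.
by apply: memv_span; apply: map_f; rewrite mem_enum.
Qed.

(** Since [l a] is nonzero, the relation can be solved for [hat (pt a)]. Were [hat y] in the span of
    T0 and tau, [hat (pt a)] would depend on the other vectors of the basis. *)
Lemma free_exchange T0 a p (tau : seq (code d N)) (l : 'I_n -> R) (c : code d N -> R) :
  free (brows pt (T0 ++ [:: a; p]) tau) -> l a != 0 ->
  hat y = \sum_(i <- T0 ++ [:: a; p]) l i *: hat (pt i)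
          - \sum_(g <- tau) c g *: dir (net g) ->
  free (hat y :: brows pt T0 tau).
Proof.
move=> fr la yE.
have pe : perm_eq (brows pt (T0 ++ [:: a; p]) tau)
    (hat (pt a) :: hat (pt p) :: brows pt T0 tau).
  by rewrite /brows map_cat -catA perm_catCA.
move: fr; rewrite (perm_free pe) !free_cons => /and3P[na _ fb].
rewrite fb andbT; apply: contra na => yin.
have inb z : z \in <<brows pt T0 tau>>%VS -> z \in <<hat (pt p) :: brows pt T0 tau>>%VS.
  by rewrite span_cons; apply: (subvP (addvSr _ _)).
have e : l a *: hat (pt a) = hat y - \sum_(i <- T0) l i *: hat (pt i)
     - l p *: hat (pt p) + \sum_(g <- tau) c g *: dir (net g).
  rewrite yE big_cat /= !big_cons big_nil addr0.
  have aux (V : zmodType) (A B C E : V) : B = A + (B + C) - E - A - C + E.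
    by rewrite addrAC [_ - A + E]addrAC subrK [A + _]addrC !addrK.
  exact: aux.
have : l a *: hat (pt a) \in <<hat (pt p) :: brows pt T0 tau>>%VS.
  rewrite e; apply: memvD; [apply: memvB; [apply: memvB|]|].
  - exact: inb.
  - apply: inb; rewrite big_seq; apply: memv_suml => i hi; apply: memvZ.
    by apply: memv_span; exact: mem_brows_pt.
  - by apply: memvZ; apply: memv_span; exact: mem_head.
  - apply: inb; rewrite big_seq; apply: memv_suml => g hg; apply: memvZ.
    by apply: memv_span; exact: mem_brows_net.
by move/(memvZ (l a)^-1); rewrite scalerA mulVf // scale1r.
Qed.

(** The unit vectors span, so one of them completes the basis; this leaves only d + 1 choices of w
    to the program. *)
Lemma free_delta (X : seq 'rV[R]_d.+1) : free X -> size X = d ->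
  exists j, free (e_ j :: X).
Proof.
move=> fX sX; have [W [Wsub Wfr Wspan]] := free_extend [seq e_ j | j <- enum 'I_d.+1] fX.
have sW : size (W ++ X) = d.+1.
  have <- : \dim <<W ++ X>> = size (W ++ X) by exact/eqP.
  have -> : <<W ++ X>>%VS = fullv.
    by apply/eqP; rewrite eqEsubv subvf /= -span_delta.
  by rewrite dimvf /dim /= mul1n.
have {sW} : size W = 1%N by move: sW; rewrite size_cat sX; clear; lia.
case: W Wsub Wfr {Wspan} => [|w [|]] // sub fr _.
have /mapP[j _ wE] := sub w (mem_head _ _).
by exists j; rewrite -wE.
Qed.

Lemma bound_comb (a : 'I_n -> R) x : \sum_i a i = 1 -> x = \sum_i a i *: pt i ->
  (#|[set i | a i != 0%R]%SET| <= k)%N ->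
  N%:R * beta <= (1 + d%:R / N%:R) * enorm (y - x).
Proof.
move=> a1 xE card_a.
have [T [tau [l [c [[uT Tl Ta] [ut nt c0] [fr sz] yE le]]]]] := basic_rep y N_gt0 a1 xE.
apply: le_trans le; rewrite ler_wpM2l ?ler0n //.
have sT : (size T <= k)%N.
  rewrite -(card_uniqP uT); apply: leq_trans card_a; apply: subset_leq_card.
  by apply/fintype.subsetP => i iT; rewrite inE Ta.
have T0 : (0 < size T)%N.
  case: T yE {uT Tl Ta fr sz sT} => // /esym.
  rewrite big_nil sub0r -sumrN.
  under eq_bigr => g _ do rewrite -scaleNr lift_mxZ mulr0.
  by rewrite lift_mx_sum big1_eq => /esym/lift_mx_inj[/eqP]; rewrite oner_eq0.
pose g0 : code d N := [ffun=> ord0].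
have [ltk|gek] := ltnP (size T) k.
  have [dn ce] := direct_complete sz fr ut yE.
  apply: le_trans (direct_bound uT _ sz nt dn _) _.
  - by rewrite T0.
  - by move=> i hi; rewrite (ce g0) // oppr_le0.
  - rewrite (big_nth g0) big_mkord ler_sum // => i _.
    by rewrite (ce g0) // opprK.
have {gek} {}sT : size T = k by apply/eqP; rewrite eqn_leq sT.
have [T0' [a0 [p0 eT]]] : exists T1 a1 p1, T = T1 ++ [:: a1; p1].
  move: sT k_ge2; clear; case/lastP: T => [|T p1]; first by move=> /= <-.
  case/lastP: T => [|T a1']; first by move=> /= <-.
  by move=> _ _; exists T, a1', p1; rewrite -!cats1 -catA.
subst T; have sT0 : size T0' = (k - 2)%N by move: sT; rewrite size_cat /=; clear; lia.
have st : size tau = (d.+1 - k)%N by move: sz; rewrite sT; clear; lia.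
have la : l a0 != 0 by rewrite -Tl mem_cat !inE eqxx orbT.
have lp : l p0 != 0 by rewrite -Tl mem_cat !inE eqxx !orbT.
have sb : (size T0' + size tau + 2 = d.+1)%N.
  by rewrite sT0 st; clear -k_ge2 k_le_d; lia.
have [j frw] : exists j, free (e_ j :: hat y :: brows pt T0' tau).
  apply: free_delta; first exact: free_exchange fr la yE.
  by rewrite /= size_cat !size_map; clear -sb; lia.
have [dn ua up dal dgam] := main_complete sb nt ut frw fr la lp yE.
set al := pal pt y T0' tau (e_ j) in dal dgam.
have dGam : pGam pt y T0' tau (e_ j) a0 - pGam pt y T0' tau (e_ j) p0 =
    (\sum_(g <- tau) c g) * (al a0 - al p0).
  rewrite /pGam -sumrB mulr_suml (big_nth g0) big_mkord.
  by apply: eq_bigr => i _; rewrite (dgam g0).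
(* The point with the smaller [al] takes the first role in [pair_bound], the other one the
   second. *)
have [lt0|gt0] := ltP (al a0 - al p0) 0.
  have := pair_bound sT0 st nt dn ua up; rewrite /= -/al => h.
  have : beta * (al p0 - al a0) <= (\sum_(g <- tau) c g) * (al p0 - al a0).
    rewrite -[X in _ <= _ * X]opprB mulrN -dGam opprB; apply: h => i hi.
    by rewrite -subr_le0 (dgam g0) // mulr_ge0_le0 // ltW.
  by rewrite ler_pM2r // -opprB oppr_gt0.
have {}gt0 : 0 < al a0 - al p0 by rewrite lt_neqAle eq_sym dal.
have := pair_bound sT0 st nt dn up ua; rewrite /= -/al => h.
have : beta * (al a0 - al p0) <= (\sum_(g <- tau) c g) * (al a0 - al p0).
  rewrite -dGam; apply: h => i hi.
  by rewrite -subr_ge0 (dgam g0) // mulr_ge0 // ltW.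
by rewrite ler_pM2r.
Qed.

Lemma bound_dist (s : seq 'I_n) : uniq s -> size s = k ->
  N%:R * beta <= (1 + d%:R / N%:R) * flat_dist y (affine_hull [seq pt i | i <- s]).
Proof.
move=> us ss; have pos : 0 < 1 + d%:R / N%:R :> R.
  by rewrite ltr_wpDr // divr_ge0.
rewrite -ler_pdivrMl //; apply: lb_le_inf.
  (* A lower bound passes to the infimum only for a nonempty set; the first of the k points is a
     witness. *)
  case: s ss us => [|i s] /= ss us; first by move: k_ge2; rewrite -ss.
  exists (enorm (y - pt i)), (pt i) => //.
  exists (fun r => (r == ord0)%:R); split.
    by rewrite (bigD1 ord0) //= big1 ?addr0 // => r /negbTE ->.
  rewrite (bigD1 ord0) //= big1 ?addr0 ?scale1r // => r /negbTE ->.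
  by rewrite scale0r.
move=> _ [x [a [a1 xE]] <-]; rewrite ler_pdivrMl //.
have sz r : (r < size [seq pt i | i <- s])%N -> (r < size s)%N by rewrite size_map.
pose i_ (r : 'I_(size [seq pt i | i <- s])) := tnth (in_tuple s) (Ordinal (sz r (ltn_ord r))).
pose a' i := \sum_(r | i_ r == i) a r.
apply: (@bound_comb a').
- by rewrite -a1 [in RHS](partition_big i_ xpredT).
- rewrite xE (partition_big i_ xpredT) //=; apply: eq_bigr => i _.
  rewrite scaler_suml; apply: eq_bigr => r /eqP <-.
  congr (_ *: _); rewrite (nth_map (i_ r)) ?sz //; congr (pt _).
  exact: (esym (tnth_nth (i_ r) (in_tuple s) (Ordinal (sz r (ltn_ord r))))).
- rewrite -ss -(card_uniqP us); apply: subset_leq_card; apply/fintype.subsetP => i.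
  rewrite inE; apply: contraR => ni; rewrite /a' big1 // => r /eqP e.
  by case/negP: ni; rewrite -e mem_tnth.
Qed.

End Approximation.

(** * Digits and binary levels *)

(** Tuples of points and tuples of levels are enumerated as numbers and recovered from their digits.
    The division is iterated, as in the expression that the program evaluates. *)
Definition dig (B v i : nat) : nat := (iter i (fun x => x %/ B) v %% B)%N.

Fixpoint undig (B : nat) (xs : seq nat) : nat :=
  if xs is x :: xs' then (undig B xs' * B + x)%N else 0%N.

Lemma dig_undig B xs i : all (fun x => x < B)%N xs -> (i < size xs)%N ->
  dig B (undig B xs) i = nth 0%N xs i.
Proof.
elim: xs i => //= x xs IH [|i] /andP[hx hxs] hi.
  by rewrite /dig /= modnMDl modn_small.
rewrite /dig iterSr divnMDl; last by apply: leq_ltn_trans hx.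
by rewrite divn_small // addn0; exact: IH.
Qed.

Lemma undig_lt B xs : all (fun x => x < B)%N xs -> (undig B xs < B ^ size xs)%N.
Proof.
elim: xs => //= x xs IH /andP[hx /IH h].
rewrite expnS; apply: (@leq_trans ((undig B xs).+1 * B)%N); last by rewrite mulnC leq_mul2l h orbT.
by rewrite mulSn [(B + _)%N]addnC -addnS leq_add2l.
Qed.

Lemma undig_inj B xs ys : size xs = size ys ->
  all (fun x => x < B)%N xs -> all (fun x => x < B)%N ys ->
  undig B xs = undig B ys -> xs = ys.
Proof.
move=> ss hx hy e; apply: (@eq_from_nth _ 0%N) => // i hi.
by rewrite -(dig_undig hx) // -(dig_undig hy) -?ss // e.
Qed.

Lemma dig_lt B v i : (0 < B)%N -> (dig B v i < B)%N.
Proof. exact: ltn_pmod. Qed.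

Lemma dig_surj B (f : nat -> nat) m : (forall i, (i < m)%N -> (f i < B)%N) ->
  exists2 v, (v < B ^ m)%N & forall i, (i < m)%N -> dig B v i = f i.
Proof.
move=> hf; have h : all (fun x => x < B)%N (mkseq f m).
  by apply/allP => x /mapP[i]; rewrite mem_iota => hi ->; exact: hf.
exists (undig B (mkseq f m)); first by have := undig_lt h; rewrite size_mkseq.
by move=> i hi; rewrite dig_undig ?size_mkseq // nth_mkseq.
Qed.

(* The highest bit in which [x] and [y] differ. *)
Lemma split_level L x y : (x < y)%N -> (y < 2 ^ L.+1)%N ->
  exists2 b, (b <= L)%N &
    [/\ (x %/ 2 ^ b.+1 = y %/ 2 ^ b.+1)%N, ~~ odd (x %/ 2 ^ b) & odd (y %/ 2 ^ b)].
Proof.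
elim: L x y => [|L IH] x y hxy hy.
  have [ex ey] : x = 0%N /\ y = 1%N by clear -hxy hy; rewrite expn1 in hy; lia.
  by exists 0%N; rewrite ?ex ?ey.
(* If the halves differ the bit is found in them; if they agree it is the lowest one. *)
have [lt2|ge2] := ltnP (x %/ 2) (y %/ 2).
  have [|b hb [h1 h2 h3]] := IH _ _ lt2.
    by rewrite ltn_divLR // -expnSr.
  exists b.+1 => //; move: h1 h2 h3; rewrite -!divnMA -!expnS => h1 h2 h3.
  by split.
exists 0%N => //; rewrite expn0 expn1 !divn1; clear -hxy ge2.
by have := modn2 x; have := modn2 y; case: (odd x); case: (odd y) => /= ? ?; split=> //; lia.
Qed.

(* Doubled ranks, shifted by one for the larger element, so that equal ranks
   are also separated at some level. *)
Lemma level_exists L r r' : (r <= r')%N -> (r' < 2 ^ L)%N ->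
  exists2 b, (b <= L)%N & [/\ (r %/ 2 ^ b = r' %/ 2 ^ b)%N,
    ~~ odd ((r * 2) %/ 2 ^ b) & odd ((r' * 2).+1 %/ 2 ^ b)].
Proof.
move=> le_r lt_r'.
have [||b hb [h1 h2 h3]] := @split_level L (r * 2) (r' * 2).+1.
- by clear -le_r; lia.
- by rewrite expnSr; clear -lt_r'; lia.
exists b => //; split=> //; move: h1; rewrite !expnS !divnMA.
by rewrite mulnK // -[(r' * 2).+1]addn1 divnMDl // addn0.
Qed.

(** The quotients by 2^b of the ranks are the bits above b of both 2 r and 2 r' + 1. These agree, so
    bit b decides: 2 r < 2 r' + 1. *)
Lemma level_le r r' b : (r %/ 2 ^ b = r' %/ 2 ^ b)%N -> ~~ odd ((r * 2) %/ 2 ^ b) ->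
  odd ((r' * 2).+1 %/ 2 ^ b) -> (r <= r')%N.
Proof.
move=> h1 h2 h3; rewrite leqNgt; apply/negP => lt_r.
have le2 : ((r' * 2).+1 %/ 2 ^ b <= (r * 2) %/ 2 ^ b)%N.
  by apply: leq_div2r; clear -lt_r; lia.
have e : ((r * 2) %/ 2 ^ b %/ 2 = (r' * 2).+1 %/ 2 ^ b %/ 2)%N.
  by rewrite -!divnMA -expnSr !expnS !divnMA mulnK // -[(r' * 2).+1]addn1 divnMDl // addn0.
move: h2 h3 le2 e; move: (_ %/ _)%N (_ %/ _)%N => u v; clear => hu hv.
by have := modn2 u; have := modn2 v; rewrite hv (negbTE hu) /=; lia.
Qed.

(** * Convex hulls *)

Section Hull.
Variables (R : realType) (A G : nat -> R).
Implicit Types (lam : R) (p : nat) (L : seq nat).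

Definition tilt lam p := G p - lam * A p.

(** The head is the top of the stack. Convexity at three consecutive vertices is stated by its use:
    at a slope [lam >= 0], if the top is no worse than its neighbour, the neighbour is no worse than
    the next. At equal abscissae the newer point is strictly lower. *)
Definition convex_top L : Prop :=
  match L with
  | p1 :: p2 :: L' => (A p2 <= A p1 /\ (A p2 = A p1 -> G p1 < G p2)) /\
      (if L' is p3 :: _ then
         forall lam, 0 <= lam -> tilt lam p1 <= tilt lam p2 -> tilt lam p2 <= tilt lam p3
       else True)
  | _ => True
  end.

Fixpoint hull L : Prop := if L is _ :: L' then convex_top L /\ hull L' else True.

(** Tilts that do not decrease at the first step never decrease further down, so comparing the two
    top elements is enough. *)
Lemma hull_min lam p1 L : hull (p1 :: L) -> 0 <= lam ->
  (if L is p2 :: _ then tilt lam p1 <= tilt lam p2 else true) ->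
  forall p, p \in p1 :: L -> tilt lam p1 <= tilt lam p.
Proof.
elim: L p1 => [|p2 L IH] p1 [h1 h2] lam0 h p.
  by rewrite inE => /eqP ->.
rewrite in_cons => /orP[/eqP ->//|pin].
apply: (le_trans h); apply: IH => //.
by case: L h1 {h2 pin} => // p3 L [_]; apply.
Qed.

(** The slope from p2 to p1 is at most that from p3 to p2, cleared of denominators: p2 is not
    strictly below the chord of its neighbours. *)
Definition cross p3 p2 p1 : bool :=
  (G p1 - G p2) * (A p2 - A p3) <= (G p2 - G p3) * (A p1 - A p2).

Lemma cross_pop p3 p2 p1 lam : A p3 <= A p2 -> A p2 <= A p1 ->
  (A p2 = A p1 -> G p1 < G p2) -> cross p3 p2 p1 ->
  tilt lam p3 <= tilt lam p2 \/ tilt lam p1 <= tilt lam p2.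
Proof.
move=> h32 h21 tie; rewrite /cross /tilt => hc.
have [e|ne] := eqVneq (A p2) (A p1).
  by right; rewrite e lerD2r ltW // tie.
have lt21 : A p2 < A p1 by rewrite lt_neqAle ne.
have [|h3] := leP (G p3 - lam * A p3) (G p2 - lam * A p2); first by left.
right; rewrite leNgt; apply/negP => h1.
have : 0 < (A p1 - A p2) * ((G p3 - lam * A p3) - (G p2 - lam * A p2)).
  by rewrite mulr_gt0 // subr_gt0.
have : 0 <= (A p2 - A p3) * ((G p1 - lam * A p1) - (G p2 - lam * A p2)).
  by rewrite mulr_ge0 // subr_ge0 // ltW.
by clear -hc; nra.
Qed.

Lemma cross_push p3 p2 p1 lam : A p3 <= A p2 -> A p2 <= A p1 -> ~~ cross p3 p2 p1 ->
  tilt lam p1 <= tilt lam p2 -> tilt lam p2 <= tilt lam p3.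
Proof.
rewrite /cross /tilt -ltNge => h32 h21 hc h.
have [e|ne] := eqVneq (A p2) (A p1).
  move: hc h; rewrite -e subrr mulr0 lerD2r => hc h.
  by have : (G p1 - G p2) * (A p2 - A p3) <= 0; [rewrite mulr_le0_ge0 // ?subr_le0 // subr_ge0|rewrite leNgt hc].
have lt21 : A p2 < A p1 by rewrite lt_neqAle ne.
have h' : (G p1 - G p2) <= lam * (A p1 - A p2) by clear -h; nra.
have : (G p2 - G p3) * (A p1 - A p2) <= (lam * (A p2 - A p3)) * (A p1 - A p2).
  apply: (le_trans (ltW hc)); rewrite mulrAC ler_wpM2r // subr_ge0 //.
rewrite ler_pM2r ?subr_gt0 //; clear; nra.
Qed.

(** Lowering the slope favours small abscissae; this is what makes pops during the queries
    irrevocable. *)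
Lemma tilt_le_mono p2 p1 lam lam' : A p2 <= A p1 -> lam' <= lam ->
  tilt lam p2 <= tilt lam p1 -> tilt lam' p2 <= tilt lam' p1.
Proof.
rewrite /tilt => h1 h2 h3.
have : 0 <= (lam - lam') * (A p1 - A p2) by rewrite mulr_ge0 // subr_ge0.
by clear -h3; nra.
Qed.

End Hull.

(** * Tournament trees *)

Section Tournament.
Variables (R : realType) (K : nat -> R) (L n : nat).

(* A leaf or node holds 0 when empty, and [p.+1] for the element [p]. *)
Definition better (x y : nat) : nat :=
  if (0 < x)%N && ((y == 0%N) || (K x.-1 <= K y.-1)) then x else y.

(** Heap numbering: the root is 1, the children of x are 2x and 2x + 1, and element p has the leaf
    2^L + p. *)
Definition tree_ok (T : nat -> nat) := forall x, (0 < x < 2 ^ L)%N ->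
  T x = better (T (2 * x)%N) (T (2 * x + 1)%N).

Lemma betterP x y : [/\ better x y = 0%N -> x = 0%N /\ y = 0%N,
  better x y = x \/ better x y = y,
  (0 < x)%N -> (0 < better x y)%N /\ K (better x y).-1 <= K x.-1 &
  (0 < y)%N -> (0 < better x y)%N /\ K (better x y).-1 <= K y.-1].
Proof.
rewrite /better; case: ifP => [/andP[x0 h]|h].
  split=> //; [by move=> e; rewrite e in x0|by left|move=> y0].
  by split=> //; move: h; rewrite eqn0Ngt y0.
split; [|by right| |by []].
  by move=> e; split=> //; apply/eqP; move: h; rewrite e /= andbT; case: (x).
move=> x0; move: h; rewrite x0 /= => /norP[]; rewrite -lt0n => y0 h.
by split=> //; rewrite ltW // ltNge.
Qed.

(** Halving the number of the leaf climbs to the root, and the key of the winner never increases on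
    the way. *)
Lemma tree_min T p : tree_ok T -> (p < 2 ^ L)%N -> (0 < T (2 ^ L + p)%N)%N ->
  (0 < T 1%N)%N /\ K (T 1%N).-1 <= K (T (2 ^ L + p)%N).-1.
Proof.
move=> ok lt_p T0.
suff H h : (h <= L)%N -> (0 < T ((2 ^ L + p) %/ 2 ^ h)%N)%N /\
    K (T ((2 ^ L + p) %/ 2 ^ h)%N).-1 <= K (T (2 ^ L + p)%N).-1.
  have := H L (leqnn L); rewrite -{1 3}[(2 ^ L)%N]mul1n !divnMDl ?expn_gt0 //.
  by rewrite divn_small ?addn0.
elim: h => [|h IH] le_h; first by rewrite expn0 divn1.
have [h1 h2] := IH (ltnW le_h).
set x := ((2 ^ L + p) %/ 2 ^ h)%N in h1 h2.
have xE : ((2 ^ L + p) %/ 2 ^ h.+1 = x %/ 2)%N by rewrite expnSr divnMA.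
rewrite xE; have gx : (2 <= x)%N.
  rewrite leq_divRL ?expn_gt0 // -expnS; apply: leq_trans (leq_addr _ _).
  by rewrite leq_exp2l.
have lx : (x %/ 2 < 2 ^ L)%N.
  rewrite -xE ltn_divLR ?expn_gt0 //.
  apply: (@leq_trans (2 ^ L * 2)); first by clear -lt_p; lia.
  by rewrite leq_mul2l expnS leq_pmulr ?expn_gt0 ?orbT.
rewrite ok; last by rewrite lx andbT divn_gt0.
have [_ _ bl br] := betterP (T (2 * (x %/ 2))%N) (T (2 * (x %/ 2) + 1)%N).
have [e|e] : x = (2 * (x %/ 2))%N \/ x = (2 * (x %/ 2) + 1)%N by clear; lia.
  by rewrite -e in bl *; have [h3 h4] := bl h1; split=> //; exact: le_trans h4 h2.
by rewrite -e in br *; have [h3 h4] := br h1; split=> //; exact: le_trans h4 h2.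
Qed.

(** Every inner node copies one of its children, so a property of all leaves holds everywhere. It
    shows that the root names an element not yet extracted, and that the tree is empty at the
    end. *)
Lemma tree_ind T (P : nat -> Prop) : tree_ok T -> P 0%N ->
  (forall p, (p < 2 ^ L)%N -> P (T (2 ^ L + p)%N)) ->
  forall x, (0 < x < 2 ^ L.+1)%N -> P (T x).
Proof.
move=> ok P0 Pl x; have [m] := ubnP (2 ^ L.+1 - x); elim: m x => // m IH x hm hx.
have [lt_x|ge_x] := ltnP x (2 ^ L).
  rewrite ok; last by case/andP: hx => -> _.
  have [_ [->|->] _ _] := betterP (T (2 * x)%N) (T (2 * x + 1)%N); apply: IH;
    rewrite expnS in hm hx *; clear -lt_x hx hm; lia.
have -> : x = (2 ^ L + (x - 2 ^ L))%N by rewrite subnKC.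
by apply: Pl; rewrite expnS in hx; clear -hx ge_x; lia.
Qed.

End Tournament.

Section SortedPrefix.
Variables (R : realType) (K : nat -> R) (n : nat).
Implicit Types (ord rk : nat -> nat) (t : nat).

(** The rank of an element is the position of the first element with the same key: equal keys get
    equal ranks, and comparing ranks is exactly comparing keys. *)
Record sorted_prefix ord rk t : Prop := SortedPrefix {
  sp_uniq : uniq (mkseq ord t);
  sp_lt : forall i, (i < t)%N -> (ord i < n)%N;
  sp_le : forall i j, (i <= j)%N -> (j < t)%N -> K (ord i) <= K (ord j);
  sp_min : forall i q, (i < t)%N -> (q < n)%N -> q \notin mkseq ord t -> K (ord i) <= K q;
  sp_rk_le : forall i, (i < t)%N -> (rk (ord i) <= i)%N;
  sp_rk : forall i j, (i <= j)%N -> (j < t)%N ->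
    (rk (ord i) <= rk (ord j))%N /\ (rk (ord i) == rk (ord j)) = (K (ord i) == K (ord j)) }.

Lemma sorted_prefix_step ord rk ord' rk' t q : sorted_prefix ord rk t ->
  (q < n)%N -> q \notin mkseq ord t ->
  (forall p, (p < n)%N -> p \notin mkseq ord t -> K q <= K p) ->
  (forall i, (i < t)%N -> ord' i = ord i) -> ord' t = q ->
  (forall p, p != q -> rk' p = rk p) ->
  rk' q = (if (0 < t)%N && (K q <= K (ord t.-1)) then rk (ord t.-1) else t) ->
  sorted_prefix ord' rk' t.+1.
Proof.
move=> [u lt le mn rl rkP] qn qnin qmin e1 e2 r1 r2.
have em : mkseq ord' t.+1 = rcons (mkseq ord t) q.
  rewrite /mkseq -{1}[t.+1]addn1 iotaD map_cat cats1 /= e2; congr rcons.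
  by apply/eq_in_map => i; rewrite mem_iota => /e1.
have nq i : (i < t)%N -> ord i != q.
  move=> it; apply: contraNneq qnin => <-; apply: map_f.
  by rewrite mem_iota.
have rq : (rk' q <= t)%N.
  rewrite r2; case: ifP => // /andP[t0 _].
  by apply: leq_trans (rl _ _) _; rewrite ?ltn_predL // leq_pred.
split.
- by rewrite em rcons_uniq qnin.
- by move=> i; rewrite ltnS leq_eqVlt => /orP[/eqP ->|it]; rewrite ?e2 // e1 ?lt.
- move=> i j ij; rewrite ltnS leq_eqVlt => /orP[/eqP ej|jt]; last first.
    by rewrite !e1 ?le // (leq_ltn_trans ij).
  subst j; rewrite e2; move: ij; rewrite leq_eqVlt => /orP[/eqP ->|it]; first by rewrite e2.
  by rewrite e1 // mn.
- move=> i p; rewrite ltnS em mem_rcons in_cons negb_or => it pn /andP[pq pnin].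
  move: it; rewrite leq_eqVlt => /orP[/eqP ->|it]; first by rewrite e2 qmin.
  by rewrite e1 // mn.
- move=> i; rewrite ltnS leq_eqVlt => /orP[/eqP ->|it]; first by rewrite e2.
  by rewrite e1 // r1 ?nq // rl.
- move=> i j ij; rewrite ltnS leq_eqVlt => /orP[/eqP ej|jt]; last first.
    have it := leq_ltn_trans ij jt.
    by rewrite !e1 // !r1 ?nq //; exact: rkP.
  subst j; rewrite e2; move: ij; rewrite leq_eqVlt => /orP[/eqP ->|it].
    by rewrite e2 !eqxx.
  have t0 : (0 < t)%N by exact: leq_trans it.
  have tl : (t.-1 < t)%N by rewrite ltn_predL.
  have itl : (i <= t.-1)%N by rewrite -ltnS prednK.
  have [h1 h2] := rkP _ _ itl tl.
  rewrite e1 // r1 ?nq // r2 t0 /=; case: ifP => hK.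
    by split=> //; rewrite h2 (_ : K q = K (ord t.-1)) //; apply/le_anti; rewrite hK mn.
  have rlt : (rk (ord i) < t)%N by apply: leq_ltn_trans (rl _ _) _.
  split; first exact: ltnW.
  rewrite ltn_eqF //; apply/esym/negbTE; rewrite lt_eqF //.
  by apply: (le_lt_trans (le _ _ itl tl)); rewrite ltNge hK.
Qed.

Lemma sorted_prefix_full ord rk : sorted_prefix ord rk n ->
  [/\ forall p, (p < n)%N -> exists2 i, (i < n)%N & ord i = p,
      forall p, (p < n)%N -> (rk p < n)%N &
      forall p q, (p < n)%N -> (q < n)%N -> (rk p <= rk q)%N = (K p <= K q)].
Proof.
move=> [u lt le mn rl rkP].
have surj p : (p < n)%N -> exists2 i, (i < n)%N & ord i = p.
  have sub : {subset mkseq ord n <= iota 0 n}.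
    by move=> z /mapP[i]; rewrite !mem_iota => hi ->; exact: lt.
  have [|_ e] := uniq_min_size u sub; first by rewrite size_iota size_mkseq.
  move=> pn; have : p \in mkseq ord n by rewrite e mem_iota.
  by case/mapP => i; rewrite mem_iota => hi ->; exists i.
split=> // [p /surj[i hi <-]|p q /surj[i hi <-] /surj[j hj <-]].
  exact: leq_ltn_trans (rl _ hi) hi.
have [ij|/ltnW ji] := leqP i j.
  have [h1 _] := rkP _ _ ij hj; by rewrite h1 le.
have [h1 h2] := rkP _ _ ji hi; have h3 := le _ _ ji hi.
by rewrite leq_eqVlt ltnNge h1 orbF eq_sym h2 eq_le h3.
Qed.

End SortedPrefix.

(** * Sorting *)

Arguments set_cell : simpl never.

Lemma cellE (T : Type) (m : nat -> nat -> T) a i v a' i' :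
  set_cell m a i v a' i' = if (a' == a) && (i' == i) then v else m a' i'.
Proof. by []. Qed.

Lemma wp_wvar (R : realType) (M : nat) x e (s : state R) Q :
  Q 1%N (setw s x 0 (weval M s e)) -> wp M (WSet x (WConst 0) e) s Q.
Proof. by move=> h; apply: wp_wset; rewrite /= mod0n. Qed.

(* Word arrays: a scalar variable is cell 0 of its array. *)
Notation vI := 2%N.      (* index of the tuple *)
Notation vP := 3%N.      (* loop over points *)
Notation vL := 4%N.      (* least L with n <= 2 ^ L *)
Notation aPOW := 5%N.    (* powers of 2 *)
Notation vE := 6%N.      (* index of the tuple of levels *)
Notation aTOP := 7%N.    (* stack tops, by key *)
Notation aBEL := 8%N.    (* next element of the stack *)
Notation aVAL := 9%N.    (* validity flags *)
Notation aTREE := 10%N.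
Notation vT := 11%N.
Notation vX := 12%N.
Notation aORD := 13%N.
Notation vG := 14%N.
Notation vQ := 15%N.
Notation aRK := (fun i => 16 + i)%N.

Notation aBEST := 2%N.
Notation aAL := 3%N.
Notation aGG := 4%N.
Notation aGA := (fun i => 5 + i)%N.

Notation "'WC' c" := (WConst c) (at level 8, c at level 8).

Definition powE e := WGet aPOW e.
Definition nE := wvar 0.
Definition isZ e := WLe e (WC 0).

Section Sort.
Variables (R : realType) (M n L : nat).
Hypotheses (n_ge2 : (2 <= n)%N) (n_le : (n <= 2 ^ L)%N) (M_big : (2 ^ L.+1 < M)%N).

Let M1 : (1 %% M = 1)%N.
Proof. by rewrite modn_small //; apply: leq_ltn_trans M_big; rewrite expn_gt0. Qed.

Let M2 : (2 %% M = 2)%N.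
Proof.
rewrite modn_small //; apply: leq_ltn_trans M_big.
by rewrite expnS leq_pmulr // expn_gt0.
Qed.

Let nM : (n < M)%N.
Proof.
apply: (leq_ltn_trans n_le); apply: leq_ltn_trans M_big.
by rewrite leq_exp2l.
Qed.

Record envL (s : state R) : Prop := EnvL {
  envL_n : words s 0 0 = n;
  envL_L : words s vL 0 = L;
  envL_pow : forall i, (i <= L)%N -> words s aPOW i = (2 ^ i)%N }.

Lemma envL_frame c s s' : envL s -> frame c s s' ->
  ~~ wmod 0 c -> ~~ wmod vL c -> ~~ wmod aPOW c -> envL s'.
Proof.
move=> [h1 h2 h3] [hw _] m1 m2 m3.
by split=> [||i hi]; rewrite hw //; exact: h3.
Qed.

Variable key : nat.

Definition treeE e := WGet aTREE e.
Definition keyE e := RGet key (WSub e (WC 1)).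

(** Computes [better]; tests have no disjunction, hence the negated conjunction. For an empty child
    [keyE] reads cell 0 by truncated subtraction, but the value does not influence the outcome. *)
Definition recompute : cmd :=
  let l := treeE (WMul (WC 2) (wvar vX)) in
  let r := treeE (WAdd (WMul (WC 2) (wvar vX)) (WC 1)) in
  If (TAnd (WLe (WC 1) l) (TNot (TAnd (TNot (isZ r)) (TNot (RLe (keyE l) (keyE r))))))
     (WSet aTREE (wvar vX) l) (WSet aTREE (wvar vX) r).

Definition update (ep ev : wexp) : cmd :=
  seqs [:: WSet vX (WC 0) (WAdd (powE (wvar vL)) ep);
           WSet aTREE (wvar vX) ev;
           WSet vX (WC 0) (WDiv (wvar vX) (WC 2));
           While (WLe (WC 1) (wvar vX))
             (Seq recompute (WSet vX (WC 0) (WDiv (wvar vX) (WC 2))))].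

Variable K : nat -> R.

Lemma wp_recompute s x :
  words s vX 0 = x -> (0 < x < 2 ^ L)%N -> (forall i, reals s key i = K i) ->
  wp M recompute s (fun t s' => t = 2%N /\ s' = setw s aTREE x
    (better K (words s aTREE (2 * x)%N) (words s aTREE (2 * x + 1)%N))).
Proof.
move=> hx /andP[x0 xL] hK.
have m2x : ((2 %% M * x) %% M = 2 * x)%N.
  by rewrite M2 modn_small //; apply: leq_ltn_trans M_big; rewrite expnS leq_mul2l ltnW.
have m2x1 : ((2 * x + 1) %% M = 2 * x + 1)%N.
  by rewrite modn_small //; apply: leq_ltn_trans M_big; rewrite expnS; clear -xL; lia.
have e : teval M s (TAnd (WLe (WC 1) (treeE (WMul (WC 2) (wvar vX))))
    (TNot (TAnd (TNot (isZ (treeE (WAdd (WMul (WC 2) (wvar vX)) (WC 1)))))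
      (TNot (RLe (keyE (treeE (WMul (WC 2) (wvar vX))))
         (keyE (treeE (WAdd (WMul (WC 2) (wvar vX)) (WC 1))))))))) =
   ((0 < words s aTREE (2 * x)%N)%N && ((words s aTREE (2 * x + 1)%N == 0%N) ||
     (K (words s aTREE (2 * x)%N).-1 <= K (words s aTREE (2 * x + 1)%N).-1))).
  by rewrite /= !mod0n hx m2x M1 m2x1 !subn1 !hK leqn0 negb_and !negbK.
apply: wp_if => h; apply: wp_wset; split=> //; rewrite e in h;
  by rewrite /= !mod0n hx m2x ?M1 ?m2x1 /better ?h // (negbTE h).
Qed.

(** During the climb the tree equation can fail only at the node in [vX]; once [vX] is 0 it holds
    everywhere. Each of the at most L turns costs 5 steps. *)
Lemma wp_update ep ev s p v :
  envL s -> weval M s ep = p -> (p < 2 ^ L)%N ->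
  (forall i, weval M (setw s vX 0 i) ev = v) -> (forall i, reals s key i = K i) ->
  tree_ok K L (words s aTREE) ->
  wp M (update ep ev) s (fun t s' => [/\ (t <= 5 * L + 9)%N,
    tree_ok K L (words s' aTREE) &
    forall q, (q < 2 ^ L)%N -> words s' aTREE (2 ^ L + q)%N =
      if q == p then v else words s aTREE (2 ^ L + q)%N]).
Proof.
move=> envs hp lt_p hv hK ok.
apply: wp_seq; apply: wp_wvar.
have -> : weval M s (WAdd (powE (wvar vL)) ep) = (2 ^ L + p)%N.
  rewrite /= mod0n (envL_L envs) (envL_pow envs) // hp modn_small //.
  by apply: leq_ltn_trans M_big; rewrite expnS; clear -lt_p; lia.
apply: wp_seq; apply: wp_wset; rewrite hv /= !mod0n !cellE /=.
apply: wp_seq; apply: wp_wset; rewrite /= !mod0n !cellE /= M2.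
apply: wp_seq.
set x0 := ((2 ^ L + p) %/ 2)%N; set s0 := setw _ vX 0 x0.
pose leaves (s' : state R) := forall q, (q < 2 ^ L)%N -> words s' aTREE (2 ^ L + q)%N =
      if q == p then v else words s aTREE (2 ^ L + q)%N.
pose I w (s' : state R) := exists x, [/\ words s' vX 0 = x, (x < 2 ^ w)%N /\ (x < 2 ^ L)%N,
  forall i, reals s' key i = K i, leaves s' &
  forall z, (0 < z < 2 ^ L)%N -> z != x -> words s' aTREE z =
    better K (words s' aTREE (2 * z)%N) (words s' aTREE (2 * z + 1)%N)].
have x0L : (x0 < 2 ^ L)%N by rewrite /x0; clear -lt_p; lia.
have I0 : I L s0.
  exists x0; rewrite /= !cellE /=; split=> //.
    move=> q hq; by rewrite /= !cellE /= eqn_add2l.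
  move=> z /andP[z0 hz] zx; rewrite /= !cellE /=.
  have ne w : (w < 2 ^ L)%N -> w == (2 ^ L + p)%N = false.
    by move=> h; rewrite ltn_eqF //; apply: leq_trans h (leq_addr _ _).
  rewrite ne // ifF; last by apply/negbTE; move: zx; rewrite /x0; clear; lia.
  rewrite ifF; last by apply/negbTE; move: zx; rewrite /x0; clear; lia.
  by apply: ok; rewrite z0.
have := @wp_while R M (WLe (WC 1) (wvar vX))
  (Seq recompute (WSet vX (WC 0) (WDiv (wvar vX) (WC 2)))) I 4 L s0 _ I0.
move=> /(_ _)/wp_mono; apply.
  move=> t s1 [hb [w [_ ht [x [hx _ _ hl hz]]]]].
  apply: wp_skip; split.
  - by move: ht; clear; lia.
  - move: hb; rewrite /= mod0n hx M1 lt0n negbK => /eqP x_0 z hzz.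
    by apply: hz => //; rewrite x_0 -lt0n; case/andP: hzz.
  - exact: hl.
move=> w s1 [x [hx [xw xL] hK1 hl hz]]; rewrite /= mod0n hx M1 => x_gt0.
case: w xw => [|w] xw; first by move: xw; rewrite expn0 ltnS leqn0 -leqn0 leqNgt x_gt0.
apply: wp_seq; apply: wp_mono (wp_recompute hx _ hK1); last by rewrite x_gt0.
move=> t s2 [-> ->]; apply: wp_wset; rewrite /= !mod0n !cellE /= hx M2.
split=> //; exists w => //; exists (x %/ 2)%N; rewrite /= !cellE /=; split=> //.
- split; first by rewrite ltn_divLR // -expnSr.
  by apply: leq_ltn_trans xL; exact: leq_div.
- move=> q hq; rewrite /= !cellE /= gtn_eqF ?hl //.
  by apply: leq_trans xL (leq_addr _ _).
move=> z hzz zx; rewrite /= !cellE /=.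
have -> : (2 * z)%N == x = false by apply/negbTE; move: zx; clear; lia.
have -> : (2 * z + 1)%N == x = false by apply/negbTE; move: zx; clear; lia.
by case: eqP => [->//|/eqP ne]; apply: hz.
Qed.

Variable rk : nat.
Hypothesis rk_gt : (15 < rk)%N.

Definition sort_insert : cmd := For vP nE (update (wvar vP) (WAdd (wvar vP) (WC 1))).

(** Keys come out in nondecreasing order, so a key not above the previous one equals it and inherits
    its rank. *)
Definition sort_extract : cmd := For vT nE (seqs [::
  WSet vQ (WC 0) (WSub (treeE (WC 1)) (WC 1));
  WSet aORD (wvar vT) (wvar vQ);
  If (TAnd (WLe (WC 1) (wvar vT))
        (RLe (RGet key (wvar vQ)) (RGet key (WGet aORD (WSub (wvar vT) (WC 1))))))
     (WSet rk (wvar vQ) (WGet rk (WGet aORD (WSub (wvar vT) (WC 1)))))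
     (WSet rk (wvar vQ) (wvar vT));
  update (wvar vQ) (WC 0)]).

Definition sort : cmd := Seq sort_insert sort_extract.

(** Required and restored by each sort; as memory starts at 0, the tree never has to be cleared. *)
Definition tree_zero (s : state R) :=
  forall x, (0 < x < 2 ^ L.+1)%N -> words s aTREE x = 0%N.

Lemma wp_sort_insert s : envL s -> (forall i, reals s key i = K i) -> tree_zero s ->
  wp M sort_insert s (fun t s' => (t <= n * (5 * L + 12) + 3)%N /\
    [/\ envL s', forall i, reals s' key i = K i, tree_ok K L (words s' aTREE) &
     forall q, (q < 2 ^ L)%N -> words s' aTREE (2 ^ L + q)%N = if (q < n)%N then q.+1 else 0%N]).
Proof.
move=> envs hK hz.
pose I (i p : nat) (s' : state R) := p = 0%N /\
    [/\ envL s', forall i, reals s' key i = K i, tree_ok K L (words s' aTREE) &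
     forall q, (q < 2 ^ L)%N -> words s' aTREE (2 ^ L + q)%N = if (q < i)%N then q.+1 else 0%N].
have := @wp_for R M vP nE (update (wvar vP) (WAdd (wvar vP) (WC 1))) n (5 * L + 9) I s 0 nM.
move=> H; apply: wp_mono (H _ _ _) => {H}.
- move=> t s' [_ [p h1 [e h2]]]; split=> //; move: h1; rewrite e addn0 addn0 => h1.
  by apply: leq_trans h1 _; rewrite -addnA.
- split=> //; split=> //.
  + by case: envs => h1 h2 h3; split=> //.
  + move=> x /andP[x0 xL]; rewrite /= !cellE /=.
    have e w : (0 < w < 2 ^ L.+1)%N -> words s aTREE w = 0%N by exact: hz.
    rewrite !e //; rewrite expnS; clear -x0 xL; try lia.
  + move=> q hq; rewrite /= !cellE /= hz // addn_gt0 expn_gt0 /=.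
    by rewrite expnS; clear -hq; lia.
- by move=> i p s1 _ _ [_ [[h1 _ _] _ _ _]]; rewrite /= mod0n.
move=> i p s1 lt_i hx [p0 [env1 hK1 ok1 hl1]].
have hp : weval M s1 (wvar vP) = i by rewrite /= mod0n.
have lt_iL : (i < 2 ^ L)%N by apply: leq_trans lt_i n_le.
have hv j : weval M (setw s1 vX 0 j) (WAdd (wvar vP) (WC 1)) = i.+1.
  rewrite /= !mod0n cellE /= hx M1 addn1 modn_small //.
  exact: leq_ltn_trans lt_i nM.
apply: wp_mono (wp_frame (wp_update env1 hp lt_iL hv hK1 ok1)).
move=> t s2 [[ht ok2 hl2] fr]; split; first by rewrite fr.1.
exists 0%N; first by rewrite addn0 p0.
have env2 := envL_frame env1 fr isT isT isT.
split=> //; split=> //.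
- by case: env2 => h1 h2 h3; split=> //.
- by move=> j; rewrite /= fr.2.
- move=> q hq; rewrite /= cellE /= hl2 // hl1 // ltnS.
  by case: (ltngtP q i) => [||->].
Qed.

Lemma wp_sort s : envL s -> (forall i, reals s key i = K i) -> tree_zero s ->
  wp M sort s (fun t s' => [/\ (t <= n * (10 * L + 40) + 7)%N, tree_zero s' &
    sorted_prefix K n (words s' aORD) (words s' rk) n]).
Proof.
move=> envs hK hz; apply: wp_seq; apply: wp_mono (wp_sort_insert envs hK hz).
move=> t1 s1 [ht1 [env1 hK1 ok1 hl1]].
pose I (i p : nat) (s' : state R) := p = 0%N /\
  [/\ envL s', forall i, reals s' key i = K i, tree_ok K L (words s' aTREE),
    (forall q, (q < 2 ^ L)%N -> words s' aTREE (2 ^ L + q)%N =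
      if (q < n)%N && (q \notin mkseq (words s' aORD) i) then q.+1 else 0%N) &
    sorted_prefix K n (words s' aORD) (words s' rk) i].
have hrk c : (c <= 15)%N -> (rk == c = false) * (c == rk = false).
  by move=> hc; rewrite gtn_eqF ?ltn_eqF // (leq_ltn_trans hc).
rewrite /sort_extract; set body := seqs _.
have := @wp_for R M vT nE body n (5 * L + 25) I s1 0 nM.
move=> H; apply: wp_mono (H _ _ _) => {H}.
- move=> t s' [_ [p h1 [e [_ _ ok hl sp]]]]; split=> //.
    by move: h1 ht1; rewrite e; clear; lia.
  apply: (tree_ind (P := fun v => v = 0%N) ok) => // q hq.
  rewrite hl // ifF //; apply/negP => /andP[qn /negP[]].
  have [surj _ _] := sorted_prefix_full sp.
  by have [i hi <-] := surj q qn; apply: map_f; rewrite mem_iota.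
- split=> //; split=> //.
  + by case: env1 => h1 h2 h3; split=> //.
  + by move=> q hq; rewrite /= !cellE /= hl1 // andbT.
- by move=> i p s2 _ _ [_ [[h1 _ _] _ _ _ _]]; rewrite /= mod0n.
move=> i p s2 lt_i hx [p0 [env2 hK2 ok2 hl2 sp2]].
pose ord := words s2 aORD.
(* some element is left, hence the root is nonempty *)
have [q0 q0n q0in] : exists2 q, (q < n)%N & q \notin mkseq ord i.
  have [/hasP[q]|/hasPn h] := boolP (has (fun q => q \notin mkseq ord i) (iota 0 n)).
    by rewrite mem_iota => hq; exists q.
  have := uniq_leq_size (iota_uniq 0 n) (s2 := mkseq ord i).
  rewrite size_iota size_mkseq leqNgt lt_i => /(_ _)/negP[] // q /h.
  by rewrite negbK.
have leaf q : (q < n)%N -> q \notin mkseq ord i -> words s2 aTREE (2 ^ L + q)%N = q.+1.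
  by move=> qn qin; rewrite hl2 ?qn ?qin //; exact: leq_trans qn n_le.
have qmin q : (q < n)%N -> q \notin mkseq ord i ->
    (0 < words s2 aTREE 1)%N /\ K (words s2 aTREE 1).-1 <= K q.
  move=> qn qin; have qL := leq_trans qn n_le.
  by have := tree_min ok2 qL; rewrite leaf // => /(_ isT).
have [root_gt0 _] := qmin _ q0n q0in.
pose q := (words s2 aTREE 1).-1.
(* By induction over the tree, every nonempty node names a point still to be extracted. *)
have [qn qin] : (q < n)%N /\ q \notin mkseq ord i.
  suff h x : (0 < x < 2 ^ L.+1)%N -> (0 < words s2 aTREE x)%N ->
      ((words s2 aTREE x).-1 < n)%N /\ (words s2 aTREE x).-1 \notin mkseq ord i.
    by apply: h => //; rewrite /= -[ltnLHS](expn0 2) ltn_exp2l.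
  move: x; apply: (tree_ind (P := fun v => (0 < v)%N -> (v.-1 < n)%N /\
     v.-1 \notin mkseq ord i) ok2) => // r hr.
  by rewrite hl2 //; case: ifP => // /andP[].
have qL := leq_trans qn n_le.
apply: wp_seq; apply: wp_wvar; rewrite /= M1 subn1 -/q.
apply: wp_seq; apply: wp_wset; rewrite /= !mod0n !cellE /= hx.
set s3 := setw _ aORD i q.
have iN : (i - 1 %% M)%N = i.-1 by rewrite M1 subn1.
apply: wp_seq.
apply: (@wp_mono _ _ _ _ (fun t s' => t = 2%N /\ s' = setw s3 rk q
   (if (0 < i)%N && (K q <= K (ord i.-1)) then words s2 rk (ord i.-1) else i))); last first.
  have e : teval M s3 (TAnd (WLe (WC 1) (wvar vT))
     (RLe (RGet key (wvar vQ)) (RGet key (WGet aORD (WSub (wvar vT) (WC 1)))))) =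
     (0 < i)%N && (K q <= K (ord i.-1)).
    rewrite /= !mod0n !cellE /= hx iN M1 !hK2.
    by case: (posnP i) => [->//|i0]; rewrite ltn_eqF ?ltn_predL.
  apply: wp_if => h; apply: wp_wset; split=> //; rewrite e in h; rewrite /= !mod0n !cellE /= hx.
    rewrite h iN !hrk //= ; case/andP: h => i0 _; by rewrite ltn_eqF ?ltn_predL.
  by rewrite (negbTE h).
move=> _ _ [-> ->]; set s4 := setw s3 rk q _.
apply: wp_seq.
have env4 : envL s4.
  case: env2 => h1 h2 h3; split=> [||j hj]; rewrite /= !cellE !hrk //=.
  exact: h3.
have ok4 : tree_ok K L (words s4 aTREE).
  by move=> x hx'; rewrite /= !cellE !hrk //= ok2.
have hp4 : weval M s4 (wvar vQ) = q by rewrite /= !mod0n !cellE !hrk.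
have hv4 j : weval M (setw s4 vX 0 j) (WC 0) = 0%N by rewrite /= mod0n.
apply: wp_mono (wp_frame (wp_update env4 hp4 qL hv4 hK2 ok4)).
move=> t s5 [[ht5 ok5 hl5] fr]; apply: wp_skip; split.
  by rewrite fr.1 //= !cellE !hrk.
exists 0%N; first by rewrite addn0 p0; move: ht5; clear; lia.
have env5 := envL_frame env4 fr isT isT isT.
have ord5 j : words s5 aORD j = if j == i then q else ord j.
  by rewrite fr.1 //= !cellE ?hrk.
have rk5 j : words s5 rk j = if j == q then
    (if (0 < i)%N && (K q <= K (ord i.-1)) then words s2 rk (ord i.-1) else i)
    else words s2 rk j.
  rewrite fr.1; last by rewrite /= !hrk.
  by rewrite /= !cellE eqxx !hrk /=.
have sp5 : sorted_prefix K n (words s5 aORD) (words s5 rk) i.+1.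
  apply: (@sorted_prefix_step _ K n ord (words s2 rk) _ _ i q) => //.
  - by move=> r rn rin; case: (qmin r rn rin).
  - by move=> j ji; rewrite ord5 ltn_eqF.
  - by rewrite ord5 eqxx.
  - by move=> r rq; rewrite rk5 (negbTE rq).
  - by rewrite rk5 eqxx.
split=> //; split=> //.
- by case: env5 => h1 h2 h3; split=> //.
- by move=> j; rewrite /= fr.2 //=; exact: hK2.
- move=> r hr; rewrite /= cellE /= hl5 // /= !cellE ?hrk //= hl2 //.
  have -> : mkseq (words (setw s5 vT 0 i.+1) aORD) i.+1 = rcons (mkseq ord i) q.
    rewrite /mkseq -{2}[i.+1]addn1 iotaD map_cat cats1 /= !cellE /= ord5 eqxx; congr rcons.
    by apply/eq_in_map => j; rewrite mem_iota /= !cellE /= ord5 => hj; rewrite ltn_eqF.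
  by rewrite mem_rcons in_cons negb_or; case: eqP => //= _; rewrite andbF.
- have -> : words (setw s5 vT 0 i.+1) rk = words s5 rk.
    by apply/funext => j; rewrite /= cellE !hrk.
  exact: sp5.
Qed.

End Sort.

(** * One tuple of levels *)

Section Stack.
Variables (R : realType) (A G : nat -> R).
Implicit Types (L : seq nat) (bel : nat -> nat).

(** Linked list with p coded as p + 1 and 0 for its end. A single array of links serves all groups,
    since a point belongs to one group only. *)
Fixpoint chain bel (x : nat) L : Prop :=
  if L is p :: L' then x = p.+1 /\ chain bel (bel p) L' else x = 0%N.

Lemma chain_ext bel bel' x L : (forall p, p \in L -> bel' p = bel p) ->
  chain bel x L -> chain bel' x L.
Proof.
elim: L x => //= p L IH x h [-> hc]; split=> //; rewrite h ?mem_head //.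
by apply: IH => // r hr; rewrite h // in_cons hr orbT.
Qed.

Definition link q L : Prop :=
  if L is h :: _ then A h <= A q /\ (A h = A q -> G q < G h) else True.

Lemma hull_push q L : hull A G L -> link q L ->
  (if L is h1 :: h2 :: _ then ~~ cross A G h2 h1 q else true) -> hull A G (q :: L).
Proof.
case: L => [|h1 [|h2 L]] //= [[[h21 e21] hL] hL'] [hq eq] nc.
by do !split=> //; move=> lam lam0; exact: cross_push.
Qed.

Lemma link_pop q h1 h2 L : hull A G (h1 :: h2 :: L) -> link q (h1 :: h2 :: L) ->
  cross A G h2 h1 q -> [/\ hull A G (h2 :: L), link q (h2 :: L) &
  forall lam p, (exists2 h, h \in q :: h1 :: h2 :: L & tilt A G lam h <= tilt A G lam p) ->
    exists2 h, h \in q :: h2 :: L & tilt A G lam h <= tilt A G lam p].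
Proof.
move=> [[[h21 e21] _] hL] [hq eq] hc; split=> //.
  split; first exact: le_trans hq.
  move=> e2q; have e1q : A h1 = A q by apply/le_anti; rewrite hq -e2q h21.
  by apply: lt_trans (eq e1q) (e21 _); rewrite e2q.
move=> lam p [h]; rewrite !in_cons => /or4P[/eqP ->|/eqP ->|/eqP ->|hh] le_h.
- by exists q; rewrite ?mem_head.
- have [h2'|q'] := cross_pop lam h21 hq eq hc.
    by exists h2; rewrite ?in_cons ?eqxx ?orbT //; exact: le_trans h2' le_h.
  by exists q; rewrite ?mem_head //; exact: le_trans q' le_h.
- by exists h2; rewrite ?in_cons ?eqxx ?orbT.
- by exists h; rewrite ?in_cons ?hh ?orbT.
Qed.

(** [P] selects the slopes for which the stack must still contain a minimizer: all nonnegative ones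
    while pushing, those up to the best value during the queries. *)
Definition cover (P : R -> Prop) (X : pred nat) L : Prop :=
  forall lam p, 0 <= lam -> P lam -> X p -> exists2 h, h \in L & tilt A G lam h <= tilt A G lam p.

Lemma cover_pop (beta : R) (X : pred nat) h1 h2 L : hull A G (h1 :: h2 :: L) ->
  tilt A G beta h2 <= tilt A G beta h1 -> cover (fun lam => lam <= beta) X (h1 :: h2 :: L) ->
  cover (fun lam => lam <= beta) X (h2 :: L).
Proof.
move=> [[[h21 _] _] _] le21 hc lam p lam0 lamb Xp.
have [h] := hc lam p lam0 lamb Xp; rewrite in_cons => /orP[/eqP ->|hh] le_h; last by exists h.
exists h2; first exact: mem_head.
exact: le_trans (tilt_le_mono h21 lamb le21) le_h.
Qed.

End Stack.

(** * One level: building the hulls of all groups and answering the slope queries *)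

Section Level.
Variables (R : realType) (M n : nat) (A G : nat -> R) (ord : nat -> nat).
Variables (kk : nat -> nat) (okA okB : pred nat).
Variables (ekey : wexp -> wexp) (tA tB : wexp -> test) (rec : cmd) (Trec : nat).
Variables (lenv : state R -> Prop) (good : (nat -> nat) -> R -> Prop).

Definition level_mods := [:: 1%N; vP; vT; vG; vQ; aTOP; aBEL].

Hypotheses (n_gt0 : (0 < n)%N) (n_lt_M : (n < M)%N).
Hypothesis lenv_frame : forall s s', lenv s ->
  (forall a i, a \notin level_mods -> words s' a i = words s a i) ->
  (forall a i, a != aBEST -> reals s' a i = reals s a i) -> lenv s'.
Hypothesis lenv_n : forall s, lenv s -> words s 0 0 = n.
Hypothesis lenv_A : forall s p, lenv s -> reals s aAL p = A p.
Hypothesis lenv_G : forall s p, lenv s -> reals s aGG p = G p.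
Hypothesis lenv_ord : forall s i, lenv s -> words s aORD i = ord i.
Hypothesis ekeyE : forall s e, lenv s -> (weval M s e < n)%N ->
  weval M s (ekey e) = kk (weval M s e).
Hypothesis tAE : forall s e, lenv s -> (weval M s e < n)%N ->
  teval M s (tA e) = okA (weval M s e).
Hypothesis tBE : forall s e, lenv s -> (weval M s e < n)%N ->
  teval M s (tB e) = okB (weval M s e).
Hypothesis ord_lt : forall i, (i < n)%N -> (ord i < n)%N.
Hypothesis ord_uniq : uniq (mkseq ord n).
Hypothesis ord_surj : forall p, (p < n)%N -> exists2 i, (i < n)%N & ord i = p.
Hypothesis ord_le : forall i j, (i <= j)%N -> (j < n)%N -> A (ord i) <= A (ord j).
Hypothesis G_le : forall a p, (a < n)%N -> (p < n)%N -> okA a -> okB p -> kk a = kk p ->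
  G a <= G p.

Definition topE := WSub (WGet aTOP (wvar vG)) (WC 1).
Definition secE := WSub (WGet aBEL topE) (WC 1).
Definition bestE := RGet aBEST (WC 0).
Definition valE e := RSub (RGet aGG e) (RMul bestE (RGet aAL e)).
Definition has_top := WLe (WC 1) (WGet aTOP (wvar vG)).
Definition has_sec := WLe (WC 1) (WGet aBEL topE).
Definition popc := WSet aTOP (wvar vG) (WGet aBEL topE).

Definition crossE := RLe
  (RMul (RSub (RGet aGG (wvar vQ)) (RGet aGG topE)) (RSub (RGet aAL topE) (RGet aAL secE)))
  (RMul (RSub (RGet aGG topE) (RGet aGG secE)) (RSub (RGet aAL (wvar vQ)) (RGet aAL topE))).

Definition clear_tops := For vP nE (WSet aTOP (ekey (wvar vP)) (WC 0)).

Definition push_loop := While (TAnd has_top (TAnd has_sec crossE)) popc.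

(** Points arrive by increasing abscissa. One that ties with the top and is not lower is dominated;
    skipping it preserves the strict tie condition of [convex_top]. *)
Definition push :=
  If (TAnd has_top (TAnd (RLe (RGet aAL (wvar vQ)) (RGet aAL topE))
                         (RLe (RGet aGG topE) (RGet aGG (wvar vQ)))))
    Skip
    (Seq push_loop
      (Seq (WSet aBEL (wvar vQ) (WGet aTOP (wvar vG)))
           (WSet aTOP (wvar vG) (WAdd (wvar vQ) (WC 1))))).

Definition push_all := For vT nE
  (Seq (WSet vQ (WC 0) (WGet aORD (wvar vT)))
    (If (tB (wvar vQ)) (Seq (WSet vG (WC 0) (ekey (wvar vQ))) push) Skip)).

Definition improve := If (TAnd has_top (TNot (RLe (valE (wvar vP)) (valE topE)))) rec Skip.

Definition query_loop :=
  While (TAnd has_top (TAnd has_sec (RLe (valE secE) (valE topE)))) (Seq popc improve).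

Definition query_all := For vP nE
  (If (tA (wvar vP)) (Seq (WSet vG (WC 0) (ekey (wvar vP))) (Seq improve query_loop)) Skip).

Definition level := Seq clear_tops (Seq push_all query_all).

Definition Inv (s : state R) := 0 <= reals s aBEST 0 /\ good (words s 1) (reals s aBEST 0).

Hypothesis rec_mod : forall a, wmod a rec -> a = 1%N.
Hypothesis rec_rmod : forall a, rmod a rec -> a = aBEST.
Hypothesis wp_rec : forall s a p, lenv s -> Inv s -> words s vP 0 = a ->
  words s aTOP (words s vG 0) = p.+1 -> (a < n)%N -> (p < n)%N -> okA a -> okB p -> kk a = kk p ->
  tilt A G (reals s aBEST 0) p < tilt A G (reals s aBEST 0) a ->
  wp M rec s (fun t s' => [/\ (t <= Trec)%N, Inv s' &
     reals s' aBEST 0 = (G p - G a) / (A p - A a)]).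

Definition keys := undup [seq kk p | p <- iota 0 n].

Definition stack (s : state R) (P : R -> Prop) (X : pred nat) g L : Prop :=
  [/\ chain (words s aBEL) (words s aTOP g) L,
      forall p, p \in L -> [/\ (p < n)%N, okB p, kk p = g & X p],
      hull A G L &
      cover A G P (fun p => [&& X p, (p < n)%N, okB p & kk p == g]) L].

(** No pair of a with a point of its group has a slope below [beta]; without the division, pairs
    with A p <= A a are included. *)
Definition done beta a := forall p, (p < n)%N -> okB p -> kk a = kk p ->
  beta * (A p - A a) <= G p - G a.

(** Each stack element prepays its removal: a pop during a query, with its [improve] and the loop
    test, costs at most [Trec + 5] steps. *)
Let cst := (Trec + 6)%N.
Definition pot (st : nat -> seq nat) := (cst * \sum_(g <- keys) size (st g))%N.

Lemma pot_upd st g L : g \in keys ->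
  (pot (fun g' => if g' == g then L else st g') + cst * size (st g) =
   pot st + cst * size L)%N.
Proof.
move=> gk; rewrite /pot -!mulnDr; congr (_ * _)%N.
rewrite !(bigD1_seq g) ?undup_uniq //= eqxx.
rewrite (eq_bigr (fun g' => size (st g'))) => [|g' /negbTE ->//].
lia.
Qed.

Lemma key_in p : (p < n)%N -> kk p \in keys.
Proof. by move=> hp; rewrite mem_undup map_f // mem_iota. Qed.

Let M1 : (1 %% M = 1)%N.
Proof. by rewrite modn_small //; apply: leq_ltn_trans n_lt_M. Qed.

Lemma lenv_wset s a i v : a \in level_mods -> lenv s -> lenv (setw s a i v).
Proof.
move=> ha hs; apply: lenv_frame hs _ _ => // a' j ha'.
by rewrite /= cellE; case: eqP => [e|//]; rewrite e ha in ha'.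
Qed.

Lemma wp_clear s : lenv s -> Inv s ->
  wp M clear_tops s (fun t s' => [/\ (t <= 4 * n + 3)%N, lenv s', Inv s',
    reals s' aBEST 0 = reals s aBEST 0 &
    forall g, g \in keys -> words s' aTOP g = 0%N]).
Proof.
move=> hl hi.
pose I (i p : nat) (s' : state R) := [/\ p = 0%N, lenv s', Inv s',
  reals s' aBEST 0 = reals s aBEST 0 &
  forall q, (q < i)%N -> words s' aTOP (kk q) = 0%N].
have H := @wp_for R M vP nE (WSet aTOP (ekey (wvar vP)) (WC 0)) n 1 I s 0 n_lt_M.
apply: wp_mono (H _ _ _) => {H}.
- move=> t s' [_ [p ht [p0 h1 h2 h3 h4]]]; split=> //; first by move: ht; clear; lia.
  by move=> g; rewrite mem_undup => /mapP[q]; rewrite mem_iota => hq ->; exact: h4.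
- by split=> //; exact: lenv_wset.
- by move=> i p s1 _ _ [_ h _ _ _]; rewrite /= mod0n lenv_n.
move=> i p s1 lt_i hx [p0 l1 i1 b1 h1].
have ei : weval M s1 (wvar vP) = i by rewrite /= mod0n.
apply: wp_wset; rewrite ekeyE // ei //= mod0n; split=> //.
exists 0%N; first by rewrite p0.
split=> //; first by do 2!apply: lenv_wset => //.
move=> q hq; rewrite /= !cellE /=; case: eqP => // ne; apply: h1.
by rewrite ltn_neqAle -ltnS hq andbT; apply/eqP => e; rewrite e in ne.
Qed.

(** The cover is maintained for [q :: L], as if q were already pushed: a popped vertex may be
    replaced by q as well as by the vertex below it. *)
Lemma wp_push_loop s g q st (X : pred nat) : lenv s -> Inv s ->
  words s vG 0 = g -> words s vQ 0 = q -> (q < n)%N ->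
  stack s (fun=> True) X g st -> link A G q st ->
  wp M push_loop s (fun t s' => exists L, [/\ (t + 2 * size L <= 2 * size st + 1)%N,
    [/\ chain (words s' aBEL) (words s' aTOP g) L, {subset L <= st}, hull A G (q :: L) &
        cover A G (fun=> True) (fun p => [&& X p, (p < n)%N, okB p & kk p == g]) (q :: L)],
    lenv s', Inv s' & [/\ reals s' aBEST 0 = reals s aBEST 0, words s' aBEL =1 words s aBEL &
      forall g', g' != g -> words s' aTOP g' = words s aTOP g']]).
Proof.
move=> l0 i0 hg hq qn [ch0 mem0 hull0 cov0] lk0.
pose J (v : nat) (s' : state R) := exists L, [/\ size L = v,
    [/\ chain (words s' aBEL) (words s' aTOP g) L, {subset L <= st}, hull A G L, link A G q L &
        cover A G (fun=> True) (fun p => [&& X p, (p < n)%N, okB p & kk p == g]) (q :: L)],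
    [/\ lenv s', words s' vG 0 = g & words s' vQ 0 = q], Inv s' &
    [/\ reals s' aBEST 0 = reals s aBEST 0, words s' aBEL =1 words s aBEL &
      forall g', g' != g -> words s' aTOP g' = words s aTOP g']].
have testE s' L : lenv s' -> words s' vG 0 = g -> words s' vQ 0 = q ->
    chain (words s' aBEL) (words s' aTOP g) L ->
    teval M s' (TAnd has_top (TAnd has_sec crossE)) =
    if L is h1 :: h2 :: _ then cross A G h2 h1 q else false.
  move=> l1 hg1 hq1; rewrite /= !mod0n hg1 hq1 M1 !subn1.
  by case: L => [->//|h1 [|h2 L]] /= [-> /=]; [move=> ->|move=> [-> _] /=; rewrite !lenv_A ?lenv_G].
have := @wp_while R M (TAnd has_top (TAnd has_sec crossE)) popc J 1 (size st) s.
move=> H; apply: wp_mono (H _ _) => {H}.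
- move=> t s' [nt [v [le_v ht [L [sL [h1 h2 h3 h4 h5] [h6 h6g h6q] h7 h8]]]]].
  exists L; rewrite sL; split=> //.
  split=> //; apply: hull_push => //; move: nt; rewrite (testE _ L) //.
  by case: (L) => [|? []].
- move=> v s1 [L [sL [h1 h2 h3 h4 h5] [h6 h6g h6q] h7 [h8 h9 h10]]].
  rewrite (testE _ L) //; case: L sL h1 h2 h3 h4 h5 => [|p1 [|p2 L]] //= sL h1 h2 h3 h4 h5 hc.
  have [hl2 lk2 cv2] := link_pop h3 h4 hc.
  have [ht1 ht2] := h1; apply: wp_wset; rewrite /= !mod0n h6g ht1 M1 subn1 /=.
  split=> //; exists v.-1; first by rewrite -sL.
  exists (p2 :: L); split => //.
  + by rewrite -sL.
  + split=> //.
    * by rewrite /= !cellE /= eqxx.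
    * by move=> p hp; apply: h2; rewrite in_cons hp orbT.
    * by move=> lam p lam0 lamP Xp; apply: cv2; exact: h5.
  + by split=> //; apply: lenv_wset.
  + by split=> // g' ne; rewrite /= cellE /= (negbTE ne) h10.
- exists st; split=> //; split=> // lam p lam0 lamP Xp.
  by have [h hh le_h] := cov0 lam p lam0 lamP Xp; exists h; rewrite ?in_cons ?hh ?orbT.
Qed.

Lemma wp_push s g q st (X X' : pred nat) : lenv s -> Inv s ->
  words s vG 0 = g -> words s vQ 0 = q -> (q < n)%N -> okB q -> kk q = g -> ~~ X q ->
  (forall p, X' p = X p || (p == q)) -> (forall p, X p -> A p <= A q) ->
  stack s (fun=> True) X g st ->
  wp M push s (fun t s' => exists L, [/\ (t + cst * size L <= cst * size st + cst + 8)%N,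
    stack s' (fun=> True) X' g L,
    lenv s', Inv s' & [/\ reals s' aBEST 0 = reals s aBEST 0,
      forall p, p != q -> words s' aBEL p = words s aBEL p &
      forall g', g' != g -> words s' aTOP g' = words s aTOP g']]).
Proof.
move=> l0 i0 hg hq qn okq kq nXq XX' XA stk; have [ch0 mem0 hull0 cov0] := stk.
have testE : teval M s (TAnd has_top (TAnd (RLe (RGet aAL (wvar vQ)) (RGet aAL topE))
      (RLe (RGet aGG topE) (RGet aGG (wvar vQ))))) =
    if st is h :: _ then (A q <= A h) && (G h <= G q) else false.
  rewrite /= !mod0n hg hq M1 !subn1 !lenv_A // !lenv_G //.
  by case: (st) ch0 => [->//|h L [-> _]].
have X'split p : X' p -> X p \/ p = q.
  by rewrite XX' => /orP[->|/eqP ->]; [left|right].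
apply: wp_if; rewrite testE => ht.
  apply: wp_skip; exists st; split=> //.
    by rewrite addnC -addnA leq_add2l; clear; lia.
  split=> // [p /mem0[? ? ? Xp]|]; first by split=> //; rewrite XX' Xp.
  move=> lam p lam0 _ /and4P[/X'split[Xp|->] pn okp kp].
    by apply: cov0 => //; rewrite Xp pn okp.
  (* The top is at least as far to the right as q and not higher, so it stands in for q at every
     slope [lam >= 0]. *)
  case: (st) ht => // h L /andP[hA hG]; exists h; first exact: mem_head.
  by rewrite /tilt lerB // ler_wpM2l.
have lk : link A G q st.
  case: (st) ht mem0 => // h L ht mem0; have [hn okh kh Xh] := mem0 h (mem_head _ _).
  split; first exact: XA.
  by move=> e; move: ht; rewrite e lexx /= -ltNge.
have [t0 st0] : True /\ True by [].
apply: wp_seq; apply: wp_mono (wp_frame (wp_push_loop l0 i0 hg hq qn stk lk)).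
move=> t s1 [[L [ht1 [ch1 sub1 hull1 cov1] l1 i1 [b1 bel1 top1]]] fr1].
have hg1 : words s1 vG 0 = g by rewrite fr1.1.
have hq1 : words s1 vQ 0 = q by rewrite fr1.1.
apply: wp_seq; apply: wp_wset; apply: wp_wset; rewrite /= !mod0n !cellE /= hg1 hq1.
have -> : ((q + 1 %% M) %% M = q.+1)%N.
  by rewrite M1 addn1 modn_small //; exact: leq_ltn_trans qn n_lt_M.
exists (q :: L); split=> //.
- move: ht1; rewrite /= mulnS; move: (size L) (size st) => x y; clear => ht.
  have xy : (x <= y)%N by lia.
  have h : (2 * (y - x) <= cst * (y - x))%N by rewrite leq_mul2r /cst; lia.
  have e : (cst * y = cst * x + cst * (y - x))%N by rewrite -mulnDr subnKC.
  rewrite e; lia.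
- split=> //.
  + rewrite /= !cellE /= eqxx; split=> //; rewrite eqxx.
    apply: chain_ext ch1 => p pL; rewrite /= !cellE /= ifF //.
    apply/negbTE; apply: contraNneq nXq => <-.
    by have [] := mem0 p (sub1 p pL).
  + move=> p; rewrite in_cons => /orP[/eqP ->|pL]; first by split=> //; rewrite XX' eqxx orbT.
    by have [? ? ? Xp] := mem0 p (sub1 p pL); split=> //; rewrite XX' Xp.
  + move=> lam p lam0 _ /and4P[/X'split[Xp|->] pn okp kp].
      by apply: cov1 => //; rewrite Xp pn okp.
    by exists q => //; exact: mem_head.
- by do 2!apply: lenv_wset => //.
- split=> //.
  + by move=> p pq; rewrite /= !cellE (negbTE pq) /= bel1.
  + by move=> g' ne; rewrite /= !cellE /= (negbTE ne) top1.
Qed.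

Lemma stack_ext s s' P (X X' : pred nat) g L :
  (forall p, p \in L -> words s' aBEL p = words s aBEL p) ->
  words s' aTOP g = words s aTOP g ->
  (forall p, (p < n)%N -> okB p -> kk p = g -> X' p = X p) ->
  stack s P X g L -> stack s' P X' g L.
Proof.
move=> hb ht hX [h1 h2 h3 h4]; split=> //.
- by rewrite ht; exact: chain_ext h1.
- by move=> p /h2[? ? ? ?]; split=> //; rewrite hX.
- move=> lam p lam0 lamP /and4P[Xp pn okp /eqP kp]; apply: h4 => //.
  by rewrite -hX // Xp pn okp kp eqxx.
Qed.

Lemma wp_push_all s : lenv s -> Inv s -> (forall g, g \in keys -> words s aTOP g = 0%N) ->
  wp M push_all s (fun t s' => exists st, [/\ (t + pot st <= n * (cst + 18) + 3)%N,
    lenv s', Inv s', reals s' aBEST 0 = reals s aBEST 0 &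
    forall g, g \in keys -> stack s' (fun=> True) (fun p => (p < n)%N) g (st g)]).
Proof.
move=> l0 i0 top0.
pose I (i p : nat) (s' : state R) := exists st, [/\ p = pot st,
    lenv s', Inv s', reals s' aBEST 0 = reals s aBEST 0 &
    forall g, g \in keys -> stack s' (fun=> True) (fun p => p \in mkseq ord i) g (st g)].
have H := @wp_for R M vT nE (Seq (WSet vQ (WC 0) (WGet aORD (wvar vT)))
    (If (tB (wvar vQ)) (Seq (WSet vG (WC 0) (ekey (wvar vQ))) push) Skip)) n (cst + 15)%N I s 0%N n_lt_M.
apply: wp_mono (H _ _ _) => {H}.
- move=> t s' [_ [p ht [st [ep h1 h2 h3 h4]]]]; exists st; split=> //.
    by rewrite -ep; move: ht; rewrite addn0 -addnA.
  move=> g /h4; apply: stack_ext => // r rn _ _; rewrite rn; apply/esym.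
  by have [i hi <-] := ord_surj rn; apply: map_f; rewrite mem_iota.
- exists (fun=> [::]); split=> //.
  + by rewrite /pot big1 ?muln0.
  + exact: lenv_wset.
  + by move=> g gk; split=> //=; exact: top0.
- by move=> i p s1 _ _ [st [_ h _ _ _]]; rewrite /= mod0n lenv_n.
move=> i p s1 lt_i hx [st [ep l1 i1 b1 h1]].
apply: wp_seq; apply: wp_wvar; rewrite /= mod0n hx lenv_ord //.
set q := ord i; have qn : (q < n)%N := ord_lt lt_i.
set s2 := setw s1 vQ 0 q.
have l2 : lenv s2 by exact: lenv_wset.
have e2 : weval M s2 (wvar vQ) = q by rewrite /= mod0n cellE.
have nq : q \notin mkseq ord i.
  apply/negP => /mapP[j]; rewrite mem_iota /= => hj e.
  have := ord_uniq; move/(mkseq_uniqP) => /(_ i j); rewrite !inE lt_i (ltn_trans hj lt_i).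
  by move=> /(_ isT isT e) eij; rewrite eij ltnn in hj.
have mem_q r : (r \in mkseq ord i.+1) = (r \in mkseq ord i) || (r == q).
  by rewrite /mkseq -{1}[i.+1]addn1 iotaD map_cat cats1 mem_rcons in_cons orbC.
have fin s' : (forall a j, a != vT -> words s' a j = words (setw s' vT 0 i.+1) a j).
  by move=> a j /negbTE ha; rewrite /= cellE ha.
apply: wp_if; rewrite tBE ?e2 // => okq; last first.
  apply: wp_skip; split; first by rewrite /= cellE.
  exists p; first by rewrite addnC leq_add2l (leq_trans _ (leq_addl _ _)).
  exists st; split=> //; first exact: lenv_wset.
  move=> g /h1; apply: stack_ext => // r rn okr kr.
  rewrite mem_q; case: eqP => [er|_]; last by rewrite orbF.
  by rewrite -er okr in okq.
apply: wp_seq; apply: wp_wvar; rewrite ekeyE ?e2 //.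
set g := kk q; set s3 := setw s2 vG 0 g.
have l3 : lenv s3 by exact: lenv_wset.
have gk : g \in keys by exact: key_in.
have stk3 : stack s3 (fun=> True) (fun r => r \in mkseq ord i) g (st g).
  by apply: stack_ext (h1 g gk).
have XA r : r \in mkseq ord i -> A r <= A q.
  by case/mapP => j; rewrite mem_iota /= => hj ->; apply: ord_le => //; exact: ltnW.
have Hp := @wp_push s3 g q (st g) (fun r => r \in mkseq ord i) (fun r => r \in mkseq ord i.+1)
  l3 i1 erefl erefl qn okq erefl nq mem_q XA stk3.
apply: wp_mono (wp_frame Hp).
move=> t s4 [[L [ht stk4 l4 i4 [b4 bel4 top4]]] fr].
split; first by rewrite fr.1.
exists (pot (fun g' => if g' == g then L else st g')).
  have := pot_upd st L gk; move: ht; rewrite ep; clear; lia.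
exists (fun g' => if g' == g then L else st g'); split=> //.
- exact: lenv_wset.
- by rewrite /= b4.
move=> g' g'k; case: eqP => [->|/eqP ne].
  by apply: stack_ext stk4.
apply: stack_ext (h1 g' g'k).
- move=> r rin; rewrite /= cellE /= bel4 //.
  have [_ mem1 _ _] := h1 g' g'k; have [_ _ _ rX] := mem1 r rin.
  by apply: contraNneq nq => <-.
- by rewrite /= cellE /= top4.
- move=> r rn okr kr; rewrite mem_q; case: eqP => [er|_]; last by rewrite orbF.
  by rewrite -kr er eqxx in ne.
Qed.

(** After an improvement the best value is the slope from a to the top, at which both have the same
    tilt. *)
Lemma wp_improve s a g st : lenv s -> Inv s -> words s vP 0 = a -> words s vG 0 = g ->
  (a < n)%N -> okA a -> kk a = g -> chain (words s aBEL) (words s aTOP g) st ->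
  (forall p, p \in st -> [/\ (p < n)%N, okB p & kk p = g]) ->
  wp M improve s (fun t s' => [/\ (t <= Trec + 2)%N, lenv s', Inv s',
    reals s' aBEST 0 <= reals s aBEST 0 &
    if st is h :: _ then tilt A G (reals s' aBEST 0) a <= tilt A G (reals s' aBEST 0) h else True]).
Proof.
move=> l0 i0 ha hg an oka ka ch mem.
have testE : teval M s (TAnd has_top (TNot (RLe (valE (wvar vP)) (valE topE)))) =
    if st is h :: _ then tilt A G (reals s aBEST 0) h < tilt A G (reals s aBEST 0) a else false.
  rewrite /= !mod0n hg ha M1 !subn1.
  case: (st) ch => [->//|h L [-> _]] /=.
  by rewrite !lenv_A // !lenv_G // -ltNge.
apply: wp_if; rewrite testE => ht; last first.
  apply: wp_skip; split=> //; first by rewrite addn2.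
  by case: (st) ht => // h L; rewrite -leNgt.
case: st ch mem ht {testE} => // h L [top _] mem lt_h.
have [hn okh kh] := mem h (mem_head _ _).
have hE : words s aTOP (words s vG 0) = h.+1 by rewrite hg.
have Hr := wp_rec l0 i0 ha hE an hn oka okh (etrans ka (esym kh)) lt_h.
apply: wp_mono (wp_frame Hr).
move=> t s1 [[ht i1 b1] fr].
have [beta0 _] := i0.
(* With a nonnegative numerator and a nonnegative best value, strict improvement forces a positive
   denominator. *)
have Gle : 0 <= G h - G a by rewrite subr_ge0 G_le // ka.
have lt2 : G h - G a < reals s aBEST 0 * (A h - A a) by move: lt_h; rewrite /tilt; lra.
have Apos : 0 < A h - A a.
  rewrite ltNge; apply/negP => le0; have := mulr_ge0_le0 beta0 le0.
  by apply/negP; rewrite -ltNge; exact: le_lt_trans Gle lt2.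
split=> //.
- by rewrite addn2 ltnS ltnW.
- apply: lenv_frame l0 _ _ => b j nb.
    by rewrite fr.1 //; apply: contra nb => /rec_mod ->.
  by rewrite fr.2 //; apply: contra nb => /rec_rmod ->.
- by rewrite b1 ler_pdivrMr // ltW.
rewrite b1 /tilt; set x := _ / _.
have : x * (A h - A a) = G h - G a by rewrite divfK // gt_eqF.
by lra.
Qed.

(** For A p < A a the left side is nonpositive and the right side nonnegative; otherwise the left
    side grows with the value. *)
Lemma done_mono (beta beta' : R) a : (a < n)%N -> okA a -> 0 <= beta' -> beta' <= beta ->
  done beta a -> done beta' a.
Proof.
move=> an oka b0 bb h p pn okp kp; have hG := G_le an pn oka okp kp.
have [le0|gt0] := leP 0 (A p - A a).
  by apply: le_trans (h p pn okp kp); rewrite ler_wpM2r.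
apply: (@le_trans _ _ 0); last by rewrite subr_ge0.
by rewrite mulr_ge0_le0 // ltW.
Qed.

(** On exit the top minimizes the tilt on its stack by convexity, hence in its group by the cover,
    and [improve] has ensured that the tilt of a is at most that of the top: this is [done]. *)
Lemma wp_query s a g st : lenv s -> Inv s -> words s vP 0 = a -> words s vG 0 = g ->
  (a < n)%N -> okA a -> kk a = g ->
  stack s (fun lam => lam <= reals s aBEST 0) (fun p => (p < n)%N) g st ->
  wp M (Seq improve query_loop) s (fun t s' => exists L,
    [/\ (t + cst * size L <= cst * size st + Trec + 5)%N,
      stack s' (fun lam => lam <= reals s' aBEST 0) (fun p => (p < n)%N) g L,
      [/\ lenv s', Inv s' & reals s' aBEST 0 <= reals s aBEST 0], done (reals s' aBEST 0) a &
      words s' aBEL =1 words s aBEL /\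
      forall g', g' != g -> words s' aTOP g' = words s aTOP g']).
Proof.
move=> l0 i0 ha hg an oka ka [ch0 mem0 hull0 cov0].
have mem0' p : p \in st -> [/\ (p < n)%N, okB p & kk p = g] by case/mem0.
have nrec b : b != 1%N -> ~~ wmod b rec by apply: contra => /rec_mod ->.
have nimp b : b != 1%N -> ~~ wmod b improve by move=> h; rewrite /= orbF nrec.
apply: wp_seq; apply: wp_mono (wp_frame (wp_improve l0 i0 ha hg an oka ka ch0 mem0')).
move=> t1 s1 [[ht1 l1 i1 b1 v1] fr1].
pose J (v : nat) (s' : state R) := exists L, [/\ size L = v,
  stack s' (fun lam => lam <= reals s' aBEST 0) (fun p => (p < n)%N) g L,
  [/\ lenv s', Inv s' & reals s' aBEST 0 <= reals s aBEST 0],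
  (if L is h :: _ then tilt A G (reals s' aBEST 0) a <= tilt A G (reals s' aBEST 0) h else True) &
  [/\ words s' vG 0 = g, words s' vP 0 = a, words s' aBEL =1 words s aBEL &
      forall g', g' != g -> words s' aTOP g' = words s aTOP g']].
have testE s' L : lenv s' -> words s' vG 0 = g ->
    chain (words s' aBEL) (words s' aTOP g) L ->
    teval M s' (TAnd has_top (TAnd has_sec (RLe (valE secE) (valE topE)))) =
    if L is h1 :: h2 :: _ then
      tilt A G (reals s' aBEST 0) h2 <= tilt A G (reals s' aBEST 0) h1 else false.
  move=> l2 hg1; rewrite /= !mod0n hg1 M1 !subn1.
  by case: L => [->//|h1 [|h2 L]] /= [-> /=]; [move=> ->|move=> [-> _] /=; rewrite !lenv_A ?lenv_G].
have H := @wp_while R M (TAnd has_top (TAnd has_sec (RLe (valE secE) (valE topE))))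
  (Seq popc improve) J (Trec + 4)%N (size st) s1.
apply: wp_mono (H _ _) => {H}.
- move=> t2 s2 [nt [v [le_v ht2 [L [sL stk2 [l2 i2 b2] v2 [h1 h2 h3 h4]]]]]].
  exists L; rewrite sL; split=> //.
    have : (cst * v + cst * (size st - v) = cst * size st)%N by rewrite -mulnDr subnKC.
    have : ((Trec + 5) * (size st - v) <= cst * (size st - v))%N by rewrite leq_mul2r /cst; lia.
    have : ((Trec + 5) * (size st - v) + (Trec + 5) * v = (Trec + 5) * size st)%N.
      by rewrite -mulnDr subnK.
    move: ht1 ht2; rewrite -addnS; clear; lia.
  have [ch2 mem2 hull2 cov2] := stk2.
  move=> p pn okp kp; have [beta0 _] := i2.
  have [|h hL le_h] := cov2 (reals s2 aBEST 0) p beta0 (lexx _).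
    by rewrite pn okp -kp ka eqxx.
  suff : tilt A G (reals s2 aBEST 0) a <= tilt A G (reals s2 aBEST 0) p.
    by rewrite /tilt; lra.
  apply: le_trans le_h; move: nt; rewrite (testE _ L) // => nt.
  case: L v2 hull2 hL nt {sL stk2 ch2 mem2 cov2} => // h1' L v2 hull2 hL nt.
  apply: (le_trans v2); apply: hull_min hull2 beta0 _ _ hL.
  by case: L nt => // h2' L; rewrite -ltNge => /ltW.
- move=> v s2 [L [sL [ch2 mem2 hull2 cov2] [l2 i2 b2] v2 [hg2 ha2 bel2 top2]]].
  rewrite (testE _ L) //; case: L sL ch2 mem2 hull2 cov2 v2 => [|p1 [|p2 L]] //= sL.
  move=> ch2 mem2 hull2 cov2 v2 le21.
  have [ct1 ct2] := ch2; apply: wp_seq; apply: wp_wset; rewrite /= !mod0n hg2 ct1 M1 subn1 /=.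
  set s3 := setw s2 aTOP g _.
  have l3 : lenv s3 by exact: lenv_wset.
  have cov3 := cover_pop hull2 le21 cov2.
  have ch3 : chain (words s3 aBEL) (words s3 aTOP g) (p2 :: L).
    by rewrite /= !cellE /= eqxx.
  have mem3 p : p \in p2 :: L -> [/\ (p < n)%N, okB p & kk p = g].
    by move=> hp; have [|] := mem2 p; first by rewrite in_cons hp orbT.
  have hg3 : words s3 vG 0 = g by rewrite /= cellE.
  have ha3 : words s3 vP 0 = a by rewrite /= cellE.
  apply: wp_mono (wp_frame (wp_improve l3 i2 ha3 hg3 an oka ka ch3 mem3)).
  move=> t3 s4 [[ht3 l4 i4 b4 v4] fr4]; split; first by move: ht3; clear; lia.
  have bel4 : words s4 aBEL =1 words s3 aBEL by move=> r; rewrite fr4.1 ?nimp.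
  have top4 : words s4 aTOP =1 words s3 aTOP by move=> r; rewrite fr4.1 ?nimp.
  exists v.-1; first by rewrite -sL.
  exists (p2 :: L); split=> //.
  + by rewrite -sL.
  + split=> //.
    * by rewrite top4; apply: chain_ext ch3 => r _; exact: bel4.
    * by move=> p hp; have [? ? ?] := mem3 p hp.
    * by case: hull2.
    * by move=> lam p lam0 lamb; apply: cov3 => //; exact: le_trans b4.
  + by split=> //; apply: le_trans b4 b2.
  + split.
    * by rewrite fr4.1 ?nimp.
    * by rewrite fr4.1 ?nimp.
    * by move=> r; rewrite bel4 /= cellE /= bel2.
    * by move=> g' ne; rewrite top4 /= cellE /= (negbTE ne) top2.
have bel1 : words s1 aBEL =1 words s aBEL by move=> r; rewrite fr1.1 ?nimp.
have top1 : words s1 aTOP =1 words s aTOP by move=> r; rewrite fr1.1 ?nimp.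
exists st; split=> //.
- split=> //.
  + by rewrite top1; apply: chain_ext ch0 => r _; exact: bel1.
  + by move=> lam p lam0 lamb; apply: cov0 => //; exact: le_trans b1.
- by split=> //; rewrite fr1.1 ?nimp.
Qed.

Lemma wp_query_all s st0 : lenv s -> Inv s ->
  (forall g, g \in keys -> stack s (fun=> True) (fun p => (p < n)%N) g (st0 g)) ->
  wp M query_all s (fun t s' => [/\ (t <= n * (Trec + 15) + pot st0 + 3)%N, lenv s', Inv s',
    reals s' aBEST 0 <= reals s aBEST 0 &
    forall a, (a < n)%N -> okA a -> done (reals s' aBEST 0) a]).
Proof.
move=> l0 i0 stk0.
pose I (i p : nat) (s' : state R) := exists st, [/\ p = pot st,
    lenv s' /\ Inv s', reals s' aBEST 0 <= reals s aBEST 0,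
    forall g, g \in keys -> stack s' (fun lam => lam <= reals s' aBEST 0) (fun p => (p < n)%N) g (st g) &
    forall a, (a < i)%N -> okA a -> done (reals s' aBEST 0) a].
have H := @wp_for R M vP nE (If (tA (wvar vP)) (Seq (WSet vG (WC 0) (ekey (wvar vP)))
   (Seq improve query_loop)) Skip) n (Trec + 10)%N I s (pot st0) n_lt_M.
apply: wp_mono (H _ _ _) => {H}.
- move=> t s' [_ [p ht [st [ep [h1 h2] h3 h4 h5]]]]; split=> //.
  by move: ht; rewrite -addnA; clear; lia.
- exists st0; split=> //; first by split=> //; exact: lenv_wset.
  move=> g gk; have [h1 h2 h3 h4] := stk0 g gk; split=> //.
  by move=> lam p lam0 _; exact: h4.
- by move=> i p s1 _ _ [st [_ [h _] _ _ _]]; rewrite /= mod0n lenv_n.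
move=> i p s1 lt_i hx [st [ep [l1 i1] b1 stk1 d1]].
have e1 : weval M s1 (wvar vP) = i by rewrite /= mod0n.
apply: wp_if; rewrite tAE ?e1 // => oki; last first.
  apply: wp_skip; split=> //; exists p; first by rewrite addnC leq_add2l (leq_trans _ (leq_addl _ _)).
  exists st; split=> //; first by split=> //; exact: lenv_wset.
  by move=> a; rewrite ltnS leq_eqVlt => /orP[/eqP ->|/d1//]; rewrite (negbTE oki).
apply: wp_seq; apply: wp_wvar; rewrite ekeyE ?e1 //.
set g := kk i; set s2 := setw s1 vG 0 g.
have gk : g \in keys by exact: key_in.
have l2 : lenv s2 by exact: lenv_wset.
have ha2 : words s2 vP 0 = i by rewrite /= cellE.
have stk2 : stack s2 (fun lam => lam <= reals s2 aBEST 0) (fun p => (p < n)%N) g (st g).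
  by apply: stack_ext (stk1 g gk).
have nrec b : b != 1%N -> ~~ wmod b rec by apply: contra => /rec_mod ->.
have nimp b : b != 1%N -> ~~ wmod b improve by move=> h; rewrite /= orbF nrec.
apply: wp_mono (wp_frame (wp_query l2 i1 ha2 erefl lt_i oki erefl stk2)).
move=> t s3 [[L [ht stk3 [l3 i3 b3] d3 [bel3 top3]]] fr].
have nm : ~~ wmod vP (Seq improve query_loop) by rewrite /= !orbF orbb nrec.
split; first by rewrite fr.1.
have [beta0 _] := i3.
exists (pot (fun g' => if g' == g then L else st g')).
  have := pot_upd st L gk; move: ht; rewrite ep; clear; lia.
exists (fun g' => if g' == g then L else st g'); split=> //.
- by split=> //; exact: lenv_wset.
- exact: le_trans b3 b1.
- move=> g' g'k; case: eqP => [->|/eqP ne].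
    by apply: stack_ext stk3.
  (* The untouched stacks keep their covers, because a decrease of the best value only removes
     slopes to be served. *)
  have [h1 h2 h3 h4] : stack (setw s3 vP 0 i.+1) (fun lam => lam <= reals s1 aBEST 0)
      (fun p => (p < n)%N) g' (st g').
    apply: stack_ext (stk1 g' g'k) => //.
      by move=> r _; rewrite /= cellE /= bel3.
    by rewrite /= cellE /= top3.
  by split=> // lam r lam0 lamb; apply: h4 => //; exact: le_trans lamb b3.
- move=> a; rewrite ltnS leq_eqVlt => /orP[/eqP ->//|ai] oka.
  apply: (done_mono (ltn_trans ai lt_i) oka beta0 b3); exact: d1.
Qed.

Lemma wp_level s : lenv s -> Inv s ->
  wp M level s (fun t s' => [/\ (t <= n * (2 * Trec + 43) + 11)%N, lenv s', Inv s',
    reals s' aBEST 0 <= reals s aBEST 0 &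
    forall a, (a < n)%N -> okA a -> done (reals s' aBEST 0) a]).
Proof.
move=> l0 i0; apply: wp_seq; apply: wp_mono (wp_clear l0 i0).
move=> t1 s1 [ht1 l1 i1 b1 top1]; apply: wp_seq; apply: wp_mono (wp_push_all l1 i1 top1).
move=> t2 s2 [st [ht2 l2 i2 b2 stk2]]; apply: wp_mono (wp_query_all l2 i2 stk2).
move=> t3 s3 [ht3 l3 i3 b3 d3]; split=> //; last by rewrite -b1 -b2.
by move: ht1 ht2 ht3; rewrite /cst; clear; lia.
Qed.

End Level.

(** * Determinants as expressions *)

Section DetExpr.
Variables (R : realType) (M D : nat).
Hypothesis M_gt1 : (1 < M)%N.

Definition rzero := ROfWord (WC 0).
Definition rone := ROfWord (WC 1).
Definition rsum (es : seq rexp) := foldr RAdd rzero es.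

(** Leibniz formula as one expression whose number of terms depends on D alone, so it can be part of
    a fixed program. *)
Definition rdet (rows : seq (nat -> rexp)) : rexp :=
  let term (p : {perm 'I_D}) := RMul (if odd_perm p then RSub rzero rone else rone)
    (foldr RMul rone (map (fun i : 'I_D => nth (fun=> rzero) rows i (p i)) (enum 'I_D))) in
  rsum [seq term p | p <- enum {perm 'I_D}].

Definition rowval (s : state R) (r : nat -> rexp) : 'rV[R]_D := \row_j reval M s (r j).

Lemma reval_zero (s : state R) : reval M s rzero = 0.
Proof. by rewrite /= mod0n. Qed.

Lemma reval_one (s : state R) : reval M s rone = 1.
Proof. by rewrite /= modn_small. Qed.

Lemma reval_rsum (s : state R) (I : Type) (r : seq I) (f : I -> rexp) :
  reval M s (rsum [seq f i | i <- r]) = \sum_(i <- r) reval M s (f i).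
Proof.
elim: r => [|i r IH]; first by rewrite big_nil reval_zero.
by rewrite big_cons /= IH.
Qed.

Lemma reval_rdet (s : state R) rows : size rows = D ->
  reval M s (rdet rows) = \det (rowsmx [seq rowval s r | r <- rows]).
Proof.
move=> sr; rewrite reval_rsum big_enum /=; apply: eq_bigr => p _.
congr (_ * _).
  by case: (odd_perm p); rewrite ?expr1 ?expr0 /= ?mod0n ?modn_small // sub0r.
have -> : forall r : seq 'I_D, reval M s (foldr RMul rone
    (map (fun i : 'I_D => nth (fun=> rzero) rows i (p i)) r)) =
    \prod_(i <- r) reval M s (nth (fun=> rzero) rows i (p i)).
  elim=> [|i r IH]; first by rewrite big_nil reval_one.
  by rewrite big_cons /= IH.
rewrite big_enum; apply: eq_bigr => i _.
by rewrite !mxE (nth_map (fun=> rzero)) ?sr // mxE.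
Qed.

Definition rcramer rows i z : rexp := rdet (set_nth (fun=> rzero) rows i z).

Lemma map_set_nth (T1 T2 : Type) (x1 : T1) (x2 : T2) (f : T1 -> T2) l i z :
  (i < size l)%N -> [seq f x | x <- set_nth x1 l i z] = set_nth x2 [seq f x | x <- l] i (f z).
Proof. by elim: l i => [|x l IH] [|i] //= hi; rewrite IH. Qed.

Lemma reval_rcramer (s : state R) rows i z : size rows = D -> (i < D)%N ->
  reval M s (rcramer rows i z) = cramer [seq rowval s r | r <- rows] i (rowval s z).
Proof.
move=> sr hi; rewrite reval_rdet; last by rewrite size_set_nth sr; apply/maxn_idPr.
by rewrite (map_set_nth _ 0) // sr.
Qed.

End DetExpr.

Section Rows.
Variables (R : realType) (M d N n : nat) (S : n.-tuple 'rV[R]_d) (y : 'rV[R]_d).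
Hypotheses (M_gt1 : (1 < M)%N) (nd_lt : (n * d < M)%N) (d_lt : (d < M)%N)
  (N_lt : (2 * N < M)%N).

Definition ptrow e (j : nat) : rexp :=
  if j is j'.+1 then RGet 0 (WAdd (WMul e (WC d)) (WC j')) else rone.
Definition yrow (j : nat) : rexp := if j is j'.+1 then RGet 1 (WC j') else rone.
Definition code_nat (g : code d N) (j : nat) : nat :=
  if insub j is Some j' then g j' : nat else 0%N.
Definition netrow (g : code d N) (j : nat) : rexp :=
  if j is j'.+1 then RSub (ROfWord (WC (code_nat g j'))) (ROfWord (WC N)) else rzero.
Definition axrow (l j : nat) : rexp := if j == l then rone else rzero.

Definition inputs (s : state R) : Prop :=
  words s 0 0 = n /\ forall a i, (a < 2)%N -> reals s a i = reals (input S y) a i.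

Lemma rowval_P s e i : inputs s -> weval M s e = i -> (i < n)%N ->
  rowval M d.+1 s (ptrow e) = hat S`_i.
Proof.
move=> [_ hs] he hi; apply/rowP => j; rewrite mxE lift_mxE.
case: unliftP => [j' ->|->]; last by rewrite /= modn_small.
have d0 : (0 < d)%N by apply: leq_ltn_trans (ltn_ord j').
have jM : (j' < M)%N by apply: ltn_trans d_lt.
have lt : (i * d + j' < n * d)%N.
  by apply: (@leq_trans (i.+1 * d)); rewrite ?leq_mul2r ?hi ?orbT // mulSnr ltn_add2l.
have idM : (i * d < M)%N.
  by apply: leq_ltn_trans nd_lt; apply: leq_trans (ltnW lt); exact: leq_addr.
rewrite /= he (modn_small d_lt) (modn_small jM) (modn_small idM).
rewrite modn_small; last exact: ltn_trans lt nd_lt.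
rewrite hs //= divnMDl // divn_small // addn0 modnMDl modn_small //.
rewrite (insubT (fun i => (i < d)%N) (ltn_ord j')); congr (fun_of_matrix _ _ _); exact/val_inj.
Qed.

Lemma rowval_Y s : inputs s -> rowval M d.+1 s yrow = hat y.
Proof.
move=> [_ hs]; apply/rowP => j; rewrite mxE lift_mxE.
case: unliftP => [j' ->|->]; last by rewrite /= modn_small.
rewrite /= modn_small; last exact: ltn_trans (ltn_ord j') d_lt.
rewrite hs //= (insubT (fun i => (i < d)%N) (ltn_ord j')); congr (fun_of_matrix _ _ _); exact/val_inj.
Qed.

Lemma rowval_V s g : rowval M d.+1 s (netrow g) = dir (netv R g).
Proof.
apply/rowP => j; rewrite mxE lift_mxE.
case: unliftP => [j' ->|->]; last by rewrite /= mod0n.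
rewrite /= mxE /code_nat (insubT (fun i => (i < d)%N) (ltn_ord j')) !modn_small //.
- by congr (_%:R - _); congr (nat_of_ord (g _)); apply/val_inj.
- by apply: leq_ltn_trans N_lt; rewrite leq_pmull.
- by apply: leq_trans N_lt; rewrite ltnS -ltnS.
Qed.

Lemma rowval_E (s : state R) l (hl : (l < d.+1)%N) :
  rowval M d.+1 s (axrow l) = delta_mx 0 (Ordinal hl).
Proof.
apply/rowP => j; rewrite !mxE eqxx /= -val_eqE /= /axrow.
by case: eqP => _; rewrite /= ?mod0n ?modn_small.
Qed.

Definition digE (e B : wexp) (j : nat) : wexp := WRem (iter j (fun e => WDiv e B) e) B.

Lemma weval_digE (s : state R) e B j :
  weval M s (digE e B j) = dig (weval M s B) (weval M s e) j.
Proof.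
rewrite /digE /dig [LHS]/=; congr (_ %% _)%N.
by elim: j => //= j ->.
Qed.

Fixpoint powE_ (e : wexp) (j : nat) : wexp := if j is j'.+1 then WMul e (powE_ e j') else WC 1.

Lemma weval_powE (s : state R) e j : (weval M s e ^ j < M)%N ->
  weval M s (powE_ e j) = (weval M s e ^ j)%N.
Proof.
suff -> : weval M s (powE_ e j) = (weval M s e ^ j %% M)%N by move=> h; rewrite modn_small.
by elim: j => //= j ->; rewrite modnMmr expnS.
Qed.

End Rows.

(** * Recording a candidate *)

Section Record.
Variables (R : realType) (M : nat).
Implicit Types (s : state R).

Fixpoint write_out (j : nat) (es : seq wexp) : cmd :=
  if es is e :: es' then Seq (WSet 1 (WC j) e) (write_out j.+1 es') else Skip.

Definition record (es : seq wexp) (delta : rexp) : cmd :=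
  Seq (write_out 0 es) (RSet aBEST (WC 0) delta).

Lemma wmod_write_out a j es : wmod a (write_out j es) -> a = 1%N.
Proof. by elim: es j => //= e es IH j /orP[/eqP|/IH]. Qed.

Lemma rmod_write_out a j es : rmod a (write_out j es) = false.
Proof. by elim: es j => //= e es IH j. Qed.

Lemma wmod_record a es delta : wmod a (record es delta) -> a = 1%N.
Proof. by rewrite /= orbF => /wmod_write_out. Qed.

Lemma rmod_record a es delta : rmod a (record es delta) -> a = aBEST.
Proof. by rewrite /= rmod_write_out => /eqP. Qed.

Lemma wp_write_out s j0 es :
  (j0 + size es < M)%N -> all (fun e => ~~ wreads e 1) es ->
  wp M (write_out j0 es) s (fun t s' => [/\ (t <= 2 * size es + 1)%N,
    forall j, (j < size es)%N -> words s' 1 (j0 + j)%N = weval M s (nth (WC 0) es j),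
    forall j, (j < j0)%N -> words s' 1 j = words s 1 j & reals s' = reals s]).
Proof.
elim: es j0 s => [|e es IH] j0 s /=; first by move=> _ _; exact: wp_skip.
move=> hM /andP[e1 hr'].
apply: wp_seq; apply: wp_wset; rewrite /= modn_small; last by apply: leq_ltn_trans hM; exact: leq_addr.
have hM' : (j0.+1 + size es < M)%N by rewrite addSnnS.
apply: wp_mono (IH _ _ hM' hr') => t s' [ht h1 h2 h3]; split=> //.
- by move: ht; clear; lia.
- case=> [_|j hj].
    by rewrite addn0 h2 // /= cellE !eqxx.
  rewrite -addSnnS h1 //=; apply: weval_ext => a i ha; rewrite /= cellE.
  case: eqP => // a1; have /(all_nthP (WC 0))/(_ j hj) := hr'.
  by rewrite -a1 ha.
- by move=> j hj; rewrite h2 ?ltnS 1?ltnW //= cellE /= ltn_eqF.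
Qed.

(** Output cells are overwritten while later expressions are still to be evaluated: these may not
    read the output array, and [delta] must be insensitive to it. *)
Lemma wp_record s es delta : (size es < M)%N ->
  all (fun e => ~~ wreads e 1) es ->
  (forall s', (forall a i, a != 1%N -> words s' a i = words s a i) -> reals s' = reals s ->
     reval M s' delta = reval M s delta) ->
  wp M (record es delta) s (fun t s' => [/\ (t <= 2 * size es + 3)%N,
    forall j, (j < size es)%N -> words s' 1 j = weval M s (nth (WC 0) es j) &
    reals s' aBEST 0 = reval M s delta]).
Proof.
move=> hM hr hd; apply: wp_seq.
apply: wp_mono (wp_frame (@wp_write_out s 0%N es hM hr)).
move=> t s1 [[ht h1 _ h3] fr]; apply: wp_rset; rewrite /= mod0n; split.
- by move: ht; clear; lia.
- by move=> j hj; rewrite /= h1.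
- rewrite cellE !eqxx; apply: hd => // a i ha; rewrite fr.1 //.
  by apply: contra ha => /wmod_write_out ->.
Qed.

End Record.

(** * One choice of basis *)

Lemma wreads_digE e B j a : wreads (digE e B j) a -> wreads e a || wreads B a.
Proof.
rewrite /digE /= => /orP[|->]; last by rewrite orbT.
by elim: j => [->//|j IH] /= /orP[/IH//|->]; rewrite orbT.
Qed.

Lemma wmod_sort a key rk : wmod a (sort key rk) ->
  a \in [:: vP; vX; aTREE; vT; vQ; aORD; rk].
Proof.
rewrite !inE /=; do ![case: (a == _) => //=].
Qed.

Section Round.
Variables (R : realType) (M d N n k L : nat) (S : n.-tuple 'rV[R]_d) (y : 'rV[R]_d).
Hypotheses (k_ge2 : (2 <= k)%N) (k_le_d : (k <= d)%N).
Hypotheses (n_ge2 : (2 <= n)%N) (n_le : (n <= 2 ^ L)%N) (M_big : (2 ^ L.+1 < M)%N)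
  (nd_lt : (n * d < M)%N) (d_lt : (d < M)%N) (N_lt : (2 * N < M)%N)
  (key_lt : (n ^ (d.+1 - k) < M)%N) (lev_lt : (L.+1 ^ (d.+1 - k) < M)%N).

Let m := (d.+1 - k)%N.
Let h := (k - 2)%N.

Let hm2 : (h + m + 2 = d.+1)%N.
Proof. by rewrite /h /m; clear -k_ge2 k_le_d; lia. Qed.

Let n_gt0 : (0 < n)%N := ltnW n_ge2.

Let nM : (n < M)%N.
Proof.
by apply: (leq_ltn_trans n_le); apply: leq_ltn_trans M_big; rewrite leq_exp2l.
Qed.

Let M_gt1 : (1 < M)%N.
Proof. exact: leq_ltn_trans n_gt0 nM. Qed.

Let M1 : (1 %% M = 1)%N.
Proof. by rewrite modn_small. Qed.

Let M2 : (2 %% M = 2)%N.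
Proof. by rewrite modn_small //; apply: leq_ltn_trans n_ge2 nM. Qed.

Definition good_output (o : nat -> nat) (beta : R) : Prop :=
  let idx := [seq o j | j <- iota 0 k] in
  [/\ all (fun i => i < n)%N idx, uniq idx &
      flat_dist y (affine_hull [seq S`_i | i <- idx]) <= N%:R * beta].

Record env (I : nat) (s : state R) : Prop := Env {
  env_in : inputs S y s;
  env_L : envL n L s;
  env_tree : tree_zero L s;
  env_I : words s vI 0 = I }.

Variables (tau : seq (code d N)) (l : nat) (I : nat).
Hypotheses (size_tau : size tau = m) (l_lt : (l < d.+1)%N)
  (net_tau : all (in_net R (N := N)) tau).

Definition base := mkseq (dig n I) h.

Definition axis_row : 'rV[R]_d.+1 := delta_mx 0 (Ordinal l_lt).

(** The basis [mrows] with points named by plain numbers, decoded from the loop index as on the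
    machine. *)
Definition nX : seq 'rV[R]_d.+1 :=
  ([seq hat S`_i | i <- base] ++ [seq dir (netv R g) | g <- tau]) ++ [:: hat y; axis_row].

Definition nu p := cramer nX (h + m + 1) (hat S`_p).
Definition nal p := cramer nX (h + m) (hat S`_p) / nu p.
Definition ngam i p := cramer nX (h + i) (hat S`_p) / nu p.
Definition nGam p := \sum_(i <- iota 0 m) ngam i p.

Definition round_ok (beta : R) : Prop :=
  \det (rowsmx nX) != 0 -> forall a p, (a < n)%N -> (p < n)%N -> nu a != 0 -> nu p != 0 ->
  (forall i, (i < m)%N -> ngam i a <= ngam i p) ->
  beta * (nal p - nal a) <= nGam p - nGam a.

Let pt (i : 'I_n) := S`_i.
Let T0 : seq 'I_n := [seq Ordinal (dig_lt I j n_gt0) | j <- iota 0 h].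

Lemma nX_mrows : nX = mrows pt y T0 tau axis_row.
Proof. by rewrite /nX /base /mkseq /mrows /brows /T0 -!map_comp. Qed.

Lemma sizeT0 : size T0 = h.
Proof. by rewrite size_map size_iota. Qed.

(** The output indices are distinct without any test: a repetition inside [base] would make the
    determinant vanish, points of [base] have [nu] equal to 0 while a and p have not, and a and p
    differ in [nal]. *)
Lemma pair_good (o : nat -> nat) a p : (a < n)%N -> (p < n)%N ->
  \det (rowsmx nX) != 0 -> nu a != 0 -> nu p != 0 -> nal a < nal p ->
  (forall i, (i < m)%N -> ngam i a <= ngam i p) ->
  [seq o j | j <- iota 0 k] = base ++ [:: a; p] ->
  good_output o ((nGam p - nGam a) / (nal p - nal a)).
Proof.
move=> an pn dn ua up lt_al le_gam oE; rewrite /good_output oE.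
have base_lt i : i \in base -> (i < n)%N.
  by case/mapP => j _ ->; exact: dig_lt.
have det0 i j : (i < d.+1)%N -> (j < d.+1)%N -> i != j -> nX`_i != nX`_j.
  move=> hi hj ij; apply: contra dn => /eqP e.
  apply/eqP; apply: (@determinant_alternate _ _ _ (Ordinal hi) (Ordinal hj)) => //.
  by move=> z; rewrite !mxE /= e.
have base_nth i : (i < h)%N -> nX`_i = hat S`_(nth 0%N base i).
  move=> hi; rewrite /nX !nth_cat !size_cat !size_map size_iota ltn_addr // hi.
  by rewrite (nth_map 0%N) // size_mkseq.
have base_nu b : b \in base -> nu b = 0.
  move=> /(nthP 0%N)[i]; rewrite size_mkseq => hi <-.
  have i_lt : (i < d.+1)%N by clear -hi hm2; lia.
  have w_lt : (h + m + 1 < d.+1)%N by clear -hm2; lia.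
  rewrite /nu -base_nth //.
  have := cramer_nth nX (Ordinal w_lt) (Ordinal i_lt); rewrite /= => ->.
  by rewrite -val_eqE /= ifF //; apply/negbTE; clear -hi; lia.
have sub : {subset [seq pt i | i <- T0 ++ [:: Ordinal an; Ordinal pn]] <=
    [seq S`_i | i <- base ++ [:: a; p]]}.
  by rewrite !map_cat /T0 -!map_comp.
split.
- by rewrite all_cat /= an pn /= andbT; apply/allP => i; exact: base_lt.
- rewrite cat_uniq /= !inE orbF andbT; apply/and3P; split.
  + apply/(uniqP 0%N) => i j; rewrite !inE size_mkseq => hi hj e.
    apply/eqP/negPn/negP => ij.
    have hi' : (i < d.+1)%N by clear -hi hm2; lia.
    have hj' : (j < d.+1)%N by clear -hj hm2; lia.
    by have := det0 i j hi' hj' ij; rewrite !base_nth // e eqxx.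
  + rewrite negb_or; apply/andP; split.
      by apply: contra ua => /base_nu ->.
    by apply: contra up => /base_nu ->.
  + by apply: contraTneq lt_al => ->; rewrite ltxx.
have sz : (size T0 + size tau + 2 = d.+1)%N by rewrite sizeT0 size_tau.
have := @main_sound R d N n pt y T0 tau axis_row sz net_tau (Ordinal an) (Ordinal pn) _ _.
move=> /(_ _ _ _ _ _ _ sub); rewrite -nX_mrows /pGam /pal /pgam /pu -nX_mrows sizeT0 size_tau.
have e (F : nat -> R) : \sum_(i <- iota 0 m) F i = \sum_(i < m) F i.
  by rewrite -(big_mkord xpredT F) /index_iota subn0.
by rewrite /nGam !e; apply.
Qed.

Lemma nGam_le a p : (forall i, (i < m)%N -> ngam i a <= ngam i p) -> nGam a <= nGam p.
Proof.
move=> hle; rewrite /nGam big_seq [X in _ <= X]big_seq; apply: ler_sum => i.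
by rewrite mem_iota => hi; exact: hle.
Qed.

Definition baseE : seq wexp := [seq digE (wvar vI) nE j | j <- iota 0 h].

Definition rowsE : seq (nat -> rexp) :=
  ([seq ptrow d e | e <- baseE] ++ [seq netrow g | g <- tau]) ++ [:: yrow; axrow l].

Definition is_rzero e := TAnd (RLe e rzero) (RLe rzero e).

Definition cramE i := rcramer d.+1 rowsE i (ptrow d (wvar vP)).

Definition store_gammas := seqs [seq RSet (aGA i) (wvar vP)
  (RDiv (cramE (h + i)) (cramE (h + m + 1))) | i <- iota 0 m].

(** For vanishing [nu] the quotients evaluate to 0 and are stored all the same; the flag keeps such
    points out of both roles. *)
Definition store_point := seqs [::
  RSet aAL (wvar vP) (RDiv (cramE (h + m)) (cramE (h + m + 1)));
  store_gammas;
  RSet aGG (wvar vP) (rsum [seq RGet (aGA i) (wvar vP) | i <- iota 0 m]);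
  If (is_rzero (cramE (h + m + 1))) (WSet aVAL (wvar vP) (WC 0)) (WSet aVAL (wvar vP) (WC 1))].

Definition store := For vP nE store_point.

Lemma size_rowsE : size rowsE = d.+1.
Proof. by rewrite !size_cat !size_map size_iota size_tau. Qed.

Lemma rowsE_val s : inputs S y s -> words s vI 0 = I ->
  [seq rowval M d.+1 s r | r <- rowsE] = nX.
Proof.
move=> hs hI; rewrite /rowsE /nX !map_cat -!map_comp; congr ((_ ++ _) ++ _).
- apply/eq_in_map => j _.
  have he : weval M s (digE (wvar vI) nE j) = dig n I j.
    by rewrite weval_digE /= !mod0n hI hs.1.
  exact: (rowval_P M_gt1 nd_lt d_lt hs he (dig_lt I j n_gt0)).
- by apply/eq_in_map => g _ /=; exact: rowval_V.
- by rewrite /= (rowval_Y _ _ hs) // (rowval_E _ s l_lt).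
Qed.

Lemma cramE_val s p i : inputs S y s -> words s vI 0 = I -> words s vP 0 = p ->
  (p < n)%N -> (i < d.+1)%N -> reval M s (cramE i) = cramer nX i (hat S`_p).
Proof.
move=> hs hI hp pn hi; rewrite reval_rcramer ?size_rowsE // rowsE_val //.
have hv : weval M s (wvar vP) = p by rewrite /= mod0n.
by rewrite (rowval_P M_gt1 nd_lt d_lt hs hv pn).
Qed.

Lemma is_rzero_val (s : state R) e : teval M s (is_rzero e) = (reval M s e == 0).
Proof. by rewrite /= mod0n eq_le. Qed.

Definition stored (s : state R) p := [/\ reals s aAL p = nal p,
  forall i, (i < m)%N -> reals s (aGA i) p = ngam i p, reals s aGG p = nGam p &
  words s aVAL p = (nu p != 0) :> nat].

Let w_lt : (h + m + 1 < d.+1)%N.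
Proof. by clear -hm2; lia. Qed.
Let y_lt : (h + m < d.+1)%N.
Proof. by clear -hm2; lia. Qed.

Lemma wp_store_gammas s p : inputs S y s -> words s vI 0 = I -> words s vP 0 = p ->
  (p < n)%N -> wp M store_gammas s (fun t s' => [/\ (t <= 2 * m + 1)%N,
    forall i, (i < m)%N -> reals s' (aGA i) p = ngam i p,
    words s' = words s,
    forall a i, (a < 5)%N -> reals s' a i = reals s a i &
    forall a q, q != p -> reals s' a q = reals s a q]).
Proof.
move=> hs hI hp pn.
pose J (l1 : seq nat) (s' : state R) := [/\ 
    forall i, i \in l1 -> reals s' (aGA i) p = ngam i p, words s' = words s,
    forall a i, (a < 5)%N -> reals s' a i = reals s a i &
    forall a q, q != p -> reals s' a q = reals s a q].
have H := @wp_seqs R M nat (fun i => RSet (aGA i) (wvar vP)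
  (RDiv (cramE (h + i)) (cramE (h + m + 1)))) (iota 0 m) 1 J s.
apply: wp_mono (H _ _) => {H}.
- move=> t s' [ht [h1 h2 h3 h4]]; split=> //.
    by move: ht; rewrite size_iota mulnC.
  by move=> i hi; apply: h1; rewrite mem_iota.
- by split.
move=> l1 i s1; rewrite mem_iota => hi [h1 h2 h3 h4].
have hs1 : inputs S y s1.
  split; first by rewrite h2; exact: hs.1.
  by move=> a j ha; rewrite h3 ?hs.2 //; clear -ha; lia.
have i_lt : (h + i < d.+1)%N by clear -hi hm2; lia.
apply: wp_rset; split=> //; rewrite [reval _ _ _]/=.
rewrite !(cramE_val (p := p)) ?h2 //= mod0n h2 hp; split.
- move=> j; rewrite mem_rcons in_cons => /orP[/eqP ->|hj].
    by rewrite /= cellE !eqxx.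
  by rewrite /= cellE eqn_add2l eqxx andbT; case: eqP => [->//|_]; exact: h1.
- by rewrite /= h2.
- move=> a j ha; rewrite /= cellE ifF ?h3 //.
  by apply/negbTE/nandP; left; clear -ha; lia.
- by move=> a q qp; rewrite /= cellE (negbTE qp) andbF h4.
Qed.

Lemma wp_store_point s p : env I s -> words s vP 0 = p -> (p < n)%N ->
  wp M store_point s (fun t s' => [/\ (t <= 2 * m + 12)%N, stored s' p,
    forall q, q != p -> stored s q -> stored s' q,
    forall a i, a != aVAL -> words s' a i = words s a i &
    forall a i, (a < 3)%N -> reals s' a i = reals s a i]).
Proof.
move=> [hs hL hT hI] hp pn.
apply: wp_seq; apply: wp_rset; rewrite [reval _ _ _]/= [weval _ _ _]/= mod0n hp.
rewrite !(cramE_val (p := p)) //.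
set s1 := setr s aAL p _.
have hs1 : inputs S y s1.
  split; first exact: hs.1.
  by move=> [|[|a]] j ha //; rewrite /= cellE hs.2.
apply: wp_seq; apply: wp_mono (wp_store_gammas hs1 hI hp pn).
move=> t s2 [ht g2 w2 r2 q2].
have hs2 : inputs S y s2.
  split; first by rewrite w2; exact: hs1.1.
  by move=> a j ha; rewrite r2 ?hs1.2 //; clear -ha; lia.
have hI2 : words s2 vI 0 = I by rewrite w2.
have hp2 : words s2 vP 0 = p by rewrite w2.
apply: wp_seq; apply: wp_rset; rewrite [weval _ _ _]/= mod0n hp2.
have -> : reval M s2 (rsum [seq RGet (aGA i) (wvar vP) | i <- iota 0 m]) = nGam p.
  rewrite reval_rsum; apply: eq_big_seq => i; rewrite mem_iota => hi.
  by rewrite /= mod0n hp2 g2.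
set s3 := setr s2 aGG p _.
have hs3 : inputs S y s3.
  split; first exact: hs2.1.
  by move=> [|[|a]] j ha //; rewrite /= cellE hs2.2.
have g54 i : (5 + i == 4)%N = false by [].
have g53 i : (5 + i == 3)%N = false by [].
apply: wp_seq.
apply: (@wp_mono _ _ _ _ (fun t s' => t = 2%N /\ s' = setw s3 aVAL p (nu p != 0))).
  move=> _ s4 [-> ->]; apply: wp_skip; split.
  - by move: ht; clear; lia.
  - split.
    + by rewrite /s3 /= cellE /= r2 // /s1 /= cellE !eqxx.
    + by move=> i hi; rewrite /s3 /= cellE g54 /= g2.
    + by rewrite /s3 /= cellE !eqxx.
    + by rewrite /= cellE !eqxx.
  - move=> q qp [h1 h2 h3 h4]; split.
    + by rewrite /s3 /= cellE /= r2 // /s1 /= cellE (negbTE qp) andbF.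
    + by move=> i hi; rewrite /s3 /= cellE g54 /= q2 // /s1 /= cellE g53 /= h2.
    + by rewrite /s3 /= cellE (negbTE qp) andbF q2 // /s1 /= cellE /= h3.
    + by rewrite /= cellE (negbTE qp) andbF w2.
  - by move=> a i /negbTE ha; rewrite /= cellE ha /= w2.
  - move=> [|[|[|a]]] i ha //; rewrite /= cellE /= r2 //.
have e : teval M s3 (is_rzero (cramE (h + m + 1))) = (nu p == 0).
  by rewrite is_rzero_val (cramE_val (p := p)).
apply: wp_if; rewrite e => hz; apply: wp_wset; split=> //=; rewrite !mod0n hp2 ?M1.
  by rewrite hz.
by rewrite hz.
Qed.

Lemma wp_store s : env I s -> wp M store s (fun t s' => [/\ (t <= n * (2 * m + 15) + 3)%N,
    forall p, (p < n)%N -> stored s' p,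
    forall a i, a != aVAL -> a != vP -> words s' a i = words s a i &
    forall a i, (a < 3)%N -> reals s' a i = reals s a i]).
Proof.
move=> envs.
pose J (i p : nat) (s' : state R) := [/\ p = 0%N, forall p, (p < i)%N -> stored s' p,
    forall a i, a != aVAL -> a != vP -> words s' a i = words s a i &
    forall a i, (a < 3)%N -> reals s' a i = reals s a i].
have H := @wp_for R M vP nE store_point n (2 * m + 12)%N J s 0 nM.
apply: wp_mono (H _ _ _) => {H}.
- move=> t s' [_ [p ht [p0 h1 h2 h3]]]; split=> //.
  by move: ht; rewrite p0; clear; lia.
- by split=> // a i _ /negbTE ha; rewrite /= cellE ha.
- by move=> i p s1 _ _ [_ _ h1 _]; rewrite /= mod0n h1 // envs.(env_L).(envL_n).
move=> i p s1 lt_i hx [p0 h1 h2 h3].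
have env1 : env I s1.
  case: envs => [[e1 e2] [e3 e4 e5] e6 e7]; split.
  - by split; [rewrite h2|move=> a j ha; rewrite h3 ?e2 //; clear -ha; lia].
  - by split; [rewrite h2|rewrite h2|move=> j hj; rewrite h2 // e5].
  - by move=> x hx'; rewrite h2 // e6.
  - by rewrite h2.
apply: wp_mono (wp_store_point env1 hx lt_i) => t s2 [ht st2 st1 w2 r2].
split; first by rewrite w2.
exists 0%N; first by rewrite p0 addn0.
split=> //.
- move=> q; rewrite ltnS leq_eqVlt => /orP[/eqP ->//|qi].
  by apply: st1; [rewrite ltn_eqF|exact: h1].
- by move=> a j ha hb; rewrite /= cellE (negbTE hb) /= w2 // h2.
- by move=> a j ha; rewrite r2 // h3.
Qed.

Definition sort_gammas := seqs [seq sort (aGA i) (aRK i) | i <- iota 0 m].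

Definition ranked (K : nat -> R) (rk : nat -> nat) := 
  (forall p, (p < n)%N -> (rk p < n)%N) /\
  forall p q, (p < n)%N -> (q < n)%N -> (rk p <= rk q)%N = (K p <= K q).

Definition sort_mods := [:: vP; vX; aTREE; vT; vQ; aORD].

Lemma env_frame s s' : env I s -> tree_zero L s' ->
  (forall a i, a \in [:: 0%N; vI; vL; aPOW] -> words s' a i = words s a i) ->
  (forall a i, (a < 2)%N -> reals s' a i = reals s a i) -> env I s'.
Proof.
move=> [[e1 e2] [e3 e4 e5] e6 e7] ht hw hr; split=> //.
- by split; [rewrite hw|move=> a j ha; rewrite hr // e2].
- by split; [rewrite hw|rewrite hw|move=> j hj; rewrite hw // e5].
- by rewrite hw.
Qed.

Lemma wp_sort_env s key rk : env I s -> (15 < rk)%N ->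
  wp M (sort key rk) s (fun t s' => [/\ (t <= n * (10 * L + 40) + 7)%N, env I s',
    sorted_prefix (reals s key) n (words s' aORD) (words s' rk) n,
    forall a i, a != rk -> a \notin sort_mods -> words s' a i = words s a i &
    forall a i, reals s' a i = reals s a i]).
Proof.
move=> envs hrk; have [h1 h2 h3 h4] := envs.
have := wp_sort n_le M_big hrk h2 (fun=> erefl) h3.
move=> /(_ key)/wp_frame; apply: wp_mono => t s' [[ht htree sp] fr].
have fw a i : a != rk -> a \notin sort_mods -> words s' a i = words s a i.
  move=> ar am; rewrite fr.1 //; apply/negP => /wmod_sort.
  by move: am; rewrite !inE (negbTE ar) orbF => /negbTE ->.
have fr2 a i : reals s' a i = reals s a i by rewrite fr.2.
split=> //; apply: (env_frame envs htree) => // a i.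
by rewrite !inE => /or4P[] /eqP ->; apply: fw => //; rewrite ltn_eqF // (leq_trans _ hrk).
Qed.

Lemma wp_sort_gammas s : env I s -> wp M sort_gammas s (fun t s' =>
  [/\ (t <= m * (n * (10 * L + 40) + 8) + 1)%N, env I s',
    forall i, (i < m)%N -> ranked (reals s (aGA i)) (words s' (aRK i)),
    forall a i, a \notin sort_mods -> (a < 16)%N -> words s' a i = words s a i &
    forall a i, reals s' a i = reals s a i]).
Proof.
move=> envs.
pose J (l1 : seq nat) (s' : state R) := [/\ env I s',
    forall i, i \in l1 -> ranked (reals s (aGA i)) (words s' (aRK i)),
    forall a i, a \notin sort_mods -> (a < 16)%N -> words s' a i = words s a i &
    forall a i, reals s' a i = reals s a i].
have H := @wp_seqs R M nat (fun i => sort (aGA i) (aRK i)) (iota 0 m)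
  (n * (10 * L + 40) + 7)%N J s.
apply: wp_mono (H _ _) => {H}.
- move=> t s' [ht [h1 h2 h3 h4]]; split=> //.
    by move: ht; rewrite size_iota -addnS.
  by move=> i hi; apply: h2; rewrite mem_iota.
- by split.
move=> l1 i s1 _ [h1 h2 h3 h4].
have rk16 : (15 < 16 + i)%N by rewrite addSn ltnS leq_addr.
apply: wp_mono (wp_sort_env (aGA i) h1 rk16) => t s2 [ht env2 sp w2 r2].
split=> //; split=> //.
- move=> j; rewrite mem_rcons in_cons => hj.
  have [->|ji] := eqVneq j i.
    have [_ rl rk] := sorted_prefix_full sp.
    by split=> // p q pn qn; rewrite rk // !h4.
  move: hj; rewrite (negbTE ji) /= => /h2[rl rk].
  have e p : words s2 (16 + j) p = words s1 (16 + j) p.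
    by rewrite w2 // ?eqn_add2l.
  by split=> [p pn|p q pn qn]; rewrite !e; [exact: rl|exact: rk].
- move=> a j am a16; rewrite w2 ?h3 //.
  by rewrite ltn_eqF // (leq_trans a16) // leq_addr.
- by move=> a j; rewrite r2 h4.
Qed.

Definition LE := WAdd (wvar vL) (WC 1).
Definition levE i := digE (wvar vE) LE i.
Definition pow_levE i := WGet aPOW (levE i).

(** Horner evaluation of [undig]. Since n^m is below the word modulus there is no wraparound, so
    equal keys mean equal leading bits in every coordinate. *)
Definition ekey e := foldr (fun i acc =>
  WAdd (WMul acc nE) (WDiv (WGet (aRK i) e) (pow_levE i))) (WC 0) (iota 0 m).

Definition bitA e i :=
  isZ (WRem (WDiv (WMul (WGet (aRK i) e) (WC 2)) (pow_levE i)) (WC 2)).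
Definition bitB e i := WLe (WC 1)
  (WRem (WDiv (WAdd (WMul (WGet (aRK i) e) (WC 2)) (WC 1)) (pow_levE i)) (WC 2)).
Definition valid_test e := WLe (WC 1) (WGet aVAL e).
Definition tA e := foldr TAnd (valid_test e) [seq bitA e i | i <- iota 0 m].
Definition tB e := foldr TAnd (valid_test e) [seq bitB e i | i <- iota 0 m].

Definition recE := record (baseE ++ [:: wvar vP; topE])
  (RDiv (RSub (RGet aGG topE) (RGet aGG (wvar vP))) (RSub (RGet aAL topE) (RGet aAL (wvar vP)))).

Definition levels := For vE (powE_ LE m) (level ekey tA tB recE).

(** * All level tuples of one basis *)

Section Levels.
Variable s1 : state R.
Hypotheses (env1 : env I s1) (dn : \det (rowsmx nX) != 0)
  (stored1 : forall p, (p < n)%N -> stored s1 p)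
  (ranked1 : forall i, (i < m)%N -> ranked (reals s1 (aGA i)) (words s1 (aRK i)))
  (sp1 : exists rk, sorted_prefix (reals s1 aAL) n (words s1 aORD) rk n).

Let rk i p := words s1 (aRK i) p.
Let lev ell i := dig L.+1 ell i.

Definition kk ell p := undig n [seq (rk i p %/ 2 ^ lev ell i)%N | i <- iota 0 m].
Definition okA ell p := all (fun i => ~~ odd ((rk i p * 2) %/ 2 ^ lev ell i)) (iota 0 m)
  && (0 < words s1 aVAL p)%N.
Definition okB ell p := all (fun i => odd ((rk i p * 2).+1 %/ 2 ^ lev ell i)) (iota 0 m)
  && (0 < words s1 aVAL p)%N.

Definition lenv ell (s : state R) := [/\
  forall a i, a \notin level_mods -> a != vE -> words s a i = words s1 a i,
  words s vE 0 = ell & forall a i, a != aBEST -> reals s a i = reals s1 a i].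

Lemma lev_le ell i : (lev ell i <= L)%N.
Proof. by rewrite -ltnS; exact: dig_lt. Qed.

Lemma pow_levE_val ell s i : lenv ell s -> weval M s (pow_levE i) = (2 ^ lev ell i)%N.
Proof.
move=> [hw he _].
have -> : weval M s (pow_levE i) = words s aPOW (weval M s (levE i)) by [].
rewrite /levE weval_digE /= !mod0n he !hw //.
rewrite env1.(env_L).(envL_L) M1 addn1 modn_small ?env1.(env_L).(envL_pow) //.
- exact: lev_le.
- by apply: ltn_trans M_big; exact: ltn_expl.
Qed.

Lemma rank_lt i p : (i < m)%N -> (p < n)%N -> (rk i p < n)%N.
Proof. by move=> hi hp; apply: (ranked1 hi).1. Qed.

Lemma digits_lt ell p : (p < n)%N ->
  all (fun x => x < n)%N [seq (rk i p %/ 2 ^ lev ell i)%N | i <- iota 0 m].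
Proof.
move=> hp; rewrite all_map; apply/allP => i; rewrite mem_iota /= => hi.
by apply: leq_ltn_trans (leq_div _ _) _; exact: rank_lt.
Qed.

Lemma ekey_val ell s e : lenv ell s -> (weval M s e < n)%N ->
  weval M s (ekey e) = kk ell (weval M s e).
Proof.
move=> hl he.
have -> : weval M s (ekey e) = (kk ell (weval M s e) %% M)%N.
  rewrite /ekey /kk; elim: (iota 0 m) => [|i r IH]; first by rewrite /= mod0n.
  have hp := pow_levE_val i hl; have [hw _ _] := hl.
  transitivity (((weval M s (foldr (fun i acc => WAdd (WMul acc nE)
      (WDiv (WGet (aRK i) e) (pow_levE i))) (WC 0) r) * weval M s nE) %% M +
      words s (aRK i) (weval M s e) %/ weval M s (pow_levE i)) %% M)%N; first by [].
  rewrite IH hp [weval M s nE]/= mod0n !hw // env1.(env_L).(envL_n) modnMml.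
  by rewrite modnDml.
rewrite modn_small //; apply: leq_trans (undig_lt (digits_lt ell he)) _.
by rewrite size_map size_iota ltnW.
Qed.

Lemma foldr_TAnd (s : state R) b (f : nat -> test) (g : nat -> bool) r :
  (forall i, i \in r -> teval M s (f i) = g i) ->
  teval M s (foldr TAnd b [seq f i | i <- r]) = all g r && teval M s b.
Proof.
elim: r => //= i r IH hf; rewrite hf ?mem_head // IH ?andbA // => j hj.
by apply: hf; rewrite in_cons hj orbT.
Qed.

Lemma tA_val ell s e : lenv ell s -> (weval M s e < n)%N ->
  teval M s (tA e) = okA ell (weval M s e).
Proof.
move=> hl he; have [hw _ _] := hl.
rewrite /tA (@foldr_TAnd _ _ _
  (fun i => ~~ odd ((rk i (weval M s e) * 2) %/ 2 ^ lev ell i))).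
  by rewrite /okA /= M1 hw.
move=> i; rewrite mem_iota => hi; have hp := pow_levE_val i hl.
transitivity (((words s (aRK i) (weval M s e) * (2 %% M)) %% M %/ weval M s (pow_levE i))
  %% (2 %% M) <= 0 %% M)%N; first by [].
rewrite hp mod0n hw // -/(rk i _) M2 [(_ * 2 %% M)%N]modn_small; last first.
  apply: ltn_trans M_big; rewrite expnSr ltn_mul2r /=.
  exact: leq_trans (rank_lt hi he) n_le.
by rewrite modn2; case: odd.
Qed.

Lemma tB_val ell s e : lenv ell s -> (weval M s e < n)%N ->
  teval M s (tB e) = okB ell (weval M s e).
Proof.
move=> hl he; have [hw _ _] := hl.
rewrite /tB (@foldr_TAnd _ _ _
  (fun i => odd ((rk i (weval M s e) * 2).+1 %/ 2 ^ lev ell i))).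
  by rewrite /okB /= M1 hw.
move=> i; rewrite mem_iota => hi; have hp := pow_levE_val i hl.
have hr : ((rk i (weval M s e) * 2).+1 < M)%N.
  apply: ltn_trans M_big; rewrite expnSr.
  by move: (leq_trans (rank_lt hi he) n_le); clear; lia.
transitivity (1 %% M <= (((words s (aRK i) (weval M s e) * (2 %% M)) %% M + 1 %% M) %% M
  %/ weval M s (pow_levE i)) %% (2 %% M))%N; first by [].
rewrite hp hw // -/(rk i _) M1 M2.
rewrite [(_ * 2 %% M)%N]modn_small ?addn1; last exact: ltnW.
by rewrite [((_ * 2).+1 %% M)%N]modn_small // modn2; case: odd.
Qed.

Lemma okA_valid ell a : (a < n)%N -> okA ell a -> nu a != 0.
Proof. by move=> /stored1[_ _ _ e] /andP[_]; rewrite e; case: (nu a == 0). Qed.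

Lemma okB_valid ell a : (a < n)%N -> okB ell a -> nu a != 0.
Proof. by move=> /stored1[_ _ _ e] /andP[_]; rewrite e; case: (nu a == 0). Qed.

(** Only admissible pairs meet in a group: [level_le] turns equal leading bits and the two test bits
    into an inequality of ranks, hence of values. *)
Lemma gam_of_key ell a p : (a < n)%N -> (p < n)%N -> okA ell a -> okB ell p ->
  kk ell a = kk ell p -> forall i, (i < m)%N -> ngam i a <= ngam i p.
Proof.
move=> an pn /andP[/allP hA _] /andP[/allP hB _] ek i hi.
have im : i \in iota 0 m by rewrite mem_iota.
have [_ ga _ _] := stored1 an; have [_ gp _ _] := stored1 pn.
rewrite -ga // -gp // -(ranked1 hi).2 //.
have := undig_inj _ (digits_lt ell an) (digits_lt ell pn) ek.
rewrite !size_map => /(_ erefl)/eq_in_map/(_ i im) e.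
exact: level_le e (hA i im) (hB i im).
Qed.

(** Every admissible pair meets in a group of at least one tuple of levels. *)
Lemma level_of_gam a p : (a < n)%N -> (p < n)%N -> nu a != 0 -> nu p != 0 ->
  (forall i, (i < m)%N -> ngam i a <= ngam i p) ->
  exists2 ell, (ell < L.+1 ^ m)%N & [/\ okA ell a, okB ell p & kk ell a = kk ell p].
Proof.
move=> an pn ua up le_gam.
have [_ ga _ va] := stored1 an; have [_ gp _ vp] := stored1 pn.
have ex i : exists b, (i < m)%N -> (b <= L)%N /\
    [/\ (rk i a %/ 2 ^ b = rk i p %/ 2 ^ b)%N,
    ~~ odd ((rk i a * 2) %/ 2 ^ b) & odd ((rk i p * 2).+1 %/ 2 ^ b)].
  have [hi|] := ltnP i m; last by exists 0%N.
  have le_r : (rk i a <= rk i p)%N by rewrite (ranked1 hi).2 // ga // gp // le_gam.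
  have [b hb hh] := level_exists le_r (leq_trans (rank_lt hi pn) n_le).
  by exists b.
(* One level per coordinate; the digits of a single number encode the tuple. *)
have [f hf] := choice ex.
have [i hi|ell ltl hell] := @dig_surj L.+1 f m; first by case: (hf i hi).
exists ell => //; rewrite /okA /okB va vp ua up !andbT; split.
- apply/allP => i; rewrite mem_iota => hi; rewrite /lev hell //.
  by have [_ []] := hf i hi.
- apply/allP => i; rewrite mem_iota => hi; rewrite /lev hell //.
  by have [_ []] := hf i hi.
- rewrite /kk; congr undig; apply/eq_in_map => i; rewrite mem_iota => hi.
  by rewrite /lev hell //; have [_ []] := hf i hi.
Qed.

Let A := reals s1 aAL.
Let G := reals s1 aGG.

Lemma G_le_key ell a p : (a < n)%N -> (p < n)%N -> okA ell a -> okB ell p ->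
  kk ell a = kk ell p -> G a <= G p.
Proof.
move=> an pn oka okp ek; have [_ _ ea _] := stored1 an; have [_ _ ep _] := stored1 pn.
rewrite /G ea ep; apply: nGam_le; exact: gam_of_key ek.
Qed.

Hypothesis k_lt : (k < M)%N.

Lemma wp_recE ell s a p : lenv ell s -> Inv good_output s -> words s vP 0 = a ->
  words s aTOP (words s vG 0) = p.+1 -> (a < n)%N -> (p < n)%N -> okA ell a -> okB ell p ->
  kk ell a = kk ell p ->
  tilt A G (reals s aBEST 0) p < tilt A G (reals s aBEST 0) a ->
  wp M recE s (fun t s' => [/\ (t <= 2 * k + 3)%N, Inv good_output s' &
     reals s' aBEST 0 = (G p - G a) / (A p - A a)]).
Proof.
move=> [hw he hr] [b0 _] ha hp an pn oka okp ek lt_val.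
have [ea _ eGa _] := stored1 an; have [ep _ eGp _] := stored1 pn.
have Gle := G_le_key an pn oka okp ek.
have lt2 : G p - G a < reals s aBEST 0 * (A p - A a) by move: lt_val; rewrite /tilt; lra.
have Apos : 0 < A p - A a.
  rewrite ltNge; apply/negP => le0; have := mulr_ge0_le0 b0 le0.
  by apply/negP; rewrite -ltNge; apply: le_lt_trans lt2; rewrite subr_ge0.
have topv : weval M s topE = p by rewrite /= !mod0n hp M1 subn1.
have sz : size (baseE ++ [:: wvar vP; topE]) = k.
  by rewrite size_cat size_map size_iota /= /h; clear -k_ge2; lia.
have H := @wp_record R M s (baseE ++ [:: wvar vP; topE]) (RDiv (RSub (RGet aGG topE)
  (RGet aGG (wvar vP))) (RSub (RGet aAL topE) (RGet aAL (wvar vP)))).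
apply: wp_mono (H _ _ _) => {H}; last 1 first.
- by move=> s' h1 h2 /=; rewrite !mod0n !h1 // h2.
- move=> t s' [ht ho hb].
  have bE : reals s' aBEST 0 = (G p - G a) / (A p - A a).
    rewrite hb; transitivity ((reals s aGG (weval M s topE) - reals s aGG (weval M s (wvar vP)))
      / (reals s aAL (weval M s topE) - reals s aAL (weval M s (wvar vP)))); first by [].
    by rewrite topv [weval M s (wvar vP)]/= mod0n ha !hr.
  split=> //; first by rewrite sz in ht.
  split; first by rewrite bE divr_ge0 ?subr_ge0 // ltW // -subr_gt0.
  rewrite bE /A /G ea ep eGa eGp; apply: pair_good => //.
  + exact: okA_valid oka.
  + exact: okB_valid okp.
  + by rewrite -ea -ep -subr_gt0.
  + exact: gam_of_key ek.
  rewrite sz in ho.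
  apply: (@eq_from_nth _ 0%N) => [|i].
    by rewrite size_map size_iota size_cat size_mkseq /= /h; clear -k_ge2; lia.
  rewrite size_map size_iota => hi; rewrite (nth_map 0%N) ?size_iota // nth_iota // add0n ho //.
  rewrite !nth_cat size_map size_iota size_mkseq; case: ifP => hih.
    rewrite (nth_map 0%N) ?size_iota // nth_iota // add0n nth_mkseq //.
    by rewrite weval_digE /= !mod0n !hw // env1.(env_I) env1.(env_L).(envL_n).
  have : (i - h < 2)%N by move: hi hih; rewrite /h; clear -k_ge2; lia.
  by case: (i - h)%N => [|[|]] //= _; rewrite ?mod0n ?ha //; rewrite /= ?mod0n hp M1 subn1.
- by rewrite sz.
rewrite all_cat /= andbT all_map; apply/allP => j _ /=; apply/negP => /wreads_digE.
by rewrite /=.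
Qed.

Lemma lenv_ok ell : forall s s', lenv ell s ->
  (forall a i, a \notin level_mods -> words s' a i = words s a i) ->
  (forall a i, a != aBEST -> reals s' a i = reals s a i) -> lenv ell s'.
Proof.
move=> s s' [h1 h2 h3] hw hr; split.
- by move=> a i am av; rewrite hw // h1.
- by rewrite hw.
- by move=> a i ab; rewrite hr // h3.
Qed.

Lemma wp_level_ell ell s : lenv ell s -> Inv good_output s ->
  wp M (level ekey tA tB recE) s (fun t s' => [/\ (t <= n * (4 * k + 49) + 11)%N,
    lenv ell s', Inv good_output s', reals s' aBEST 0 <= reals s aBEST 0 &
    forall a, (a < n)%N -> okA ell a ->
      done n A G (kk ell) (okB ell) (reals s' aBEST 0) a]).
Proof.
move=> hl hi; have [rk0 sp] := sp1; have [surj _ _] := sorted_prefix_full sp.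
have H := @wp_level R M n A G (words s1 aORD) (kk ell) (okA ell) (okB ell) ekey tA tB recE
  (2 * k + 3)%N (lenv ell) good_output n_gt0 nM (@lenv_ok ell).
apply: wp_mono (H _ _ _ _ _ _ _ _ _ _ _ _ _ _ _ s hl hi) => {H}.
- move=> t s' [ht h1 h2 h3 h4]; split=> //.
  by move: ht; rewrite (_ : (2 * (2 * k + 3) + 43 = 4 * k + 49)%N) //; clear; lia.
- by move=> s2 [hw _ _]; rewrite hw // env1.(env_L).(envL_n).
- by move=> s2 p [_ _ hr]; rewrite hr.
- by move=> s2 p [_ _ hr]; rewrite hr.
- by move=> s2 i [hw _ _]; rewrite hw.
- by move=> s2 e; exact: ekey_val.
- by move=> s2 e; exact: tA_val.
- by move=> s2 e; exact: tB_val.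
- exact: sp.(sp_lt).
- exact: sp.(sp_uniq).
- exact: surj.
- exact: sp.(sp_le).
- by move=> a p; exact: G_le_key.
- by move=> a; exact: wmod_record.
- by move=> a; exact: rmod_record.
- by move=> s2 a p; exact: wp_recE.
Qed.

Lemma wp_levels s : (forall a i, a \notin level_mods -> a != vE -> words s a i = words s1 a i) ->
  (forall a i, a != aBEST -> reals s a i = reals s1 a i) -> Inv good_output s ->
  wp M levels s (fun t s' => [/\ (t <= L.+1 ^ m * (n * (4 * k + 49) + 14) + 3)%N,
    env I s', Inv good_output s', reals s' aBEST 0 <= reals s aBEST 0 & round_ok (reals s' aBEST 0)]).
Proof.
move=> hw hr hi.
pose J (i p : nat) (s' : state R) := [/\ p = 0%N,
  (forall a i, a \notin level_mods -> a != vE -> words s' a i = words s1 a i) /\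
  (forall a i, a != aBEST -> reals s' a i = reals s1 a i), Inv good_output s',
  reals s' aBEST 0 <= reals s aBEST 0 &
  forall ell, (ell < i)%N -> forall a, (a < n)%N -> okA ell a ->
      done n A G (kk ell) (okB ell) (reals s' aBEST 0) a].
have H := @wp_for R M vE (powE_ LE m) (level ekey tA tB recE) (L.+1 ^ m)%N
  (n * (4 * k + 49) + 11)%N J s 0 lev_lt.
apply: wp_mono (H _ _ _) => {H}.
- move=> t s' [_ [p ht [p0 [h1 h2] h3 h4 h5]]]; split=> //.
  + by move: ht; rewrite p0 !addn0 -addnA.
  + case: env1 => [[e1 e2] [e3 e4 e5] e6 e7]; split.
    * by split; [rewrite h1|move=> a j ha; rewrite h2 ?e2 //; apply: contraTneq ha => ->].
    * by split; [rewrite h1|rewrite h1|move=> j hj; rewrite h1 // e5].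
    * by move=> x hx; rewrite h1 // e6.
    * by rewrite h1.
  + move=> _ a p' an pn ua up le_gam.
    have [ell ltl [oka okp ek]] := level_of_gam an pn ua up le_gam.
    have [ea _ eGa _] := stored1 an; have [ep _ eGp _] := stored1 pn.
    by rewrite -ea -ep -eGa -eGp; exact: (h5 ell ltl a an oka).
- split=> //; split=> // a i am av; rewrite /= cellE (negbTE av) /=; exact: hw.
- move=> i p s2 _ _ [_ [h1 _] _ _ _].
  have e : weval M s2 LE = L.+1.
    rewrite /= !mod0n h1 // env1.(env_L).(envL_L) M1 addn1 modn_small //.
    by apply: ltn_trans M_big; exact: ltn_expl.
  by rewrite weval_powE ?e.
move=> i p s2 lt_i hx [p0 [h1 h2] h3 h4 h5].
have hl : lenv i s2 by split.
apply: wp_mono (wp_level_ell hl h3) => t s3 [ht [w3 e3 r3] i3 b3 d3].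
split=> //; exists 0%N; first by rewrite p0 addn0.
split=> //.
- by split=> // a j am av; rewrite /= cellE (negbTE av) /=; exact: w3.
- exact: le_trans b3 h4.
- move=> ell; rewrite ltnS leq_eqVlt => /orP[/eqP ->//|lt_ell] a an oka.
  have [beta0 _] := i3.
  exact: (@done_mono R n A G (kk ell) (okA ell) (okB ell)
    (fun a1 p1 an1 pn1 oa ob ek => G_le_key an1 pn1 oa ob ek) _ _ a an oka beta0 b3
    (h5 ell lt_ell a an oka)).
Qed.

End Levels.

Hypothesis k_lt : (k < M)%N.

(** The sort along y comes last, so that [aORD] is left in the order of [aAL]; its ranks go to the
    spare array [aRK m]. *)
Definition round := If (is_rzero (rdet d.+1 rowsE)) Skip
  (seqs [:: store; sort_gammas; sort aAL (aRK m); levels]).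

Definition round_time := (n * (2 * m + 15) + 3 + (m * (n * (10 * L + 40) + 8) + 1) +
  (n * (10 * L + 40) + 7) + (L.+1 ^ m * (n * (4 * k + 49) + 14) + 3) + 6)%N.

Lemma wp_round s : env I s -> Inv good_output s ->
  wp M round s (fun t s' => [/\ (t <= round_time)%N, env I s', Inv good_output s',
    reals s' aBEST 0 <= reals s aBEST 0 & round_ok (reals s' aBEST 0)]).
Proof.
move=> envs hi.
have e : teval M s (is_rzero (rdet d.+1 rowsE)) = (\det (rowsmx nX) == 0).
  rewrite is_rzero_val reval_rdet ?size_rowsE // rowsE_val //.
  - by case: envs.
  - by case: envs.
apply: wp_if; rewrite e => hd.
  by apply: wp_skip; split=> //; [rewrite /round_time addnC|rewrite /round_ok hd].
apply: wp_seq; apply: wp_mono (wp_frame (wp_store envs)) => t1 s1 [[ht1 st1 w1 r1] fr1].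
have env1 : env I s1.
  apply: (env_frame envs).
  - by move=> x hx; rewrite w1 // envs.(env_tree).
  - by move=> a i; rewrite !inE => /or4P[] /eqP ->; exact: w1.
  - by move=> a i ha; rewrite r1 // (ltn_trans ha).
apply: wp_seq; apply: wp_mono (wp_sort_gammas env1) => t2 s2 [ht2 env2 rk2 w2 r2].
have rkm : (15 < 16 + m)%N by rewrite addSn ltnS leq_addr.
apply: wp_seq; apply: wp_mono (wp_sort_env aAL env2 rkm) => t3 s3 [ht3 env3 sp3 w3 r3].
have best3 : reals s3 aBEST 0 = reals s aBEST 0 by rewrite r3 r2 r1.
have out3 : words s3 1 = words s 1.
  by apply/funext => i; rewrite w3 // w2 // w1.
have st3 p : (p < n)%N -> stored s3 p.
  move=> pn; have [h1 h2 h3 h4] := st1 p pn; split.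
  - by rewrite r3 r2.
  - by move=> i him; rewrite r3 r2 h2.
  - by rewrite r3 r2.
  - by rewrite w3 // w2.
have rk3 i : (i < m)%N -> ranked (reals s3 (aGA i)) (words s3 (aRK i)).
  move=> him; have [h1 h2] := rk2 i him.
  have e3 p : words s3 (16 + i) p = words s2 (16 + i) p.
    by rewrite w3 // eqn_add2l ltn_eqF.
  by split=> [p pn|p q pn qn]; rewrite !e3 ?r3 ?r2; [exact: h1|exact: h2].
have sp3' : exists rk, sorted_prefix (reals s3 aAL) n (words s3 aORD) rk n.
  exists (words s3 (16 + m)); have -> : reals s3 aAL = reals s2 aAL; last exact: sp3.
  by apply/funext => i; rewrite r3.
have i3 : Inv good_output s3 by rewrite /Inv best3 out3.
have dn : \det (rowsmx nX) != 0 by rewrite hd.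
apply: wp_seq; apply: wp_mono (wp_levels env3 dn st3 rk3 sp3' k_lt _ _ i3) => //.
move=> t4 s4 [ht4 env4 i4 b4 ok4]; apply: wp_skip; split=> //; last by rewrite -best3.
by move: ht1 ht2 ht3 ht4; rewrite /round_time; clear; lia.
Qed.

End Round.

(** * The algorithm *)

Section Program.
Variables (d N k : nat).

Definition ttrue := WLe (WC 0) (WC 0).
Definition wneq e e' := TNot (TAnd (WLe e e') (WLe e' e)).

Fixpoint distinctE (es : seq wexp) : test :=
  if es is e :: es' then
    TAnd (foldr TAnd ttrue [seq wneq e e' | e' <- es']) (distinctE es')
  else ttrue.

(* A candidate: the first [c.1.1] of [k.-1] points, a tuple [c.1.2] of
   directions, and the last index of the output. *)
Definition cand := (nat * seq (code d N) * nat)%type.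

Definition prefixE j : seq wexp := [seq digE (wvar vI) nE i | i <- iota 0 j].

Definition drowsE (c : cand) : seq (nat -> rexp) :=
  [seq ptrow d e | e <- prefixE c.1.1] ++ [seq netrow g | g <- c.1.2].

Definition cfE (c : cand) i :=
  RDiv (rcramer d.+1 (drowsE c) (c.1.1 + i) yrow) (rdet d.+1 (drowsE c)).

Definition dvalE (c : cand) := rsum [seq RSub rzero (cfE c i) | i <- iota 0 (size c.1.2)].

(** Fewer than k points define the candidate, yet k distinct ones must be returned. As k - 1 indices
    cannot exhaust 0, ..., k - 1, a constant serves as the last index, and the loop runs over
    n^(k-1) tuples only. *)
Definition outE (c : cand) : seq wexp := prefixE k.-1 ++ [:: WC (c.2)].

Definition direct (c : cand) : cmd :=
  If (TAnd (TNot (is_rzero (rdet d.+1 (drowsE c))))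
     (TAnd (foldr TAnd ttrue [seq RLe (cfE c i) rzero | i <- iota 0 (size c.1.2)])
     (TAnd (distinctE (outE c)) (TNot (RLe bestE (dvalE c))))))
    (record (outE c) (dvalE c)) Skip.

End Program.

Section Stages.
Variables (R : realType) (M d N n k L : nat) (S : n.-tuple 'rV[R]_d) (y : 'rV[R]_d).
Hypotheses (k_ge2 : (2 <= k)%N) (k_le_d : (k <= d)%N) (k_le_n : (k <= n)%N).
Hypotheses (n_ge2 : (2 <= n)%N) (n_le : (n <= 2 ^ L)%N) (M_big : (2 ^ L.+1 < M)%N)
  (nd_lt : (n * d < M)%N) (d_lt : (d < M)%N) (N_lt : (2 * N < M)%N)
  (key_lt : (n ^ (d.+1 - k) < M)%N) (lev_lt : (L.+1 ^ (d.+1 - k) < M)%N)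
  (k_lt : (k < M)%N).

Let n_gt0 : (0 < n)%N := ltnW n_ge2.

Let M_gt1 : (1 < M)%N.
Proof. by apply: leq_ltn_trans M_big; rewrite expn_gt0. Qed.

Let pt (i : 'I_n) := S`_i.

Local Notation env := (env L S y).
Local Notation good := (good_output (R := R) N k S y).

Definition nprefix I j := mkseq (dig n I) j.

Definition dX I (c : cand d N) : seq 'rV[R]_d.+1 :=
  [seq hat S`_i | i <- nprefix I c.1.1] ++ [seq dir (netv R g) | g <- c.1.2].

Definition ncf I (c : cand d N) i :=
  cramer (dX I c) (c.1.1 + i) (hat y) / \det (rowsmx (dX I c)).

Definition direct_ok I (c : cand d N) (beta : R) : Prop :=
  \det (rowsmx (dX I c)) != 0 -> (forall i, (i < size c.1.2)%N -> ncf I c i <= 0) ->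
  uniq (nprefix I k.-1 ++ [:: c.2]) ->
  beta <= \sum_(i <- iota 0 (size c.1.2)) - ncf I c i.

Definition cand_ok (c : cand d N) := [/\ (c.1.1 < k)%N, (c.1.1 + size c.1.2 = d.+1)%N,
  all (in_net R (N := N)) c.1.2 & (c.2 < k)%N].

Lemma teval_all (s : state R) (f : nat -> test) (g : nat -> bool) r :
  (forall i, i \in r -> teval M s (f i) = g i) ->
  teval M s (foldr TAnd ttrue [seq f i | i <- r]) = all g r.
Proof.
elim: r => [_|i r IH hf] /=; first by rewrite leqnn.
rewrite hf ?mem_head // IH // => j hj.
by apply: hf; rewrite in_cons hj orbT.
Qed.

Lemma teval_distinct (s : state R) es :
  teval M s (distinctE es) = uniq [seq weval M s e | e <- es].
Proof.
elim: es => [|e es IH]; first by rewrite /= leqnn.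
rewrite /= IH; congr (_ && _).
elim: es {IH} => [|e' es IH] /=; first by rewrite leqnn.
by rewrite IH in_cons negb_or -eqn_leq.
Qed.

Lemma prefixE_val s I j : inputs S y s -> words s vI 0 = I ->
  [seq weval M s e | e <- prefixE j] = nprefix I j.
Proof.
move=> hs hI; rewrite -map_comp; apply/eq_in_map => i _ /=.
by rewrite -[LHS]/(weval M s (digE (wvar vI) nE i)) weval_digE /= !mod0n hI hs.1.
Qed.

Lemma drowsE_val s I c : inputs S y s -> words s vI 0 = I ->
  [seq rowval M d.+1 s r | r <- drowsE c] = dX I c.
Proof.
move=> hs hI; rewrite /drowsE /prefixE /dX /nprefix /mkseq map_cat -!map_comp; congr (_ ++ _).
  apply/eq_in_map => i _.
  have he : weval M s (digE (wvar vI) nE i) = dig n I i.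
    by rewrite weval_digE /= !mod0n hI hs.1.
  exact: (rowval_P M_gt1 nd_lt d_lt hs he (dig_lt I i n_gt0)).
by apply/eq_in_map => g _ /=; exact: rowval_V.
Qed.

Lemma size_drowsE c : cand_ok c -> size (drowsE c) = d.+1.
Proof. by move=> [_ h _ _]; rewrite size_cat !size_map size_iota. Qed.

Lemma cfE_val s I c i : cand_ok c -> inputs S y s -> words s vI 0 = I ->
  (i < size c.1.2)%N -> reval M s (cfE c i) = ncf I c i.
Proof.
move=> hc hs hI hi; have [_ h _ _] := hc; have sr := size_drowsE hc.
have hd : (c.1.1 + i < d.+1)%N by rewrite -h ltn_add2l.
transitivity (reval M s (rcramer d.+1 (drowsE c) (c.1.1 + i) yrow) /
  reval M s (rdet d.+1 (drowsE c))); first by [].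
rewrite (reval_rcramer M_gt1) // (reval_rdet M_gt1) // (drowsE_val _ hs hI).
by rewrite (rowval_Y M_gt1 d_lt hs).
Qed.

Lemma dvalE_val s I c : cand_ok c -> inputs S y s -> words s vI 0 = I ->
  reval M s (dvalE c) = \sum_(i <- iota 0 (size c.1.2)) - ncf I c i.
Proof.
move=> hc hs hI; rewrite reval_rsum; apply: eq_big_seq => i; rewrite mem_iota => hi.
transitivity (reval M s rzero - reval M s (cfE c i)); first by [].
by rewrite reval_zero (cfE_val hc hs hI) // sub0r.
Qed.

Lemma direct_good I c (o : nat -> nat) : cand_ok c -> \det (rowsmx (dX I c)) != 0 ->
  (forall i, (i < size c.1.2)%N -> ncf I c i <= 0) ->
  uniq (nprefix I k.-1 ++ [:: c.2]) ->
  [seq o j | j <- iota 0 k] = nprefix I k.-1 ++ [:: c.2] ->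
  good o (\sum_(i <- iota 0 (size c.1.2)) - ncf I c i).
Proof.
move=> [c1 c2 c3 c4] dn cle un oE; rewrite /good_output oE; split=> //.
  rewrite all_cat /= andbT; apply/andP; split; last exact: leq_trans c4 k_le_n.
  by apply/allP => i /mapP[j _ ->]; exact: dig_lt.
pose T : seq 'I_n := [seq Ordinal (dig_lt I j n_gt0) | j <- iota 0 c.1.1].
have dE : dX I c = brows pt T c.1.2 by rewrite /dX /nprefix /mkseq /brows -!map_comp.
have sT : size T = c.1.1 by rewrite size_map size_iota.
have e (F : nat -> R) : \sum_(i <- iota 0 (size c.1.2)) F i = \sum_(i < size c.1.2) F i.
  by rewrite -(big_mkord xpredT F) /index_iota subn0.
rewrite e; have cfE' i : ncf I c i = cf pt y T c.1.2 i by rewrite /ncf /cf dE sT.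
under eq_bigr => i _ do rewrite cfE'.
apply: direct_sound => //.
- by rewrite sT.
- by rewrite -dE.
- by move=> i hi; rewrite -cfE' cle.
move=> z /mapP[i /mapP[j]]; rewrite mem_iota => hj -> ->.
rewrite map_cat mem_cat; apply/orP; left; apply: (map_f (fun i => S`_i)).
by apply: map_f; rewrite mem_iota; apply: leq_trans hj _; clear -c1; lia.
Qed.

Lemma wp_direct I c s : cand_ok c -> env I s -> Inv good s ->
  wp M (direct k c) s (fun t s' => [/\ (t <= 2 * k + 4)%N, env I s', Inv good s',
    reals s' aBEST 0 <= reals s aBEST 0 & direct_ok I c (reals s' aBEST 0)]).
Proof.
move=> hc envs hi; have [hs hL hT hI] := envs; have [c1 c2 c3 c4] := hc.
have sr := size_drowsE hc.
have outv : [seq weval M s e | e <- outE k c] = nprefix I k.-1 ++ [:: c.2].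
  by rewrite map_cat (prefixE_val _ hs hI) /= modn_small // (ltn_trans c4).
have so : size (outE k c) = k.
  by rewrite size_cat size_map size_iota addn1 prednK // (leq_trans _ k_ge2).
have testE : teval M s (TAnd (TNot (is_rzero (rdet d.+1 (drowsE c))))
     (TAnd (foldr TAnd ttrue [seq RLe (cfE c i) rzero | i <- iota 0 (size c.1.2)])
     (TAnd (distinctE (outE k c)) (TNot (RLe bestE (dvalE c)))))) =
  [&& \det (rowsmx (dX I c)) != 0, all (fun i => ncf I c i <= 0) (iota 0 (size c.1.2)),
    uniq (nprefix I k.-1 ++ [:: c.2]) &
    \sum_(i <- iota 0 (size c.1.2)) - ncf I c i < reals s aBEST 0].
  rewrite -outv -teval_distinct -(dvalE_val hc hs hI) -(drowsE_val _ hs hI) -(reval_rdet M_gt1) //.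
  rewrite -is_rzero_val -(@teval_all s (fun i => RLe (cfE c i) rzero)).
    by rewrite ltNge /= !mod0n.
  move=> i; rewrite mem_iota => hi'.
  transitivity (reval M s (cfE c i) <= reval M s rzero); first by [].
  by rewrite (cfE_val hc hs hI) // reval_zero.
apply: wp_if; rewrite testE => ht; last first.
  apply: wp_skip; split=> //; first by clear; lia.
  move=> dn cle un; rewrite leNgt; apply: contra ht => ->.
  rewrite dn un !andbT; apply/allP => i; rewrite mem_iota; exact: cle.
have /and4P[dn /allP cle un lt_v] := ht.
have cle' i : (i < size c.1.2)%N -> ncf I c i <= 0.
  by move=> hi'; apply: cle; rewrite mem_iota.
have H := @wp_record R M s (outE k c) (dvalE c).
apply: wp_mono (wp_frame (H _ _ _)) => {H}.
- move=> t s' [[ht' ho hb] fr]; rewrite so in ht' ho.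
  have w1 a i : a != 1%N -> words s' a i = words s a i.
    by move=> a1; rewrite fr.1 //; apply: contra a1 => /wmod_record ->.
  have r1 a i : a != aBEST -> reals s' a i = reals s a i.
    by move=> a1; rewrite fr.2 //; apply: contra a1 => /rmod_record ->.
  have bE : reals s' aBEST 0 = \sum_(i <- iota 0 (size c.1.2)) - ncf I c i.
    by rewrite hb (dvalE_val hc hs hI).
  split.
  + by move: ht'; clear; lia.
  + apply: (env_frame envs).
    * by move=> x hx; rewrite w1 // hT.
    * by move=> a i; rewrite !inE => /or4P[] /eqP ->; exact: w1.
    * by move=> [|[|a]] i ha //; exact: r1.
  + split.
      rewrite bE big_seq; apply: sumr_ge0 => i; rewrite mem_iota oppr_ge0; exact: cle'.
    rewrite bE; apply: direct_good => //; rewrite -outv.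
    apply: (@eq_from_nth _ 0%N) => [|i]; first by rewrite !size_map size_iota so.
    rewrite size_map size_iota => hi'; rewrite (nth_map 0%N) ?size_iota // nth_iota // add0n ho //.
    by rewrite (nth_map (WC 0)) // so.
  + by rewrite bE ltW.
  + by rewrite bE.
- by rewrite so.
- rewrite all_cat /= andbT all_map; apply/allP => j _ /=; apply/negP => /wreads_digE.
  by [].
- move=> s' h1 h2.
  have hs' : inputs S y s' by split; [rewrite h1 // hs.1|move=> a j ha; rewrite h2 hs.2].
  have hI' : words s' vI 0 = I by rewrite h1.
  by rewrite (dvalE_val hc hs hI) (dvalE_val hc hs' hI').
Qed.

(** Common to both stages; the antitonicity hypothesis carries what was established for earlier
    tuples through later decreases of the best value. *)
Lemma wp_stage (C : eqType) (f : C -> cmd) (cs : seq C) (T e : nat)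
    (ok : nat -> C -> R -> Prop) s :
  (n ^ e < M)%N ->
  (forall I c (b b' : R), 0 <= b' -> b' <= b -> ok I c b -> ok I c b') ->
  (forall c I s, c \in cs -> env I s -> Inv good s ->
    wp M (f c) s (fun t s' => [/\ (t <= T)%N, env I s', Inv good s',
      reals s' aBEST 0 <= reals s aBEST 0 & ok I c (reals s' aBEST 0)])) ->
  (exists I, env I s) -> Inv good s ->
  wp M (For vI (powE_ nE e) (seqs [seq f c | c <- cs])) s (fun t s' =>
    [/\ (t <= n ^ e * (size cs * T.+1 + 4) + 3)%N, exists I, env I s', Inv good s',
      reals s' aBEST 0 <= reals s aBEST 0 &
      forall I c, (I < n ^ e)%N -> c \in cs -> ok I c (reals s' aBEST 0)]).
Proof.
move=> e_lt anti hf [I0 env0] i0.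
pose J (i p : nat) (s' : state R) := [/\ p = 0%N, exists I, env I s', Inv good s',
  reals s' aBEST 0 <= reals s aBEST 0 &
  forall I c, (I < i)%N -> c \in cs -> ok I c (reals s' aBEST 0)].
have setI I1 I2 s' : env I1 s' -> env I2 (setw s' vI 0 I2).
  move=> [[e1 e2] [e3 e4 e5] e6 e7]; split; [by split|by split|by []|].
  by rewrite /= cellE.
have H := @wp_for R M vI (powE_ nE e) (seqs [seq f c | c <- cs]) (n ^ e)%N
  (size cs * T.+1 + 1)%N J s 0 e_lt.
apply: wp_mono (H _ _ _) => {H}.
- move=> t s' [_ [p ht [p0 h1 h2 h3 h4]]]; split=> //.
  by move: ht; rewrite p0 !addn0 -addnA.
- by split=> //; exists 0%N; exact: setI env0.
- move=> i p s1 _ _ [_ [I1 env1] _ _ _].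
  have e1 : weval M s1 nE = n by rewrite /= mod0n; exact: env1.(env_in).1.
  by rewrite weval_powE e1.
move=> i p s1 lt_i hx [p0 [I1 env1] h2 h3 h4].
have eI : I1 = i by rewrite -hx env1.(env_I).
subst I1.
pose J2 (l1 : seq C) (s' : state R) := [/\ env i s', Inv good s',
  reals s' aBEST 0 <= reals s1 aBEST 0 &
  forall c, c \in l1 -> ok i c (reals s' aBEST 0)].
have H := @wp_seqs R M C f cs T J2 s1.
apply: wp_mono (H _ _) => {H}; last 2 first.
- by split.
- move=> l1 c s2 hc [env2 i2 b2 d2].
  apply: wp_mono (hf c i s2 hc env2 i2) => t s3 [ht env3 i3 b3 d3]; split=> //.
  split=> //; first exact: le_trans b3 b2.
  move=> c'; rewrite mem_rcons in_cons => /orP[/eqP ->//|/d2].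
  by apply: anti => //; case: i3.
move=> t s2 [ht [env2 i2 b2 d2]]; split; first exact: env2.(env_I).
exists 0%N; first by rewrite p0 addn0.
split=> //.
- by exists i.+1; exact: setI env2.
- exact: le_trans b2 h3.
- move=> I c; rewrite ltnS leq_eqVlt => /orP[/eqP ->|lt_I] hc; first exact: d2.
  by apply: anti (h4 I c lt_I hc) => //; case: i2.
Qed.

End Stages.

(** * The whole program *)

(** The program cannot mention the input size, so L is found at run time, while the table of powers
    is filled by doubling. *)
Definition powers := Seq (WSet aPOW (WC 0) (WC 1))
  (While (TNot (WLe nE (powE (wvar vL))))
    (Seq (WSet aPOW (WAdd (wvar vL) (WC 1)) (WAdd (powE (wvar vL)) (powE (wvar vL))))
         (WSet vL (WC 0) (WAdd (wvar vL) (WC 1))))).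

Lemma wp_powers (R : realType) (M n lg : nat) (s : state R) :
  (n < 2 ^ lg)%N -> (2 ^ lg.+1 < M)%N -> words s 0 0 = n -> words s vL 0 = 0%N ->
  wp M powers s (fun t s' => (t <= 4 * lg + 3)%N /\
    exists L, [/\ (L <= lg)%N, (n <= 2 ^ L)%N & envL n L s']).
Proof.
move=> n_lt M_big hn hL.
have M1 : (1 %% M = 1)%N by rewrite modn_small //; apply: leq_ltn_trans M_big; rewrite expn_gt0.
have pM j : (j <= lg.+1)%N -> (2 ^ j < M)%N.
  by move=> hj; apply: leq_ltn_trans M_big; rewrite leq_exp2l.
have jM j : (j <= lg.+1)%N -> (j < M)%N.
  by move=> hj; apply: ltn_trans (pM j hj); exact: ltn_expl.
apply: wp_seq; apply: wp_wset; rewrite /= mod0n M1.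
pose J v (s' : state R) := exists j, [/\ v = (lg - j)%N, (j <= lg)%N, words s' 0 0 = n,
  words s' vL 0 = j & forall i, (i <= j)%N -> words s' aPOW i = (2 ^ i)%N].
have H := @wp_while R M (TNot (WLe nE (powE (wvar vL))))
    (Seq (WSet aPOW (WAdd (wvar vL) (WC 1)) (WAdd (powE (wvar vL)) (powE (wvar vL))))
         (WSet vL (WC 0) (WAdd (wvar vL) (WC 1)))) J 3 lg.
apply: wp_mono (H _ _ _) => {H}.
- move=> t s' [nt [v [le_v ht [j [ev le_j h1 h2 h3]]]]]; split; first by move: ht; clear; lia.
  by exists j; split=> //; move: nt; rewrite /= !mod0n h1 h2 h3 // negbK.
- move=> v s1 [j [ev le_j h1 h2 h3]]; rewrite /= !mod0n h1 h2 h3 // -ltnNge => lt_n.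
  have lt_j : (j < lg)%N by rewrite -(ltn_exp2l _ _ (ltnSn 1)); exact: ltn_trans lt_n n_lt.
  apply: wp_seq; apply: wp_wset; apply: wp_wvar; rewrite /= !mod0n !cellE /= h2 M1 addn1.
  have p1 : ((2 ^ j + 2 ^ j) %% M = 2 ^ j.+1)%N.
    by rewrite addnn -mul2n -expnS modn_small // pM // ltnW.
  have p2 : (j.+1 %% M = j.+1)%N by rewrite modn_small // jM // ltnW.
  rewrite h3 // p1 addn1 p2.
  split=> //; exists (lg - j.+1)%N; first by rewrite ev; clear -lt_j; lia.
  exists j.+1; split=> //=.
  move=> i; rewrite leq_eqVlt !cellE /= => /orP[/eqP ->|hi]; first by rewrite eqxx.
  by rewrite ltn_eqF ?h3 //.
- exists 0%N; split=> //=; first by rewrite subn0.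
  by case=> // _; rewrite cellE.
Qed.

Section Final.
Variables (R : realType) (d N k : nat).

(** The norm condition is decided here, while the program text is being built; the machine could not
    take the square root. *)
Definition taus r : seq (seq (code d N)) :=
  map (fun t : r.-tuple (code d N) => tval t)
    (seq.filter (fun t : r.-tuple (code d N) => all (in_net R (N := N)) (tval t))
      (enum {: r.-tuple (code d N)})).

Lemma mem_taus r tau : (tau \in taus r) = (size tau == r) && all (in_net R (N := N)) tau.
Proof.
apply/mapP/andP => [[t]|[/eqP sr ht]].
  by rewrite mem_filter => /andP[ht _] ->; rewrite size_tuple eqxx.
by subst r; exists (in_tuple tau) => //; rewrite mem_filter ht mem_enum.
Qed.

Definition cands : seq (cand d N) :=
  [seq (p, x) | p <- [seq (j, tau) | j <- iota 1 k.-1, tau <- taus (d.+1 - j)], x <- iota 0 k].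

Definition bases : seq (seq (code d N) * nat) :=
  [seq (tau, l) | tau <- taus (d.+1 - k), l <- iota 0 d.+1].

(** The value 1 + |y - S_0|^2 bounds |y - S_0| without a square root, so it certifies the first k
    points as an initial output. *)
Definition initE := RAdd rone (rsum [seq RMul (RSub (RGet 1 (WC j)) (RGet 0 (WC j)))
  (RSub (RGet 1 (WC j)) (RGet 0 (WC j))) | j <- iota 0 d]).

Definition init := record [seq WC i | i <- iota 0 k] initE.

Definition program := seqs [:: init; powers;
  For vI (powE_ nE k.-1) (seqs [seq direct k c | c <- cands]);
  For vI (powE_ nE (k - 2)) (seqs [seq round k p.1 p.2 | p <- bases])].

Hypotheses (k_ge2 : (2 <= k)%N) (k_le_d : (k <= d)%N) (N_gt0 : (0 < N)%N).

Lemma mem_cands j tau x : ((j, tau, x) \in cands) =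
  [&& (0 < j < k)%N, size tau == (d.+1 - j)%N, all (in_net R (N := N)) tau & (x < k)%N].
Proof.
apply/allpairsP/and4P => [[[[j' tau'] x'] /= [/allpairsPdep[j1 [t1 [h1 h2 [-> ->]]]] h3 [-> -> ->]]]|].
  move: h1 h2 h3; rewrite !mem_iota mem_taus => h1 /andP[-> ->] h3; split=> //.
  by move: h1; rewrite add1n prednK // (leq_trans _ k_ge2).
move=> [h1 h2 h3 h4]; exists ((j, tau), x) => /=; rewrite mem_iota; split=> //.
apply/allpairsPdep; exists j, tau; rewrite mem_taus h2 h3 mem_iota; split=> //.
by rewrite add1n prednK // (leq_trans _ k_ge2).
Qed.

Lemma mem_bases tau l : ((tau, l) \in bases) =
  [&& size tau == (d.+1 - k)%N, all (in_net R (N := N)) tau & (l < d.+1)%N].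
Proof.
apply/allpairsP/and3P => [[[tau' l'] [h1 h2 [-> ->]]]|[h1 h2 h3]].
  by move: h1 h2; rewrite mem_taus mem_iota => /andP[-> ->].
by exists (tau, l); rewrite mem_taus mem_iota h1 h2.
Qed.

Variables (M n lg : nat) (S : n.-tuple 'rV[R]_d) (y : 'rV[R]_d).
Hypotheses (k_le_n : (k <= n)%N) (n_lt : (n < 2 ^ lg)%N) (M_big : (2 ^ lg.+1 < M)%N)
  (nd_lt : (n * d < M)%N) (d_lt : (d < M)%N) (N_lt : (2 * N < M)%N) (k_lt : (k < M)%N)
  (key_lt : (n ^ (d.+1 - k) < M)%N) (lev_lt : (lg.+1 ^ (d.+1 - k) < M)%N)
  (nk_lt : (n ^ k.-1 < M)%N).

Let n_gt0 : (0 < n)%N.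
Proof. by apply: leq_trans k_le_n; apply: leq_trans k_ge2. Qed.

Let n_ge2 : (2 <= n)%N := leq_trans k_ge2 k_le_n.

Local Notation good := (good_output (R := R) N k S y).

Lemma wp_init : wp M init (input S y) (fun t s' => (t <= 2 * k + 3)%N /\ Inv good s').
Proof.
have M_gt1 : (1 < M)%N by apply: leq_ltn_trans M_big; rewrite expn_gt0.
have hs : inputs S y (input S y) by [].
have v2 s' : reals s' = reals (input S y) ->
    reval M s' initE = 1 + enorm (y - S`_0) ^+ 2.
  move=> hr; transitivity (reval M s' rone + reval M s' (rsum
    [seq RMul (RSub (RGet 1 (WC j)) (RGet 0 (WC j)))
      (RSub (RGet 1 (WC j)) (RGet 0 (WC j))) | j <- iota 0 d])); first by [].
  rewrite (reval_one M_gt1) reval_rsum enorm_sqr; congr (_ + _).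
  have e (F : nat -> R) : \sum_(i <- iota 0 d) F i = \sum_(i < d) F i.
    by rewrite -(big_mkord xpredT F) /index_iota subn0.
  rewrite e; apply: eq_bigr => j _; rewrite [LHS]/= hr /=.
  have jd : (j %% M = j)%N by rewrite modn_small // (ltn_trans (ltn_ord j)).
  rewrite jd divn_small // modn_small // (insubT (fun i => (i < d)%N) (ltn_ord j)) !mxE -expr2.
  by congr ((y 0 _ - S`_0 0 _) ^+ 2); apply/val_inj.
have H := @wp_record R M (input S y) [seq WC i | i <- iota 0 k] initE.
apply: wp_mono (H _ _ _) => {H}.
- move=> t s'; rewrite size_map size_iota => -[ht ho hb]; split=> //.
  have bE : reals s' aBEST 0 = 1 + enorm (y - S`_0) ^+ 2 by rewrite hb v2.
  split; first by rewrite bE addr_ge0 // sqr_ge0.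
  have oE : [seq words s' 1 j | j <- iota 0 k] = iota 0 k.
    rewrite -[RHS]map_id; apply/eq_in_map => j; rewrite mem_iota => hj.
    by rewrite ho // (nth_map 0%N) ?size_iota // nth_iota //= modn_small // (ltn_trans _ k_lt).
  rewrite /good_output oE bE; split.
  + by apply/allP => i; rewrite mem_iota => /= hi; exact: leq_trans hi k_le_n.
  + exact: iota_uniq.
  apply: (@le_trans _ _ (enorm (y - S`_0))).
    apply: flat_dist_le; apply: (@affine_hull_comb _ _ _ [:: S`_0] _ (fun=> 1)).
      move=> z; rewrite inE => /eqP ->; apply: (map_f (fun i => S`_i)).
      by rewrite mem_iota; exact: leq_trans k_ge2.
    by rewrite big_ord1 scale1r.
  have e0 := enorm_ge0 (y - S`_0); set x := enorm _ in e0 *.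
  have h1 : x <= 1 + x ^+ 2 by nra.
  apply: (le_trans h1); rewrite ler_peMl ?ler1n //.
  by rewrite addr_ge0 // sqr_ge0.
- by rewrite size_map size_iota.
- by rewrite all_map; apply/allP.
- by move=> s' _ hr; rewrite !v2.
Qed.

Definition total_time := (2 * k + 3 + (4 * lg + 3) +
  (n ^ k.-1 * (size cands * (2 * k + 4).+1 + 4) + 3) +
  (n ^ (k - 2) * (size bases * (round_time d n k lg).+1 + 4) + 3) + 6)%N.

Lemma round_time_mono L : (L <= lg)%N -> (round_time d n k L <= round_time d n k lg)%N.
Proof.
move=> hL; rewrite /round_time.
have h : (L.+1 ^ (d.+1 - k) * (n * (4 * k + 49) + 14) <=
    lg.+1 ^ (d.+1 - k) * (n * (4 * k + 49) + 14))%N.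
  by rewrite leq_mul2r; apply/orP; right; case: (_ - _)%N => // e; rewrite leq_exp2r.
have h2 : (n * (10 * L + 40) <= n * (10 * lg + 40))%N.
  by rewrite leq_mul2l; apply/orP; right; clear -hL; lia.
have h3 : ((d.+1 - k) * (n * (10 * L + 40) + 8) <= (d.+1 - k) * (n * (10 * lg + 40) + 8))%N.
  by rewrite leq_mul2l; apply/orP; right; clear -h2; lia.
by clear -h h2 h3; lia.
Qed.

Lemma wp_program : wp M program (input S y) (fun t s' => [/\ (t <= total_time)%N, Inv good s',
  forall I c, (I < n ^ k.-1)%N -> c \in cands -> direct_ok k S y I c (reals s' aBEST 0) &
  forall I p (l_lt : (p.2 < d.+1)%N), (I < n ^ (k - 2))%N -> p \in bases ->
    round_ok k S y p.1 I l_lt (reals s' aBEST 0)]).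
Proof.
apply: wp_seq; apply: wp_mono (wp_frame wp_init) => t1 s1 [[ht1 i1] fr1].
have w1 a i : a != 1%N -> words s1 a i = words (input S y) a i.
  by move=> a1; rewrite fr1.1 //; apply: contra a1 => /wmod_record ->.
have r1 a i : (a < 2)%N -> reals s1 a i = reals (input S y) a i.
  by move=> ha; rewrite fr1.2 //; apply: contraTN ha => /rmod_record ->.
have hn1 : words s1 0 0 = n by rewrite w1.
have hL1 : words s1 vL 0 = 0%N by rewrite w1.
apply: wp_seq; apply: wp_mono (wp_frame (wp_powers n_lt M_big hn1 hL1)).
move=> t2 s2 [[ht2 [L [L_lg n_le envL2]]] fr2].
have ML : (2 ^ L.+1 < M)%N by apply: leq_ltn_trans M_big; rewrite leq_exp2l.
have levL : (L.+1 ^ (d.+1 - k) < M)%N.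
  by apply: leq_ltn_trans lev_lt; case: (_ - _)%N => // e; rewrite leq_exp2r.
have env2 : env L S y 0 s2.
  split=> //.
  - by split; [rewrite fr2.1|move=> a i ha; rewrite fr2.2 // r1].
  - by move=> x hx; rewrite fr2.1 // w1.
  - by rewrite fr2.1 // w1.
have i2 : Inv good s2.
  have e1 : words s2 1 = words s1 1 by apply/funext => i; rewrite fr2.1.
  by rewrite /Inv e1 fr2.2.
have nk2_lt : (n ^ (k - 2) < M)%N.
  apply: leq_ltn_trans nk_lt; rewrite leq_exp2l //; clear; lia.
apply: wp_seq.
have H3 := @wp_stage R M d N n k L S y _ (direct (N := N) (d := d) k) cands (2 * k + 4) k.-1
  (direct_ok k S y) s2 nk_lt.
apply: wp_mono (H3 _ _ _ i2) => {H3}; last 1 first.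
- by exists 0%N.
- move=> t3 s3 [ht3 env3 i3 b3 d3]; apply: wp_seq.
  have H4 := @wp_stage R M d N n k L S y _ (fun p => round (d := d) (N := N) k p.1 p.2)
    bases (round_time d n k lg) (k - 2)
    (fun I p beta => forall l_lt : (p.2 < d.+1)%N, round_ok k S y p.1 I l_lt beta) s3 nk2_lt.
  apply: wp_mono (H4 _ _ env3 i3) => {H4}.
  + move=> t4 s4 [ht4 env4 i4 b4 d4]; apply: wp_skip; split=> //.
    * move: ht1 ht2 ht3 ht4; rewrite /total_time.
      move: (n ^ k.-1 * _)%N (n ^ (k - 2) * _)%N => u v; clear; lia.
    * move=> I c hI hc dn cle un; apply: le_trans b4 _; exact: d3.
    * by move=> I p l_lt hI hp; apply: d4.
  + move=> I p b b' b0 bb ok l_lt.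
    move=> dn a q an qn ua uq le_gam.
    have hG : nGam k S y p.1 I l_lt a <= nGam k S y p.1 I l_lt q.
      by apply: nGam_le.
    have := ok l_lt dn a q an qn ua uq le_gam => h.
    have [le0|gt0] := leP 0 (nal k S y p.1 I l_lt q - nal k S y p.1 I l_lt a).
      by apply: le_trans h; rewrite ler_wpM2r.
    by apply: (@le_trans _ _ 0); [rewrite mulr_ge0_le0 // ltW|rewrite subr_ge0].
  + move=> [tau l] I s; rewrite mem_bases => /and3P[/eqP h1 h2 h3] envs is_.
    have Hr := wp_round k_ge2 k_le_d n_ge2 n_le ML nd_lt d_lt N_lt key_lt levL h1 h3 h2 k_lt envs is_.
    apply: wp_mono Hr => t5 s5 [ht5 env5 i5 b5 d5]; split=> //.
      exact: leq_trans ht5 (round_time_mono L_lg).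
- by move=> I c b b' b0 bb ok dn cle un; apply: le_trans bb _; exact: ok.
move=> [[j tau] x] I s; rewrite mem_cands => /and4P[/andP[h0 h1] /eqP h2 h3 h4] envs is_.
have hc : cand_ok R k (j, tau, x).
  split=> //=; rewrite h2 subnKC // (leq_trans (ltnW h1)) //.
  exact: leqW.
exact: (wp_direct k_ge2 k_le_n n_ge2 ML nd_lt d_lt N_lt k_lt hc envs is_).
Qed.

End Final.

(** * Every basis is met by the program *)

Section Correctness.
Variables (R : realType) (d N n k : nat) (S : n.-tuple 'rV[R]_d) (y : 'rV[R]_d) (beta : R).
Hypotheses (k_ge2 : (2 <= k)%N) (k_le_d : (k <= d)%N) (k_le_n : (k <= n)%N) (N_gt0 : (0 < N)%N).
Hypothesis all_direct : forall I c, (I < n ^ k.-1)%N -> c \in cands R d N k ->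
  direct_ok k S y I c beta.
Hypothesis all_rounds : forall I p (l_lt : (p.2 < d.+1)%N), (I < n ^ (k - 2))%N ->
  p \in bases R d N k -> round_ok k S y p.1 I l_lt beta.

Let pt (i : 'I_n) := S`_i.

Let sum_iota (F : nat -> R) r : \sum_(i <- iota 0 r) F i = \sum_(i < r) F i.
Proof. by rewrite -(big_mkord xpredT F) /index_iota subn0. Qed.

Lemma extend_indices (T : seq 'I_n) j : uniq T -> (size T <= j)%N -> (j <= n)%N ->
  exists U, uniq (T ++ U) /\ size (T ++ U) = j.
Proof.
move=> uT leT lej; pose rest := [seq i <- enum 'I_n | i \notin T].
have ur : uniq rest by rewrite seq.filter_uniq // enum_uniq.
have sr : (j - size T <= size rest)%N.
  rewrite leq_subLR; apply: (leq_trans lej).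
  have e : size (enum 'I_n) = (count (mem T) (enum 'I_n) + size rest)%N.
    by rewrite [size rest](_ : _ = count (predC (mem T)) (enum (ordinal n))) ?count_predC // /rest size_filter.
  rewrite -[leqLHS](size_enum_ord n) e.
  rewrite leq_add2r -size_filter; apply: uniq_leq_size.
    by rewrite seq.filter_uniq // enum_uniq.
  by move=> i; rewrite mem_filter => /andP[].
exists (take (j - size T) rest); split; last by rewrite size_cat size_takel // subnKC.
rewrite cat_uniq uT take_uniq // andbT; apply/hasPn => i /mem_take.
by rewrite mem_filter => /andP[].
Qed.

(** The indices of T are completed to k - 1 distinct ones, and by the pigeonhole principle some x <
    k is left as the last index; the distinctness test then lets this candidate through. *)
Lemma program_direct_bound T (tau : seq (code d N)) :
  uniq T -> (0 < size T < k)%N -> (size T + size tau = d.+1)%N ->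
  all (in_net R (N := N)) tau -> \det (rowsmx (brows pt T tau)) != 0 ->
  (forall i, (i < size tau)%N -> cf pt y T tau i <= 0) ->
  beta <= \sum_(i < size tau) - cf pt y T tau i.
Proof.
move=> uT /andP[T0 Tk] sz nt dn ce.
have leT : (size T <= k.-1)%N by rewrite -ltnS prednK // ltnW.
have [||U [uU sU]] := @extend_indices T k.-1 uT.
- exact: leT.
- by apply: leq_trans k_le_n; exact: leq_pred.
pose W := map (@nat_of_ord n) (T ++ U).
have uW : uniq W by rewrite map_inj_uniq //; exact: val_inj.
have sW : size W = k.-1 by rewrite size_map.
have [x x_lt xW] : exists2 x, (x < k)%N & x \notin W.
  have /hasP[x] : has (fun x => x \notin W) (iota 0 k).
    apply/negPn/negP => /hasPn h.
    have : (size (iota 0 k) <= size W)%N.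
      by apply: uniq_leq_size; [exact: iota_uniq|move=> x /h; rewrite negbK].
    by rewrite size_iota sW; clear -k_ge2; lia.
  by rewrite mem_iota => hx nx; exists x.
have aW : all (fun i => i < n)%N W by apply/allP => _ /mapP[i _ ->].
(* The loop index at which this tuple is met. *)
have [I I_lt IW] := @dig_surj n (fun i => nth 0%N W i) k.-1 (fun i (hi : (i < k.-1)%N) =>
  allP aW _ (mem_nth 0%N (leq_trans hi (eq_leq (esym sW))))).
have pre j : (j <= k.-1)%N -> nprefix n I j = take j W.
  move=> hj; apply: (@eq_from_nth _ 0%N); first by rewrite size_mkseq size_takel ?sW.
  move=> i; rewrite size_mkseq => hi.
  by rewrite nth_mkseq // IW ?nth_take // (leq_trans hi hj).
have preT : nprefix n I (size T) = map (@nat_of_ord n) T.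
  rewrite pre //.
  by rewrite /W map_cat take_size_cat // size_map.
have XE : dX S I (size T, tau, x) = brows pt T tau by rewrite /dX preT -map_comp.
have cE i : ncf S y I (size T, tau, x) i = cf pt y T tau i by rewrite /ncf XE.
have hc : (size T, tau, x) \in cands R d N k.
  rewrite mem_cands // T0 Tk nt x_lt !andbT /=; by rewrite -sz addKn.
have dn' : \det (rowsmx (dX S I (size T, tau, x))) != 0 by rewrite XE.
have ce' i : (i < size tau)%N -> ncf S y I (size T, tau, x) i <= 0 by move=> hi; rewrite cE ce.
have un : uniq (nprefix n I k.-1 ++ [:: x]).
  by rewrite pre // take_oversize ?sW // cat_uniq uW /= orbF xW.
have := all_direct I_lt hc dn' ce' un; rewrite sum_iota.
by under eq_bigr => i _ do rewrite cE.
Qed.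

Lemma program_pair_bound T0 (tau : seq (code d N)) (j : 'I_d.+1) a p :
  size T0 = (k - 2)%N -> size tau = (d.+1 - k)%N -> all (in_net R (N := N)) tau ->
  let w := delta_mx 0 j : 'rV[R]_d.+1 in
  \det (rowsmx (mrows pt y T0 tau w)) != 0 ->
  pu pt y T0 tau w a != 0 -> pu pt y T0 tau w p != 0 ->
  (forall i, (i < size tau)%N -> pgam pt y T0 tau w i a <= pgam pt y T0 tau w i p) ->
  beta * (pal pt y T0 tau w p - pal pt y T0 tau w a) <=
    pGam pt y T0 tau w p - pGam pt y T0 tau w a.
Proof.
case: j => l l_lt sT st nt w dn ua up le_gam.
pose W := map (@nat_of_ord n) T0.
have aW : all (fun i => i < n)%N W by apply/allP => _ /mapP[i _ ->].
have sW : size W = (k - 2)%N by rewrite size_map.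
have [I I_lt IW] := @dig_surj n (fun i => nth 0%N W i) (k - 2) (fun i (hi : (i < k - 2)%N) =>
  allP aW _ (mem_nth 0%N (leq_trans hi (eq_leq (esym sW))))).
have baseE : base n k I = W.
  apply: (@eq_from_nth _ 0%N); first by rewrite size_mkseq.
  by move=> i; rewrite size_mkseq => hi; rewrite nth_mkseq // IW.
have XE : nX k S y tau I l_lt = mrows pt y T0 tau w.
  by rewrite /nX baseE /mrows /brows -map_comp.
have hp : (tau, l) \in bases R d N k by rewrite mem_bases st eqxx nt.
have uE i : nu k S y tau I l_lt i = cramer (mrows pt y T0 tau w) (size T0 + size tau + 1) (hat S`_i).
  by rewrite /nu XE sT st.
have aE (q : 'I_n) : nal k S y tau I l_lt q = pal pt y T0 tau w q.
  by rewrite /nal uE XE -sT -st.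
have gE i (q : 'I_n) : ngam k S y tau I l_lt i q = pgam pt y T0 tau w i q.
  by rewrite /ngam uE XE -sT.
have GE (q : 'I_n) : nGam k S y tau I l_lt q = pGam pt y T0 tau w q.
  by rewrite /nGam /pGam sum_iota st; apply: eq_bigr => i _; rewrite gE.
have := @all_rounds I (tau, l) l_lt I_lt hp; rewrite /round_ok /= XE => /(_ dn a p).
rewrite !uE !aE !GE; apply=> // i hi.
by rewrite !gE le_gam // st.
Qed.

Lemma program_bound q : k_points k S q ->
  N%:R * beta <= (1 + d%:R / N%:R) * flat_dist y (affine_hull q).
Proof.
move=> /and3P[/eqP sq uq /allP qS].
pose ix := fun x : 'rV[R]_d => index x S.
have ix_lt x : x \in q -> (ix x < n)%N.
  by move=> /qS; rewrite -index_mem size_tuple.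
have n_gt0 : (0 < n)%N by apply: leq_trans k_le_n; apply: leq_trans k_ge2.
pose s := [seq (insubd (Ordinal n_gt0) (ix x) : 'I_n) | x <- q].
have ptE x : x \in q -> pt (insubd (Ordinal n_gt0) (ix x)) = x.
  by move=> xq; rewrite /pt val_insubd ix_lt // nth_index // qS.
have qE : q = map pt s.
  by rewrite -map_comp -[LHS]map_id; apply/eq_in_map => x hx /=; rewrite ptE.
rewrite qE; apply: (bound_dist N_gt0 k_ge2 k_le_d program_direct_bound program_pair_bound).
  by apply: (@map_uniq _ _ pt); rewrite -qE.
by rewrite size_map.
Qed.

End Correctness.

Lemma reach_halted (R : realType) M (s : state R) cf :
  reach M ([::], s) cf -> cf = ([::], s).
Proof.
move e : ([::], s) => cf0 h; elim: h e => [//|cf1 r cf2 _ _ IH e].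
by move: IH; rewrite -e; exact.
Qed.

(** * Word length and running time *)

Section Bounds.
Variables (n d k N : nat).
Hypothesis n_ge2 : (2 <= n)%N.

(** Words of this many bit lengths of n have room for the constants d, k and 2N, the offsets below n
    * d, the tuple counts, the group keys and the number of level tuples. *)
Definition word_factor := (d + k + 2 * N + 10)%N.
Definition bit_length := (trunc_log 2 n).+1.
Local Notation lg := bit_length.
Local Notation M := (word_modulus word_factor n).

Lemma ltn_bit_length : (n < 2 ^ lg)%N.
Proof. exact: trunc_log_ltn. Qed.

Lemma bit_length_ge2 : (2 <= lg)%N.
Proof. by rewrite ltnS trunc_log_gt0. Qed.

Let pow_lt e : (e < word_factor)%N -> (2 ^ (e * lg) < M)%N.
Proof. by move=> he; rewrite ltn_exp2l // ltn_pmul2r. Qed.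

Let expn_lt x e : (x <= 2 ^ lg)%N -> (e < word_factor)%N -> (x ^ e < M)%N.
Proof.
move=> hx he; apply: leq_ltn_trans (pow_lt he); rewrite mulnC expnM.
by case: e {he} => // e; rewrite leq_exp2r.
Qed.

Let const_lt x : (x < word_factor)%N -> (x < M)%N.
Proof.
move=> hx; apply: leq_ltn_trans (pow_lt hx); apply: ltnW; apply: (@leq_trans (2 ^ x)).
  exact: ltn_expl.
by rewrite leq_exp2l // leq_pmulr.
Qed.

Lemma word_modulus_bounds :
  [/\ (2 ^ lg.+1 < M)%N, (n * d < M)%N, (d < M)%N, (2 * N < M)%N & (k < M)%N] /\
  [/\ (n ^ (d.+1 - k) < M)%N, (lg.+1 ^ (d.+1 - k) < M)%N & (n ^ k.-1 < M)%N].
Proof.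
have hn := ltnW ltn_bit_length.
split; split.
- apply: leq_ltn_trans (@pow_lt 2 _); last by rewrite /word_factor; clear; lia.
  by rewrite leq_exp2l // mul2n -addnn -addn1 leq_add2l.
- apply: leq_ltn_trans (@pow_lt d.+1 _); last by rewrite /word_factor; clear; lia.
  rewrite mulSn expnD leq_mul //; apply: ltnW; apply: (@leq_trans (2 ^ d)).
    exact: ltn_expl.
  by rewrite leq_exp2l // leq_pmulr.
- by apply: const_lt; rewrite /word_factor; clear; lia.
- by apply: const_lt; rewrite /word_factor; clear; lia.
- by apply: const_lt; rewrite /word_factor; clear; lia.
- by apply: expn_lt => //; rewrite /word_factor; clear; lia.
- by apply: expn_lt; [exact: ltn_expl|rewrite /word_factor; clear; lia].
- by apply: expn_lt => //; rewrite /word_factor; clear; lia.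
Qed.

(** The left side is t + 2 with t the truncated binary logarithm; t >= 1 as n >= 2, so t + 2 <= 3
    t. *)
Lemma bit_length_le_ln (R : realType) : lg.+1%:R <= 3 / ln 2 * ln n%:R :> R.
Proof.
have ln2 : 0 < ln 2 :> R by rewrite ln_gt0 // ltr1n.
have n_gt0 : 0 < n%:R :> R by rewrite ltr0n ltnW.
have h1 : (2 ^ trunc_log 2 n <= n)%N by apply: trunc_logP => //; exact: ltnW.
have h2 : ln 2 * (trunc_log 2 n)%:R <= ln n%:R :> R.
  rewrite mulrC mulr_natl -lnXn // ler_ln ?posrE // ?exprn_gt0 //.
  by rewrite -natrX ler_nat.
rewrite mulrAC ler_pdivlMr //.
apply: (@le_trans _ _ (3 * (ln 2 * (trunc_log 2 n)%:R))); last by rewrite ler_pM2l.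
rewrite mulrCA [leLHS]mulrC ler_pM2l // -natrM ler_nat.
by move: (bit_length_ge2); rewrite /bit_length; clear; lia.
Qed.

End Bounds.

Section TimeBound.
Variables (R : realType) (d k N : nat).
Hypotheses (k_ge2 : (2 <= k)%N).

Let m := (d.+1 - k)%N.

Definition time_factor :=
  (2 * k + 3 + 7 + (size (cands R d N k) * (2 * k + 4).+1 + 7) +
   (size (bases R d N k) * (60 * m + 4 * k + 149) + 7) + 6)%N.

(** Sorting contributes one logarithmic factor and the levels m of them; both are absorbed by the
    power m + 1. *)
Lemma total_time_le n lg : (0 < n)%N ->
  (total_time R d N k n lg <= time_factor * (n ^ k.-1 * lg.+1 ^ m.+1))%N.
Proof.
move=> n0; rewrite /total_time /round_time /time_factor -/m expnS.
have -> : (n ^ k.-1 = n * n ^ (k - 2))%N.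
  by rewrite -expnS; congr (_ ^ _)%N; clear -k_ge2; lia.
have u0 : (0 < lg.+1)%N by [].
have v0 : (0 < lg.+1 ^ m)%N by rewrite expn_gt0.
have p0 : (0 < n ^ (k - 2))%N by rewrite expn_gt0 n0.
move: (size (cands R d N k)) (size (bases R d N k)) v0 p0 => A B.
have -> : (10 * lg + 40 = 10 * lg.+1 + 30)%N by clear; lia.
have -> : (4 * lg + 3 = 4 * lg.+1 - 1)%N by clear; lia.
move: (lg.+1)%N (lg.+1 ^ m)%N (n ^ (k - 2))%N u0 => u v p u0 v0 p0.
have huv : (v <= u * v)%N by rewrite leq_pmull.
have huv2 : (u <= u * v)%N by rewrite leq_pmulr.
move: (u * v)%N huv huv2 => w vw uw.
have w0 : (0 < w)%N by exact: leq_trans vw.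
have h1 : ((n * (2 * m + 15) + 3 + (m * (n * (10 * u + 30) + 8) + 1) +
    (n * (10 * u + 30) + 7) + (v * (n * (4 * k + 49) + 14) + 3) + 6).+1 <=
   (60 * m + 4 * k + 149) * (n * w))%N.
  have a1 : (n <= n * w)%N by rewrite leq_pmulr.
  have a2 : (n * (10 * u + 30) <= 40 * (n * w))%N.
    by rewrite [leqRHS]mulnCA leq_mul2l; apply/orP; right; clear -uw w0; lia.
  have a3 : (v * (n * (4 * k + 49) + 14) <= (4 * k + 63) * (n * w))%N.
    apply: (@leq_trans (w * (n * (4 * k + 63)))%N); last by clear; nia.
    by rewrite leq_mul //; clear -n0; nia.
  have a4 : (0 < n * w)%N by rewrite muln_gt0 n0.
  have a5 : (m * (n * (10 * u + 30) + 8) <= 48 * m * (n * w))%N.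
    apply: (@leq_trans (m * (48 * (n * w)))%N); last by clear; nia.
    by rewrite leq_mul2l; apply/orP; right; clear -a2 a4; lia.
  have a6 : (n * (2 * m + 15) <= (2 * m + 15) * (n * w))%N by rewrite mulnC leq_mul2l a1 orbT.
  move: (n * (10 * u + 30))%N (v * _)%N (m * _)%N (n * (2 * m + 15))%N a1 a2 a3 a4 a5 a6.
  move: (n * w)%N => X x1 x2 x3 x4; clear; nia.
move: (_.+1) (60 * m + 4 * k + 149)%N h1 => r c h1.
have a1 : (n * p <= n * p * w)%N by rewrite leq_pmulr.
have X0 : (0 < n * p * w)%N by rewrite !muln_gt0 n0 p0.
have a2 : (u <= n * p * w)%N by apply: leq_trans uw _; rewrite leq_pmull // muln_gt0 n0.
have a3 : (p * r <= c * (n * p * w))%N.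
  by rewrite (_ : c * (n * p * w) = p * (c * (n * w)))%N ?leq_mul2l ?h1 ?orbT //; clear; lia.
have a4 : (p <= n * p * w)%N by rewrite mulnAC -[leqLHS]mul1n leq_mul2r muln_gt0 n0 w0 orbT.
move: (n * p * w)%N a1 X0 a2 a3 a4 => X + X0 X2 X3 X4; move: (n * p)%N => x X1.
move: (2 * k + 4).+1 => e.
have b1 : (x * (A * e + 4) <= (A * e + 4) * X)%N by rewrite mulnC leq_mul2l X1 orbT.
have b2 : (p * (B * r + 4) <= (B * c + 4) * X)%N.
  have : (B * (p * r) <= B * (c * X))%N by rewrite leq_mul2l X3 orbT.
  rewrite mulnDr mulnDl -mulnA mulnCA [(p * 4)%N]mulnC; clear -X4; lia.
have b3 : (2 * k <= 2 * k * X)%N by rewrite leq_pmulr.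
move: (x * (A * e + 4))%N (p * (B * r + 4))%N b1 b2 => x1 x2 b1 b2; move: (A * e)%N (B * c)%N (2 * k)%N b1 b2 b3 => x3 x4 x5.
by rewrite !mulnDl; clear -X0 X2; lia.
Qed.

End TimeBound.

Lemma flat_dist_ge0 (R : realType) (d : nat) (y : 'rV[R]_d) F : 0 <= flat_dist y F.
Proof.
rewrite /flat_dist; set E := (X in inf X).
have [->|/set0P E0] := eqVneq E set0; first by rewrite inf0.
by apply: lb_le_inf => // _ [x _ <-]; exact: enorm_ge0.
Qed.

Theorem theorem2 (R : realType) (eps : R) (d k : nat)
    (heps : 0 < eps) (hk2 : (2 <= k)%N) (hkd : (k <= d)%N) :
  exists (b : nat) (P : cmd), (0 < b)%N /\
  (* every halting run is correct *)
  (forall (n : nat) (S : n.-tuple 'rV[R]_d) (y : 'rV[R]_d),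
     (k <= n)%N -> uniq S ->
     forall s : state R,
     reach (word_modulus b n) ([:: P], input S y) ([::], s) ->
     let idx := output_indices k s in
     let q := [seq S`_i | i <- idx] in
     [/\ all (fun i => i < n)%N idx,
         k_points k S q
       & forall q' : seq 'rV[R]_d, k_points k S q' ->
           flat_dist y (affine_hull q)
             <= (1 + eps) * flat_dist y (affine_hull q')]) /\
  (* the time bound holds with high probability *)
  (forall c : nat, exists2 C : R, 0 < C &
     forall (n : nat) (S : n.-tuple 'rV[R]_d) (y : 'rV[R]_d),
     (k <= n)%N -> uniq S ->
     exists2 t : nat,
       t%:R <= C * n%:R ^+ (k - 1) * ln n%:R ^+ (d - k + 2)
       & 1 - n%:R ^- c
           <= prob_halt (word_modulus b n) t ([:: P], input S y)).
Proof.
(* Chosen so that the loss d / N of the net is at most [eps]. *)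
pose N := (Num.truncn (d%:R / eps)).+1.
have N_gt : d%:R / eps < N%:R by exact: truncnS_gt.
have dN : d%:R / N%:R <= eps.
  by rewrite ler_pdivrMr ?ltr0n // mulrC -ler_pdivrMr // ltW.
exists (word_factor d k N), (program R d N k); split; first by rewrite /word_factor addn_gt0 orbT.
(* One forced run carries both certificates: N times the best value bounds the distance for the
   output from above, and the distance for every choice of k points from below up to 1 + d / N. *)
have main (n : nat) (S : n.-tuple 'rV[R]_d) (y : 'rV[R]_d) : (k <= n)%N ->
    exists t s, [/\ dpath (word_modulus (word_factor d k N) n) t
        ([:: program R d N k], input S y) ([::], s),
      (t <= time_factor R d k N * (n ^ k.-1 * (bit_length n).+1 ^ (d.+1 - k).+1))%N,
      good_output N k S y (words s 1) (reals s aBEST 0) &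
      forall q, k_points k S q -> N%:R * reals s aBEST 0 <=
        (1 + d%:R / N%:R) * flat_dist y (affine_hull q)].
  move=> kn; have n2 : (2 <= n)%N by exact: leq_trans kn.
  have [[m1 m2 m3 m4 m5] [m6 m7 m8]] := word_modulus_bounds n d k N.
  have [t [s [ex [ht [_ i1] h1 h2]]]] := wp_program hk2 hkd (ltn0Sn _ : (0 < N)%N) S y kn (ltn_bit_length n) m1 m2 m3 m4 m5 m6 m7 m8.
  exists t, s; split=> //.
  - by apply: leq_trans ht _; apply: total_time_le => //; exact: ltnW.
  - by move=> q; apply: (@program_bound R d N n k S y) => //; exact: h2.
split.
- move=> n S y kn uS s hr; have [t [s' [ex _ gd bd]]] := main n S y kn.
  (* Any halting run ends in the final state of the forced one. *)
  have {hr} [->] := reach_halted (dpath_reach ex hr).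
  rewrite /output_indices /=; case: gd => g1 g2 g3; split=> //.
    apply/and3P; split; first by rewrite !size_map size_iota.
      rewrite map_inj_in_uniq // => i j /(allP g1) hi /(allP g1) hj /eqP.
      by rewrite nth_uniq ?size_tuple // => /eqP.
    by apply/allP => _ /mapP[i /(allP g1) hi ->]; rewrite mem_nth ?size_tuple.
  move=> q' kq; apply: le_trans g3 _; apply: (le_trans (bd _ kq)).
  by apply: ler_wpM2r; [exact: flat_dist_ge0|rewrite lerD2l].
move=> c.
pose D := time_factor R d k N; pose a : R := 3 / ln 2.
have a_gt0 : 0 < a by rewrite divr_gt0 // ln_gt0 // ltr1n.
exists (D%:R * a ^+ (d - k + 2)).
  rewrite mulr_gt0 ?exprn_gt0 // ltr0n /D /time_factor; clear; lia.
move=> n S y kn uS; have [t [s [ex ht _ _]]] := main n S y kn.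
have n2 : (2 <= n)%N by exact: leq_trans kn.
(* The halting probability within [t] is 1, which exceeds the required bound for every [c]; the
   constant therefore need not depend on [c]. *)
exists t; last first.
  by rewrite (dpath_prob_halt ex) gerBl invr_ge0 exprn_ge0.
apply: (@le_trans _ _ (D * (n ^ k.-1 * (bit_length n).+1 ^ (d.+1 - k).+1))%:R).
  by rewrite ler_nat.
rewrite natrM natrM !natrX -subn1 subSn // -addn2.
rewrite -!mulrA ler_wpM2l // [leRHS]mulrCA ler_wpM2l ?exprn_ge0 //.
rewrite -exprMn lerXn2r ?nnegrE ?ler0n ?(bit_length_le_ln n2) //.
by rewrite mulr_ge0 ?(ltW a_gt0) // ln_ge0 // ler1n ltnW.
Qed.
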